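(* There exist positive absolute constants $b_2,C_3,C_4$ such that the following holds. Let $\Sigma$, $\mathbf u^*$, $\lambda_1>\lambda_2\ge\dots\ge\lambda_d\ge0$ and the samples $X^{(1)},X^{(2)},\ldots$ be as in the context, and let $\mathbf u^{(0)}$ be sampled uniformly from the unit sphere $\mathcal S^{d-1}$, independently of the samples. Then for any $\varepsilon\in(0,1/8)$, $\beta>0$, $\delta>0$ satisfying $$d\,[\lambda_1^2(\lambda_1-\lambda_2)^{-1}\beta]^{1-2\varepsilon}\le b_2\delta^2\quad\text{and}\quad 4dN^*_{\beta,2}\exp\left(-C_3[\lambda_1^2(\lambda_1-\lambda_2)^{-1}\beta]^{-2\varepsilon}\right)\le\delta,$$ there exists an event $\mathcal A_*$ with $\mathbb P(\mathcal A_* )\ge1-2\delta$ such that the iterates $\mathbf u^{(n)}$ of the online PCA algorithm with stepsize $\beta$ satisfy, for all integers $n\in[N^*_{\beta,2},N^*_{\beta,3}]$, $$\mathbb E\left[\tan^2\angle(\mathbf u^{(n)},\mathbf u^* );\mathcal A_*\right]\le C_4\delta^{-4}d^2\left(1-\beta(\lambda_1-\lambda_2)\right)^{2n}+C_4\sum_{k=2}^d\frac{\lambda_1\lambda_k+\lambda_1^2\left[\lambda_1^2(\lambda_1-\lambda_2)^{-1}\beta\right]^{0.5-4\varepsilon}}{\lambda_1-\lambda_k}\cdot\beta .$$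
   Context: Notation: $\|\cdot\|$ is the Euclidean norm, $\mathcal S^{d-1}=\{\mathbf u\in\mathbb R^d:\|\mathbf u\|=1\}$, $\angle(\mathbf u,\mathbf w)=\arccos(\mathbf u^\top\mathbf w)\in[0,\pi]$ for unit vectors, $\mathbb E[X;\mathcal A]=\mathbb E[X\mathbf 1_{\mathcal A}]$, $\lceil x\rceil$ is the smallest integer $\ge x$. ''Absolute constant'' means independent of all other quantities (dimension, distribution, stepsize, etc.). For a real random variable $Y$, $\|Y\|_{\psi_2}=\sup_{p\ge1}p^{-1/2}(\mathbb E|Y|^p)^{1/p}$. Data: $\Sigma\in\mathbb R^{d\times d}$ is symmetric positive semidefinite with eigenvalues $\lambda_1>\lambda_2\ge\dots\ge\lambda_d\ge0$, and $\mathbf u^*$ is a unit eigenvector for $\lambda_1$. $Z\in\mathbb R^d$ is a random vector with $\mathbb E[Z]=0$, $\mathbb E[ZZ^\top]=\mathbf I_d$ and $\sup_{\mathbf v\in\mathcal S^{d-1}}\|\mathbf v^\top Z\|_{\psi_2}\le1$. The samples $X^{(1)},X^{(2)},\ldots$ are i.i.d. copies of $X=\Sigma^{1/2}Z$, where $\Sigma^{1/2}$ is the symmetric positive semidefinite square root of $\Sigma$. Online PCA algorithm with stepsize $\beta>0$: starting from $\mathbf u^{(0)}\in\mathcal S^{d-1}$, for $n\ge1$, $\mathbf u^{(n)}=\Pi\{\mathbf u^{(n-1)}+\beta X^{(n)}(X^{(n)})^\top\mathbf u^{(n-1)}\}$, where $\Pi\mathbf w=\mathbf w/\|\mathbf w\|$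 for $\mathbf w\ne0$. Rescaled time: for $s>0$, $$N^*_{\beta,s}=\left\lceil\frac{s\log(\lambda_1^{-2}(\lambda_1-\lambda_2)\beta^{-1})}{-\log(1-\beta(\lambda_1-\lambda_2))}\right\rceil.$$ *)

(* Defs.v *)
From HB Require Import structures.
From mathcomp Require Import all_boot all_order all_algebra finmap.
From mathcomp Require Import all_classical all_reals all_analysis.

Set Implicit Arguments.
Unset Strict Implicit.
Unset Printing Implicit Defensive.

Import Order.TTheory GRing.Theory Num.Theory.
Import numFieldNormedType.Exports.

Local Open Scope classical_set_scope.
Local Open Scope ring_scope.

(* Matrices carry the sigma-algebra generated by their entries; for real
   entries this is the Borel sigma-algebra of the Euclidean topology. *)
Definition measure_matrix_display : measure_display -> measure_display.
Proof. exact. Qed.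

Section measurable_matrix.
Context {d : measure_display} {T : measurableType d} (m n : nat).

Definition matrix_measurable : set (set 'M[T]_(m, n)) :=
  <<s \bigcup_(ij : 'I_m * 'I_n)
        preimage_set_system setT (fun M : 'M[T]_(m, n) => M ij.1 ij.2)
          measurable >>.

Let matrix_set0 : matrix_measurable set0.
Proof. exact: sigma_algebra0. Qed.

Let matrix_setC A : matrix_measurable A -> matrix_measurable (~` A).
Proof. exact: sigma_algebraC. Qed.

Let matrix_bigcup (F : (set 'M[T]_(m, n))^nat) :
  (forall i, matrix_measurable (F i)) -> matrix_measurable (\bigcup_i F i).
Proof. exact: sigma_algebra_bigcup. Qed.

HB.instance Definition _ := @isMeasurable.Build (measure_matrix_display d)
  'M[T]_(m, n) matrix_measurable matrix_set0 matrix_setC matrix_bigcup.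

End measurable_matrix.

Section euclidean.
Context {R : realType} {d : nat}.
Implicit Types u v w : 'cV[R]_d.

Definition dotp u v : R := (u^T *m v) 0 0.

(* The library's norm on matrices is the max norm. *)
Definition enorm v : R := Num.sqrt (dotp v v).

Definition unit_sphere : set 'cV[R]_d := [set v | enorm v = 1].

Definition proj_sphere w : 'cV[R]_d := (enorm w)^-1 *: w.

Definition angle u v : R := acos (dotp u v).

(* tan^2 with its limit value +oo where the cosine vanishes: the library's
   real-valued tan is 0 there. *)
Definition sqr_tan (theta : R) : \bar R :=
  if cos theta == 0 then +oo%E else (tan theta ^+ 2)%:E.

Definition sym_psd (S : 'M[R]_d) : Prop :=
  S^T = S /\ forall v, 0 <= dotp v (S *m v).

Definition is_psd_sqrt (S Sigma : 'M[R]_d) : Prop :=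
  sym_psd S /\ S *m S = Sigma.

Definition spectrum_of (Sigma : 'M[R]_d) (lam : d.-tuple R) : Prop :=
  sorted >=%R lam /\ char_poly Sigma = \prod_(x <- lam) ('X - x%:P).

End euclidean.

Section random_vectors.
Context {R : realType}.
Local Open Scope ereal_scope.

Definition psi2_norm (disp : measure_display) (T : measurableType disp)
    (P : probability T R) (Y : T -> R) : \bar R :=
  ereal_sup [set (p `^ (- 2^-1))%:E * 'N[P]_(p%:E)[EFin \o Y]
            | p in [set p : R | (1 <= p)%R]].

(* An expectation equal to a finite value forces integrability, since an
   undefined difference of infinite integrals evaluates to -oo. *)
Definition isotropic_subgaussian (disp : measure_display)
    (T : measurableType disp) (P : probability T R) (d : nat)
    (Z : T -> 'cV[R]_d) : Prop :=
  [/\ forall i, 'E_P[fun w => Z w i 0%R] = 0,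
      forall i j, 'E_P[fun w => (Z w *m (Z w)^T)%R i j]
                  = ((1%:M : 'M[R]_d) i j)%:E
    & ereal_sup [set psi2_norm P (fun w => dotp v (Z w)) | v in unit_sphere]
      <= 1].

Definition same_law (disp1 disp2 disp : measure_display)
    (T1 : measurableType disp1) (T2 : measurableType disp2)
    (S : measurableType disp)
    (P1 : probability T1 R) (Y1 : T1 -> S)
    (P2 : probability T2 R) (Y2 : T2 -> S) : Prop :=
  forall B, measurable B -> pushforward P1 Y1 B = pushforward P2 Y2 B.

Definition mutually_independent (disp disp' : measure_display)
    (T : measurableType disp) (S : measurableType disp')
    (P : probability T R) (I : choiceType) (X : I -> T -> S) : Prop :=
  forall (J : {fset I}) (B : I -> set S), (forall i, measurable (B i)) ->
    P (\bigcap_(i in [set` J]) X i @^-1` B i)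
    = \prod_(i <- J) P (X i @^-1` B i).

Definition generated_sigma_algebra (disp disp' : measure_display)
    (T : measurableType disp) (S : measurableType disp')
    (I : Type) (X : I -> T -> S) : set (set T) :=
  <<s \bigcup_i preimage_set_system setT (X i) measurable >>.

Definition independent_of_family (disp disp' : measure_display)
    (T : measurableType disp) (S : measurableType disp')
    (P : probability T R) (Y : T -> S) (I : Type) (X : I -> T -> S) : Prop :=
  forall B E, measurable B -> generated_sigma_algebra X E ->
    P ((Y @^-1` B) `&` E) = P (Y @^-1` B) * P E.

(* The uniform law on the unit sphere: the rotation-invariant probability
   measure carried by it. *)
Definition uniform_on_sphere (disp : measure_display)
    (T : measurableType disp) (P : probability T R) (d : nat)
    (u : T -> 'cV[R]_d) : Prop :=
  P (u @^-1` unit_sphere) = 1 /\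
  forall Q : 'M[R]_d, (Q *m Q^T = 1%:M)%R ->
    same_law P (fun w => (Q *m u w)%R) P u.

End random_vectors.

Section online_pca.
Context {R : realType}.

(* Samples are indexed from 0: X n is the (n+1)-st sample. *)
Fixpoint online_pca (T : Type) (d : nat) (beta : R) (X : nat -> T -> 'cV[R]_d)
    (u0 : T -> 'cV[R]_d) (n : nat) (w : T) : 'cV[R]_d :=
  if n is n'.+1 then
    let u := online_pca beta X u0 n' w in
    proj_sphere (u + beta *: (X n' w *m (X n' w)^T *m u))
  else u0 w.

Definition rescaled_time (lam1 lam2 beta s : R) : int :=
  Num.ceil (s * ln (lam1 ^- 2 * (lam1 - lam2) * beta^-1)
            / - ln (1 - beta * (lam1 - lam2))).

End online_pca.

(* Main.v *)
Require Import Defs.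
From HB Require Import structures.
From mathcomp Require Import all_boot all_order all_algebra finmap.
From mathcomp Require Import all_classical all_reals all_analysis.
From mathcomp Require Import measurable_realfun ring lra.

Set Implicit Arguments.
Unset Strict Implicit.
Unset Printing Implicit Defensive.

Import Order.TTheory GRing.Theory Num.Theory.
Import numFieldNormedType.Exports.

Local Open Scope classical_set_scope.
Local Open Scope ring_scope.

(* After diagonalising Sigma with first basis vector u*, write the iterate in the
   eigenbasis and drop the projections: this only changes a scalar factor, and
   tan^2 of the angle is the squared norm of the coordinates k >= 2 divided by
   the square of the first one. Rescale so that the first coordinate starts at 1
   and contract by 1 / (1 + beta lam_1) at each step; its expectation is then
   constant.

   A uniform starting point satisfies |<u*, u0>| > delta / (216 sqrt n), where
   n = d - 1, with probability at least 1 - delta. From there the potential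
   (y_1 - 1)^2 + kap (sum_(k >= 2) y_k^2 + tau), raised to a power of order
   ln (1 / r) with r = lam_1^2 beta / (lam_1 - lam_2), is a supermartingale while
   |y_1 - 1| <= 1/2, so y_1 leaves [1/2, 3/2] before time N*_(beta,3) with
   probability at most delta. On the complementary event A_* the denominator of
   tan^2 is at least 1/4, and the second moments of the killed chain satisfy a
   linear recursion that yields the bound. If delta >= 1/2, A_* is empty. *)

(** * Orthogonal diagonalisation *)

(** The obstacle is that the noise in the first coordinate [y_1] is multiplicative: with
    [b = beta lam_1], its variance in one step is only bounded by a multiple of [b^2 |y|^2], and
    [|y|^2] may start as large as [n / delta^2]. The contraction of the tail, at rate
    [x = beta (lam_1 - lam_2)], has to pay for it, which fixes the weight [kap], of order
    [p b^2 / x = p r]. The step-size conditions make the initial potential smaller than an absolute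
    constant only, whereas the exit probability must be at most [delta], so Markov's inequality for
    the potential itself does not suffice. For its [p]-th power with [p >= ln (1 / r)] it gives
    [exp (- p) <= r <= delta]. A finite power replaces the usual exponential supermartingale because
    the increments are controlled by fourth powers of subgaussian variables: their [k]-th moments
    grow like [k^(2k)] and yield no exponential moment. The power may be as large as [ln (1 / r)]
    because [p^8 x] is still small. *)

Section linear_algebra.
Context {R : realType}.

Lemma dotpE d (u v : 'cV[R]_d) : dotp u v = \sum_i u i 0 * v i 0.
Proof. by rewrite /dotp mxE; apply: eq_bigr => i _; rewrite mxE. Qed.

Lemma dotpC d (u v : 'cV[R]_d) : dotp u v = dotp v u.
Proof. by rewrite !dotpE; apply: eq_bigr => i _; rewrite mulrC. Qed.

Lemma dotpDl d (u v w : 'cV[R]_d) : dotp (u + v) w = dotp u w + dotp v w.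
Proof. by rewrite /dotp linearD mulmxDl mxE. Qed.

Lemma dotpZl d a (u v : 'cV[R]_d) : dotp (a *: u) v = a * dotp u v.
Proof. by rewrite /dotp linearZ -scalemxAl mxE. Qed.

Lemma dotpBl d (u v w : 'cV[R]_d) : dotp (u - v) w = dotp u w - dotp v w.
Proof. by rewrite /dotp linearB mulmxBl !mxE. Qed.

Lemma dotpDr d (u v w : 'cV[R]_d) : dotp w (u + v) = dotp w u + dotp w v.
Proof. by rewrite !(dotpC w) dotpDl. Qed.

Lemma dotpZr d a (u v : 'cV[R]_d) : dotp u (a *: v) = a * dotp u v.
Proof. by rewrite !(dotpC u) dotpZl. Qed.

Lemma dotpBr d (u v w : 'cV[R]_d) : dotp w (u - v) = dotp w u - dotp w v.
Proof. by rewrite !(dotpC w) dotpBl. Qed.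

Lemma dotp0r d (u : 'cV[R]_d) : dotp u 0 = 0.
Proof. by rewrite -(scale0r 0) dotpZr mul0r. Qed.

Lemma dotp_mull d (A : 'M[R]_d) u v : dotp (A *m u) v = dotp u (A^T *m v).
Proof. by rewrite /dotp trmx_mul mulmxA. Qed.

Lemma dotp_ge0 d (u : 'cV[R]_d) : 0 <= dotp u u.
Proof. by rewrite dotpE sumr_ge0// => i _; rewrite -expr2 sqr_ge0. Qed.

Lemma dotp_eq0 d (u : 'cV[R]_d) : (dotp u u == 0) = (u == 0).
Proof.
apply/idP/eqP => [|->]; last by rewrite dotp0r.
rewrite dotpE psumr_eq0 => [/allP u0|i _]; last by rewrite -expr2 sqr_ge0.
apply/matrixP => i j; rewrite ord1 !mxE.
by have := u0 i (mem_index_enum _); rewrite -expr2 sqrf_eq0 => /eqP.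
Qed.

Lemma dotp_delta m (v : 'cV[R]_m) i : dotp (delta_mx i 0) v = v i 0.
Proof.
rewrite dotpE (bigD1 i)//= big1 ?addr0 => [|j /negbTE ji]; rewrite !mxE ?eqxx ?mul1r//.
by rewrite ji mul0r.
Qed.

Lemma enorm_eq1 d (u : 'cV[R]_d) : (enorm u = 1) <-> (dotp u u = 1).
Proof.
rewrite /enorm; split => [u1|->]; last exact: sqrtr1.
by rewrite -[LHS](sqr_sqrtr (dotp_ge0 u)) u1 expr1n.
Qed.

Lemma mulmx_outer d (u v w : 'cV[R]_d) : u *m v^T *m w = dotp v w *: u.
Proof.
rewrite -mulmxA [v^T *m w]mx11_scalar -/(dotp v w).
by rewrite mul_mx_scalar.
Qed.

(** The reflection in the hyperplane orthogonal to [a - b] exchanges the two unit vectors and fixes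
    whatever is orthogonal to [a - b]. It is used throughout as an explicit orthogonal map with one
    prescribed value. *)
Lemma householder d (a b : 'cV[R]_d) : dotp a a = 1 -> dotp b b = 1 ->
  exists Q : 'M[R]_d, [/\ Q^T = Q, Q *m Q = 1%:M, Q *m a = b &
    forall c, dotp c a = dotp c b -> Q *m c = c].
Proof.
move=> a1 b1; have [->|ab] := eqVneq a b.
  by exists 1%:M; split; rewrite ?trmx1 ?mul1mx// => c _; rewrite mul1mx.
pose w := a - b; pose Q : 'M[R]_d := 1%:M - (2 / dotp w w) *: (w *m w^T).
have w0 : dotp w w != 0 by rewrite dotp_eq0 subr_eq0.
have QE c : Q *m c = c - (2 / dotp w w * dotp w c) *: w.
  by rewrite /Q mulmxBl mul1mx -scalemxAl mulmx_outer scalerA.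
have Qa : Q *m a = b.
  have wwE : dotp w w = 2 * dotp w a.
    by rewrite /w !(dotpBl, dotpBr) a1 b1 (dotpC b a); ring.
  rewrite QE {1}wwE invfM mulrA divff ?pnatr_eq0// mul1r mulVf.
    by rewrite scale1r /w opprB addrC subrK.
  by move: w0; rewrite wwE mulf_eq0 pnatr_eq0.
have Qfix c : dotp c a = dotp c b -> Q *m c = c.
  move=> cab; rewrite QE (_ : dotp w c = 0) ?mulr0 ?scale0r ?subr0//.
  by rewrite dotpC /w dotpBr cab subrr.
have QT : Q^T = Q.
  by rewrite /Q linearB/= trmx1 linearZ/= trmx_mul trmxK.
exists Q; split => //.
have QQ (c : 'cV_d) : Q *m (Q *m c) = c.
  rewrite !QE (@dotpBr _ c) dotpZr.
  have -> : 2 / dotp w w * (dotp w c - 2 / dotp w w * dotp w c * dotp w w)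
     = - (2 / dotp w w * dotp w c) by field.
  by rewrite scaleNr opprK subrK.
apply/matrixP => i j.
have := QQ (delta_mx j 0); rewrite mulmxA => /matrixP/(_ i 0).
by rewrite -!colE mxE => ->; rewrite !mxE eqxx andbT.
Qed.

(** Deflation: after conjugation by the reflection that sends the first basis vector to [v], the
    first column is a multiple of that basis vector, and symmetry clears the first row. *)
Lemma spectral_step n (A : 'M[R]_(1 + n)) (v : 'cV[R]_(1 + n)) x :
  A^T = A -> dotp v v = 1 -> A *m v = x *: v ->
  exists (Q : 'M[R]_(1 + n)) (A' : 'M[R]_n), [/\ Q^T *m Q = 1%:M,
    Q *m delta_mx 0 0 = v,
    A'^T = A' & Q^T *m A *m Q = block_mx (x%:M : 'M[R]_1) 0 0 A'].
Proof.
move=> AT v1 Av.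
have e1 : dotp (delta_mx 0 0 : 'cV[R]_(1 + n)) (delta_mx 0 0) = 1.
  by rewrite /dotp trmx_delta mul_delta_mx mxE !eqxx.
have [Q [QT QQ Qe _]] := householder e1 v1.
have Qv : Q *m v = delta_mx 0 0 by rewrite -Qe mulmxA QQ mul1mx.
pose B := Q^T *m A *m Q.
have BT : B^T = B by rewrite /B !trmx_mul trmxK AT mulmxA.
have B0 : B *m delta_mx 0 0 = x *: delta_mx 0 (0 : 'I_1).
  by rewrite /B -mulmxA Qe -mulmxA Av -scalemxAr QT Qv.
have Bi i : B i 0 = x * (i == 0)%:R.
  by move: B0; rewrite -colE => /matrixP/(_ i 0); rewrite !mxE eqxx andbT.
exists Q, (drsubmx B); split => //; first by rewrite QT.
  by rewrite trmx_drsub BT.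
rewrite -/B; clearbody B; rewrite -[LHS]submxK; congr block_mx.
- by apply/matrixP => i j; rewrite !mxE !ord1 lshift0 Bi eqxx mulr1n mulr1.
- apply/matrixP => i j; rewrite ord1 -[ursubmx B]trmxK trmx_ursub BT !mxE.
  by rewrite lshift0 Bi mulr0.
- by apply/matrixP => i j; rewrite !mxE ord1 lshift0 Bi mulr0.
Qed.

(** Repeated deflation. The head of [s] is tied to a given eigenvector because [u*] has to become
    the first basis vector. The characteristic polynomial of the remaining block is the product over
    the tail of [s], whose head is therefore an eigenvalue; so the eigenvalues come out in the order
    of [s]. *)
Lemma spectral_theorem_head n (A : 'M[R]_n.+1) (s : seq R) v :
  size s = n.+1 -> A^T = A -> char_poly A = \prod_(x <- s) ('X - x%:P) ->
  dotp v v = 1 -> A *m v = s`_0 *: v ->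
  exists V : 'M[R]_n.+1, [/\ V^T *m V = 1%:M, V *m delta_mx 0 0 = v &
    V^T *m A *m V = diag_mx (\row_i s`_i)].
Proof.
elim: n A s v => [|n IHn] A s v.
  case: s => [|x []]// _ AT _ v1 /= Av.
  have [Q [A' [QQ Qv _ QA]]] := @spectral_step 0 A v x AT v1 Av.
  exists Q; split => //; rewrite QA; apply/matrixP => i j.
  rewrite !ord1 !mxE; case: splitP => // k _; rewrite !mxE.
  by case: splitP => // l _; rewrite !mxE !ord1.
case: s => [//|x s] [ss] AT chA v1 /= Av.
have [Q [A' [QQ Qv A'T QA]]] := @spectral_step n.+1 A v x AT v1 Av.
have chA' : char_poly A' = \prod_(x <- s) ('X - x%:P).
  have : char_poly (Q^T *m A *m Q) = char_poly A.
    rewrite /char_poly /char_poly_mx.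
    have -> : 'X%:M - map_mx polyC (Q^T *m A *m Q) =
        map_mx polyC Q^T *m ('X%:M - map_mx polyC A) *m map_mx polyC Q.
      rewrite mulmxBr mulmxBl -!map_mxM; congr (_ - _).
      rewrite scalar_mxC -mulmxA -map_mxM QQ map_mx1.
      by rewrite mulmx1.
    rewrite !det_mulmx mulrC mulrA -det_mulmx -map_mxM.
    by rewrite (mulmx1C QQ) map_mx1 det1 mul1r.
  rewrite QA chA big_cons /char_poly char_block_diag_mx det_ublock.
  rewrite (_ : \det (char_poly_mx x%:M) = 'X - x%:P); last first.
    by rewrite det_mx11 !mxE eqxx !mulr1n.
  by move/(mulfI (monic_neq0 (monicXsubC x))).
have [v' v'1 A'v'] : exists2 v', dotp v' v' = 1 & A' *m v' = s`_0 *: v'.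
  have : root (char_poly A') s`_0.
    by rewrite chA' root_prod_XsubC mem_nth// ss.
  rewrite -eigenvalue_root_char => /eigenvalueP[u uA u0].
  have uu : dotp u^T u^T != 0.
    by rewrite dotp_eq0; apply: contra u0 => /eqP/(congr1 trmx); rewrite trmxK trmx0 => ->.
  exists ((Num.sqrt (dotp u^T u^T))^-1 *: u^T).
    rewrite dotpZl dotpZr mulrA -invfM -expr2 sqr_sqrtr ?dotp_ge0//.
    by rewrite mulVf.
  by rewrite -scalemxAr -{1}A'T -trmx_mul uA linearZ/= !scalerA mulrC.
have [V [VV _ VA]] := IHn A' s v' ss A'T chA' v'1 A'v'.
pose W : 'M[R]_(1 + n.+1) := block_mx 1%:M 0 0 V.
have WT : W^T = block_mx 1%:M 0 0 V^T.
  by rewrite /W tr_block_mx trmx1 !trmx0.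
have WW : W^T *m W = 1%:M.
  rewrite WT /W mulmx_block.
  rewrite !(mul1mx, mulmx1, mul0mx, mulmx0, addr0, add0r) VV.
  by rewrite -scalar_mx_block.
have WAW : W^T *m block_mx x%:M 0 0 A' *m W =
    block_mx x%:M 0 0 (diag_mx (\row_i s`_i)).
  rewrite WT /W !mulmx_block.
  by rewrite !(mul1mx, mulmx1, mul0mx, mulmx0, addr0, add0r) VA.
have We : W *m delta_mx 0 (0 : 'I_1) = delta_mx 0 0.
  apply/matrixP => i j; rewrite -colE ord1 !mxE.
  case: splitP => k ki; rewrite !mxE; case: splitP => l //.
  + by rewrite !ord1 !mxE (_ : i = 0)//; apply: ord_inj; rewrite ki ord1.
  + by rewrite !mxE (_ : i == 0 = false)//; apply/negbTE; rewrite -val_eqE/= ki.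
exists (Q *m W); split.
- by rewrite trmx_mul -mulmxA (mulmxA Q^T) QQ mul1mx.
- by rewrite -mulmxA We.
- rewrite trmx_mul -mulmxA -mulmxA (mulmxA A) (mulmxA Q^T) (mulmxA Q^T) QA.
  rewrite mulmxA WAW.
  apply/matrixP => i j; rewrite !mxE -val_eqE/=.
  case: splitP => k ki; rewrite !mxE; case: splitP => l lj; rewrite !mxE.
  + by rewrite ki lj !ord1.
  + by rewrite ki lj ord1.
  + by rewrite ki lj ord1.
  + by rewrite -val_eqE/= ki lj.
Qed.

End linear_algebra.

(** * Measurability and expectations *)

Section measurability.
Context {R : realType} {disp : measure_display} {T : measurableType disp}.
Implicit Types f g : T -> R.

Lemma measurable_fun_normr f : measurable_fun setT f ->
  measurable_fun setT (fun x => `|f x|).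
Proof. by move=> mf; apply: measurableT_comp. Qed.

Lemma measurable_fun_invr f : measurable_fun setT f ->
  measurable_fun setT (fun x => (f x)^-1).
Proof.
(* Away from 0, [1 / z = z (z^2)^(-1)] with a real power of a nonnegative number; the inverse of 0
   is 0 by convention and is split off. *)
move=> mf; rewrite (_ : (fun x => _) =
  (fun x => if f x == 0 then 0 else f x * powR (f x ^+ 2) (- 1))).
  apply: measurable_fun_ifT => //.
    exact: measurable_fun_eqr.
  apply: measurable_funM => //.
  apply: (measurableT_comp (measurable_powR _)).
  exact: measurable_funX.
apply/funext => x; case: eqP => [->|/eqP fx0]; first by rewrite invr0.
rewrite powRN powRr1 ?sqr_ge0// expr2 invfM mulrA divff// mul1r//.
Qed.

Lemma measurable_fun_sumr (I : Type) (s : seq I) (h : I -> T -> R) :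
  (forall i, measurable_fun setT (h i)) ->
  measurable_fun setT (fun x => \sum_(i <- s) h i x).
Proof.
move=> mh; elim: s => [|i s IHs].
  by rewrite (_ : (fun x => _) = cst 0)//; apply/funext => x; rewrite big_nil.
rewrite (_ : (fun x => _) = (fun x => h i x + \sum_(i <- s) h i x)).
  exact: measurable_funD.
by apply/funext => x; rewrite big_cons.
Qed.

Lemma measurable_coord m n (Z : T -> 'M[R]_(m, n)) i j :
  measurable_fun setT Z -> measurable_fun setT (fun x => Z x i j).
Proof.
move=> mZ _ B mB; rewrite setTI.
have -> : (fun x => Z x i j) @^-1` B = setT `&` Z @^-1` [set M | B (M i j)].
  by rewrite setTI.
apply: mZ => //; apply: sub_sigma_algebra.
by exists (i, j) => //; exists B => //; rewrite setTI.
Qed.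

Lemma measurable_fun_matrix m n (Z : T -> 'M[R]_(m, n)) :
  (forall i j, measurable_fun setT (fun x => Z x i j)) ->
  measurable_fun setT Z.
Proof.
move=> mZ; apply: (@measurability _ _ _ _ _ _
  (\bigcup_(ij : 'I_m * 'I_n) preimage_set_system setT
     (fun M : 'M[R]_(m, n) => M ij.1 ij.2) measurable)) => //.
move=> _ [_ [[i j] _ [C mC <-]] <-]; rewrite setTI setTI.
by have := mZ i j measurableT C mC; rewrite setTI.
Qed.

Lemma measurable_set_pred (p : T -> bool) :
  measurable_fun setT p -> measurable [set x | p x].
Proof.
move=> mp; have := mp measurableT [set true] I.
by rewrite setTI; congr (measurable _); apply/seteqP; split => x //= ->.
Qed.

End measurability.

Lemma measurable_fun_dotp {R : realType} {disp} {T : measurableType disp} d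
    (f g : T -> 'cV[R]_d) : measurable_fun setT f -> measurable_fun setT g ->
  measurable_fun setT (fun x => dotp (f x) (g x)).
Proof.
move=> mf mg; rewrite (_ : (fun x => _) = fun x => \sum_i f x i 0 * g x i 0).
  apply: measurable_fun_sumr => i.
  by apply: measurable_funM; apply: measurable_coord.
by apply/funext => x; rewrite /dotp mxE; apply: eq_bigr => i _; rewrite mxE.
Qed.

Lemma measurable_fun_mulmx {R : realType} {disp} {T : measurableType disp} d
    (A : 'M[R]_d) (f : T -> 'cV[R]_d) : measurable_fun setT f ->
  measurable_fun setT (fun x => A *m f x).
Proof.
move=> mf; apply: measurable_fun_matrix => i j.
rewrite (_ : (fun x => _) = fun x => \sum_k A i k * f x k j).
  apply: measurable_fun_sumr => k.
  by apply: measurable_funM => //; apply: measurable_coord.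
by apply/funext => x; rewrite mxE.
Qed.

Ltac mfun := repeat first
  [ assumption | apply: measurable_fun_dotp
  | exact: measurable_cst | exact: measurable_id
  | apply: measurable_funD | apply: measurable_funB
  | apply: measurable_funM | apply: measurable_funN
  | apply: measurable_fun_normr | apply: measurable_fun_invr
  | apply: measurable_funX | (apply: measurable_fun_sumr => ?)
  | apply: measurable_fun_ler | apply: measurable_fun_ltr
  | apply: measurable_fun_eqr
  | apply: measurable_and | apply: measurable_or
  | apply: measurable_coord ].

Section expectation.
Context {R : realType} {disp : measure_display} {T : measurableType disp}.
Variable P : probability T R.
Implicit Types f g : T -> R.

Definition itg f := P.-integrable setT (EFin \o f).
(** [fine] sends infinite values to 0, so this is a genuine expectation only together with [itg].
    Quantities not yet known to be finite are bounded as extended integrals and converted by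
    [itg_of_bound]. *)
Definition Ex f : R := fine (\int[P]_x (f x)%:E).

Lemma ExE f : itg f -> (\int[P]_x (f x)%:E = (Ex f)%:E)%E.
Proof. by move=> itf; rewrite /Ex fineK//; exact: integrable_fin_num. Qed.

Lemma itg_measurable f : itg f -> measurable_fun setT f.
Proof. by move/measurable_int/measurable_EFinP. Qed.

Lemma itg_le f g : measurable_fun setT f -> itg g ->
  (forall x, `|f x| <= g x) -> itg f.
Proof.
move=> mf itg_ fg; apply: (le_integrable measurableT _ _ itg_).
  exact/measurable_EFinP.
by move=> x _ /=; rewrite lee_fin (le_trans (fg x))// ler_norm.
Qed.

Lemma itg_cst c : itg (fun=> c).
Proof. exact: finite_measure_integrable_cst. Qed.

Lemma itg_bounded f M : measurable_fun setT f -> (forall x, `|f x| <= M) -> itg f.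
Proof. by move=> mf fM; apply: (itg_le mf (itg_cst M)). Qed.

Lemma itgD f g : itg f -> itg g -> itg (fun x => f x + g x).
Proof.
by move=> itf itg_; have := integrableD measurableT itf itg_.
Qed.

Lemma itgZ c f : itg f -> itg (fun x => c * f x).
Proof. by move=> itf; exact: (@integrableZl _ _ _ P setT measurableT c _ itf). Qed.

Lemma itgB f g : itg f -> itg g -> itg (fun x => f x - g x).
Proof.
move=> itf itg_; rewrite (_ : (fun x => _) = fun x => f x + -1 * g x).
  by apply: itgD => //; apply: itgZ.
by apply/funext => x; rewrite mulN1r.
Qed.

Lemma itg_sum (I : Type) (s : seq I) (h : I -> T -> R) :
  (forall i, itg (h i)) -> itg (fun x => \sum_(i <- s) h i x).
Proof.
move=> ith; elim: s => [|i s IHs].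
  rewrite (_ : (fun x => _) = cst 0); first exact: itg_cst.
  by apply/funext => x; rewrite big_nil.
rewrite (_ : (fun x => _) = (fun x => h i x + \sum_(i <- s) h i x)).
  exact: itgD.
by apply/funext => x; rewrite big_cons.
Qed.

Lemma integral_prob_cst c : (\int[P]_w c%:E = c%:E)%E.
Proof. by rewrite integral_cst// -[Measure.sort _ _]/(P _) probability_setT mule1. Qed.

Lemma Ex_cst c : Ex (fun=> c) = c.
Proof. by rewrite /Ex integral_prob_cst. Qed.

Lemma ExD f g : itg f -> itg g -> Ex (fun x => f x + g x) = Ex f + Ex g.
Proof. by move=> itf itg_; have := RintegralD measurableT itf itg_. Qed.

Lemma ExZ c f : itg f -> Ex (fun x => c * f x) = c * Ex f.
Proof. by move=> itf; exact: (RintegralZl c measurableT itf). Qed.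

Lemma ExB f g : itg f -> itg g -> Ex (fun x => f x - g x) = Ex f - Ex g.
Proof. by move=> itf itg_; have := RintegralB measurableT itf itg_. Qed.

Lemma Ex_sum (I : Type) (s : seq I) (h : I -> T -> R) :
  (forall i, itg (h i)) -> Ex (fun x => \sum_(i <- s) h i x) = \sum_(i <- s) Ex (h i).
Proof.
move=> ith; elim: s => [|i s IHs].
  rewrite big_nil -[RHS](Ex_cst 0); congr Ex.
  by apply/funext => x; rewrite big_nil.
rewrite big_cons -IHs -ExD//; last exact: itg_sum.
by congr Ex; apply/funext => x; rewrite big_cons.
Qed.

Lemma Ex_le f g : itg f -> itg g -> (forall x, f x <= g x) -> Ex f <= Ex g.
Proof.
by move=> itf itg_ fg; apply: (le_Rintegral measurableT itf itg_) => x _.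
Qed.

Lemma Ex_ge0 f : (forall x, 0 <= f x) -> 0 <= Ex f.
Proof. by move=> f0; apply: fine_ge0; apply: integral_ge0 => x _; rewrite lee_fin. Qed.

Lemma itg_indic (D : set T) : measurable D -> itg \1_D.
Proof. by move=> mD; apply: integrable_indic. Qed.

Lemma Ex_indic (D : set T) : measurable D -> (P D = (Ex \1_D)%:E)%E.
Proof.
move=> mD; rewrite -(ExE (itg_indic mD)) integral_indic// setIT//.
Qed.

Lemma itg_of_bound f c : measurable_fun setT f -> (forall x, 0 <= f x) ->
  (\int[P]_x (f x)%:E <= c%:E)%E -> itg f /\ Ex f <= c.
Proof.
move=> mf f0 fc.
have itf : itg f.
  apply/integrableP; split; first exact/measurable_EFinP.
  rewrite (eq_integral (fun x => (f x)%:E)); last first.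
    by move=> x _ /=; rewrite ger0_norm.
  by rewrite (le_lt_trans fc)// ltry.
by split=> //; rewrite -lee_fin -ExE.
Qed.

End expectation.

Section same_law_integral.
Context {R : realType} {d1 d2 d3 : measure_display}.
Context {T1 : measurableType d1} {T2 : measurableType d2} {S : measurableType d3}.
Variables (P1 : probability T1 R) (P2 : probability T2 R).

Lemma same_law_integral (Y1 : T1 -> S) (Y2 : T2 -> S) (f : S -> \bar R) :
  measurable_fun setT Y1 -> measurable_fun setT Y2 ->
  same_law P1 Y1 P2 Y2 -> measurable_fun setT f -> (forall s, (0 <= f s)%E) ->
  (\int[P1]_w f (Y1 w) = \int[P2]_w f (Y2 w))%E.
Proof.
move=> mY1 mY2 same mf f0.
have := ge0_integral_pushforward mY1 P1 measurableT mf (fun x _ => f0 x).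
rewrite preimage_setT => <-.
have := ge0_integral_pushforward mY2 P2 measurableT mf (fun x _ => f0 x).
rewrite preimage_setT => <-.
by apply: eq_measure_integral => B mB _; exact: same.
Qed.

End same_law_integral.

(** * Anticoncentration of the uniform law on the sphere *)

Section uniform_sphere.
Context {R : realType} {disp : measure_display} {T : measurableType disp}.
Variables (P : probability T R) (n : nat) (u : T -> 'cV[R]_n.+1).
Hypotheses (mu : measurable_fun setT u) (unif : uniform_on_sphere P u).

Lemma uniform_Ex_rot (Q : 'M[R]_n.+1) (f : 'cV[R]_n.+1 -> R) :
  Q *m Q^T = 1%:M -> measurable_fun setT f -> (forall v, 0 <= f v) ->
  Ex P (fun w => f (Q *m u w)) = Ex P (fun w => f (u w)).
Proof.
move=> QQ mf f0; rewrite /Ex; congr fine.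
apply: (same_law_integral (f := EFin \o f) _ mu (unif.2 Q QQ)).
- exact: measurable_fun_mulmx.
- exact/measurable_EFinP.
- by move=> s; rewrite lee_fin.
Qed.

Lemma uniform_prob_rot (Q : 'M[R]_n.+1) (p q : 'cV[R]_n.+1 -> bool) :
  Q *m Q^T = 1%:M -> measurable [set v | q v] ->
  (forall v, p v = q (Q *m v)) ->
  P [set w | p (u w)] = P [set w | q (u w)].
Proof.
move=> QQ mq pq; have := unif.2 Q QQ _ mq; rewrite /pushforward => <-.
by congr (P _); apply/seteqP; split => w /=; rewrite pq.
Qed.

(** The reflection exchanging [a] and [a' = c a + s b] maps [s b = a' - c a] to
    [a - c a' = s (s a - c b)]. For [s = 0] this says nothing about the image of [b], whose sign may
    then differ; hence the absolute values. *)
Lemma plane_reflection (a b : 'cV[R]_n.+1) c s :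
  dotp a a = 1 -> dotp b b = 1 -> dotp a b = 0 -> c ^+ 2 + s ^+ 2 = 1 ->
  exists Q : 'M[R]_n.+1, [/\ Q *m Q^T = 1%:M,
    forall v, dotp a (Q *m v) = dotp (c *: a + s *: b) v &
    forall v, `|dotp b (Q *m v)| = `|dotp (s *: a - c *: b) v|].
Proof.
move=> a1 b1 ab cs; pose a' := c *: a + s *: b.
have a'1 : dotp a' a' = 1.
  rewrite /a' !(dotpDl, dotpDr, dotpZl, dotpZr) a1 b1 (dotpC b) ab.
  by rewrite -[RHS]cs; ring.
have [Q [QT QQ Qa Qfix]] := householder a1 a'1.
have dQ x v : dotp x (Q *m v) = dotp (Q *m x) v by rewrite dotp_mull QT.
exists Q; split; first by rewrite QT.
  by move=> v; rewrite dQ Qa.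
move=> v; rewrite dQ; have [s0|s0] := eqVneq s 0.
  rewrite Qfix; last first.
    by rewrite /a' dotpDr !dotpZr (dotpC b) ab s0; ring.
  have : `|c| = 1.
    apply/eqP; rewrite -(@pexpr_eq1 _ _ 2)// real_normK ?num_real//.
    by rewrite -[X in _ == X]cs s0 expr0n addr0.
  by rewrite s0 scale0r sub0r -scaleNr dotpZl normrM normrN => ->; rewrite mul1r.
rewrite (_ : Q *m b = s *: a - c *: b)//.
have Qa' : Q *m a' = a by rewrite -Qa mulmxA QQ mul1mx.
apply: (scalerI s0); rewrite scalemxAr (_ : s *: b = a' - c *: a).
  rewrite mulmxBr Qa' -scalemxAr Qa /a'; apply/matrixP => i j; rewrite !mxE.
  by rewrite -[X in X - _]mul1r -[in LHS]cs; ring.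
by rewrite /a' addrC addrA addNr add0r.
Qed.

(** Here [x], [y] are coordinates in the plane, [k] and [k'] tangents of two angles, [c] and [c']
    their cosines. Membership in both strips gives [|x + k y|, |x + k' y| <= 3 t / 2], so
    [h |y| <= 3 t], that is [|y| <= s / 3]. Then [x] is small too, and the second coordinate for the
    first strip falls below [s]; note that [t <= s / 9] because [h <= 1]. *)
Lemma strips_disjoint (x y t s h k k' c c' : R) :
  0 < t -> 0 < s -> h * s = 9 * t -> 0 <= k -> k + h <= k' -> k' <= 1 ->
  0 < c -> c ^+ 2 * (1 + k ^+ 2) = 1 -> 0 < c' -> c' ^+ 2 * (1 + k' ^+ 2) = 1 ->
  `|c * x + c * k * y| <= t -> s <= `|c * k * x - c * y| ->
  `|c' * x + c' * k' * y| <= t -> False.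
Proof.
move=> t0 s0 hs k0 kk k1 c0 c2 c'0 c'2.
have h0 : 0 < h by rewrite -(pmulr_lgt0 _ s0) hs; lra.
have bnd (e l : R) : 0 < e -> e ^+ 2 * (1 + l ^+ 2) = 1 -> 0 <= l <= 1 ->
    forall z, `|e * z| <= t -> `|z| <= 3 / 2 * t.
  move=> e0 e2 /andP[l0 l1] z; rewrite normrM gtr0_norm// => ezt.
  have l2 : 0 <= e ^+ 2 * (1 - l ^+ 2) by rewrite mulr_ge0 ?sqr_ge0//; nra.
  have e23 : 2 / 3 <= e by rewrite leNgt; apply/negP => e23; nra.
  by have := normr_ge0 z; nra.
rewrite -!mulrA -!mulrDr -mulrBr.
have k01 : 0 <= k <= 1 by lra.
have k'01 : 0 <= k' <= 1 by lra.
move=> /(bnd _ _ c0 c2 k01) xk sxy /(bnd _ _ c'0 c'2 k'01) xk'.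
have c1 : c <= 1 by nra.
have {sxy} : s <= `|k * x - y|.
  by apply: le_trans sxy _; rewrite normrM gtr0_norm//; have := normr_ge0 (k * x - y); nra.
have y3 : `|(k' - k) * y| <= 3 * t.
  rewrite (_ : (k' - k) * y = (x + k' * y) - (x + k * y)); last by ring.
  by rewrite (le_trans (ler_normB _ _))//; lra.
have {y3} ys : `|y| <= s / 3.
  have : h * `|y| <= 3 * t.
    apply: le_trans y3; rewrite normrM ler_wpM2r// ger0_norm; lra.
  have -> : 3 * t = h * (s / 3) by lra.
  by rewrite ler_pM2l.
have {xk} xs : `|x| <= 3 / 2 * t + `|y|.
  rewrite (_ : x = (x + k * y) - k * y); last by ring.
  rewrite (le_trans (ler_normB _ _))// lerD//.
  by rewrite normrM ger0_norm//; have := normr_ge0 y; nra.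
apply/negP; rewrite -ltNge (le_lt_trans (ler_normB _ _))//.
rewrite normrM (ger0_norm k0); have := normr_ge0 x; nra.
Qed.

(* The planar rotates of the strip by the angles arctan (j h), [0 <= j <= M],
   are pairwise disjoint and all have the probability of the strip. *)
Lemma uniform_strip (a b : 'cV[R]_n.+1) (t s : R) :
  dotp a a = 1 -> dotp b b = 1 -> dotp a b = 0 -> 0 < t -> 0 < s ->
  (P [set w | (`|dotp a (u w)| <= t)%R && (s <= `|dotp b (u w)|)%R]
   <= (9 * t / s)%:E)%E.
Proof.
move=> a1 b1 ab t0 s0.
pose strip (x y v : 'cV[R]_n.+1) := (`|dotp x v| <= t) && (s <= `|dotp y v|).
have mstrip x y : measurable [set v | strip x y v].
  apply: measurable_set_pred; rewrite /strip.
  by mfun.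
have mstripu x y : measurable [set w | strip x y (u w)].
  by have := mu measurableT (mstrip x y); rewrite setTI.
rewrite -/(strip a b).
(* The slopes [j h] with [j <= M] stay in [0, 1] and there are at least [1 / h] of them; that many
   disjoint events of equal probability bound it by [h]. The factor 9 is the one required by
   [strips_disjoint]. *)
pose h : R := 9 * t / s; have h0 : 0 < h by rewrite divr_gt0 ?mulr_gt0.
pose M := Num.truncn h^-1.
pose k (j : nat) := j%:R * h.
pose c j : R := (Num.sqrt (1 + k j ^+ 2))^-1.
have c2 j : c j ^+ 2 * (1 + k j ^+ 2) = 1.
  have kp : 0 < 1 + k j ^+ 2 by rewrite ltr_pwDl// sqr_ge0.
  by rewrite /c exprVn sqr_sqrtr ?ltW// mulVf// gt_eqF.
have c0 j : 0 < c j by rewrite invr_gt0 sqrtr_gt0 ltr_pwDl// sqr_ge0.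
pose A j := c j *: a + (c j * k j) *: b.
pose B j := (c j * k j) *: a - c j *: b.
have PE j : P [set w | strip (A j) (B j) (u w)] = P [set w | strip a b (u w)].
  have [|Q [QQ QA QB]] := @plane_reflection a b (c j) (c j * k j) a1 b1 ab.
    by rewrite -[RHS](c2 j); ring.
  by apply: (uniform_prob_rot QQ) => // v; rewrite /strip QA QB.
have kM j : (j <= M)%N -> k j <= 1.
  move=> jM; rewrite /k -ler_pdivlMr// div1r.
  rewrite (@le_trans _ _ M%:R) ?ler_nat// truncn_le invr_ge0 ltW//.
have disj i j w : (i < j)%N -> (j <= M)%N ->
    strip (A i) (B i) (u w) -> strip (A j) (B j) (u w) -> False.
  move=> ij jM /andP[Ai Bi] /andP[Aj _].
  have ki0 : 0 <= k i by rewrite mulr_ge0// ltW.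
  have kij : k i + h <= k j.
    by rewrite /k !mulr_natl -mulrSr -(mulr_natl h i.+1) -(mulr_natl h j) ler_pM2r// ler_nat.
  have hs : h * s = 9 * t by rewrite /h mulfVK// gt_eqF.
  move: Ai Bi Aj; rewrite /A /B !(dotpBl, dotpDl, dotpZl).
  exact: strips_disjoint t0 s0 hs ki0 kij (kM _ jM) (c0 i) (c2 i) (c0 j) (c2 j).
pose F j := if (j <= M)%N then [set w | strip (A j) (B j) (u w)] else set0.
have mF j : measurable (F j) by rewrite /F; case: ifP.
have tF : trivIset setT F.
  apply: ltn_trivIset => j i ij; rewrite /F; case: ifP => iM; last by rewrite set0I.
  case: ifP => jM; last by rewrite setI0.
  by rewrite -subset0 => w [/= si sj]; exact: disj ij jM si sj.
have := measure_bigsetU P mF tF M.+1.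
rewrite (eq_bigr (fun=> P [set w | strip a b (u w)])); last first.
  by move=> i _; rewrite /F leq_ord; exact: PE.
have mS := mstripu a b.
have -> : P [set w | strip a b (u w)] = (fine (P [set w | strip a b (u w)]))%:E.
  by rewrite fineK// fin_num_measure.
rewrite sumEFin sumr_const card_ord => PF.
have : (P (\big[setU/set0]_(i < M.+1) F i) <= 1)%E.
  by apply: probability_le1; apply: bigsetU_measurable.
rewrite PF !lee_fin -(mulr_natr (fine _)) => fM.
rewrite (_ : 9 * t / s = 1 / h^-1); last by rewrite invrK mul1r.
rewrite ler_pdivlMr ?invr_gt0//.
apply: le_trans fM; rewrite ler_wpM2l//.
  by rewrite fine_ge0.
have hV : 0 <= h^-1 by rewrite invr_ge0 ltW.
by have /andP[_ /ltW] := truncn_itv hV.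
Qed.

(** Indicator of the band [|v_0| <= t] around the equator of the sphere. Including the norm
    condition keeps all coordinates bounded on its support, whatever [u] does on the null event of
    leaving the sphere. *)
Definition cap (t : R) (v : 'cV[R]_n.+1) : R := ((dotp v v == 1) && (`|v 0 0| <= t))%:R.

Lemma cap_ge0 t v : 0 <= cap t v. Proof. by rewrite /cap ler0n. Qed.

Lemma measurable_cap t : measurable_fun setT (cap t).
Proof.
rewrite /cap (_ : (fun v => _) = (fun v : 'cV[R]_n.+1 =>
  if (dotp v v == 1) && (`|v 0 0| <= t) then 1 else 0)).
  by apply: measurable_fun_ifT; mfun.
by apply/funext => v; case: ifP.
Qed.

(** The reflection exchanging [b] and [b'] fixes the first basis vector, to which both are
    orthogonal, and therefore preserves the band as well as the law of [u]. *)
Lemma cap_sym t (b b' : 'cV[R]_n.+1) (phi : R -> R) :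
  dotp b b = 1 -> dotp b' b' = 1 -> b 0 0 = 0 -> b' 0 0 = 0 ->
  measurable_fun setT phi -> (forall x, 0 <= phi x) ->
  Ex P (fun w => cap t (u w) * phi (dotp b (u w))) =
  Ex P (fun w => cap t (u w) * phi (dotp b' (u w))).
Proof.
move=> b1 b'1 b0 b'0 mphi phi0.
have [Q [QT QQ Qb Qfix]] := householder b1 b'1.
have dQ x v : dotp x (Q *m v) = dotp (Q *m x) v by rewrite dotp_mull QT.
have QQT : Q *m Q^T = 1%:M by rewrite QT.
pose f v := cap t v * phi (dotp b v).
have mf : measurable_fun setT f.
  apply: measurable_funM; first exact: measurable_cap.
  by apply: measurableT_comp => //; mfun.
rewrite -(uniform_Ex_rot QQT mf) => [|v]; last by rewrite mulr_ge0// cap_ge0.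
congr Ex; apply/funext => w; rewrite /f dQ Qb; congr (_ * _).
rewrite /cap dQ mulmxA QQ mul1mx; congr (((_ == _) && (`|_| <= _))%:R).
by rewrite -!dotp_delta dQ Qfix// !dotp_delta b0 b'0.
Qed.

Lemma cap_itg t (f : 'cV[R]_n.+1 -> R) M : measurable_fun setT f ->
  (forall v, dotp v v = 1 -> `|f v| <= M) -> 0 <= M ->
  itg P (fun w => cap t (u w) * f (u w)).
Proof.
move=> mf fM M0; apply: (@itg_bounded _ _ _ _ _ M).
  apply: measurable_funM; last exact: measurableT_comp.
  by apply: measurableT_comp mu; exact: measurable_cap.
move=> w; rewrite normrM /cap; have [/fM fw|_] := eqVneq; last first.
  by rewrite mulr0n normr0 mul0r.
by case: (`|u w 0 0| <= t); rewrite /= ?mulr1n ?mulr0n ?normr1 ?normr0 ?mul1r ?mul0r.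
Qed.

Lemma sphere_coord (v : 'cV[R]_n.+1) i : dotp v v = 1 -> v i 0 ^+ 2 <= 1.
Proof.
rewrite dotpE => <-; rewrite (bigD1 i)//= -expr2 lerDl sumr_ge0// => j _.
by rewrite -expr2 sqr_ge0.
Qed.

Let d2 i : 'cV[R]_n.+1 := delta_mx (lift 0 i) 0.

Let d2E (i j : 'I_n) : dotp (d2 i) (d2 j) = (i == j)%:R.
Proof. by rewrite dotp_delta mxE eqxx andbT (inj_eq lift_inj). Qed.

Let d20 (i : 'I_n) : d2 i 0 0 = 0.
Proof. by rewrite mxE. Qed.

Lemma cap_second_moment t (i j : 'I_n) :
  Ex P (fun w => cap t (u w) * u w (lift 0 i) 0 ^+ 2) =
  Ex P (fun w => cap t (u w) * u w (lift 0 j) 0 ^+ 2).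
Proof.
have := @cap_sym t (d2 i) (d2 j) (fun x => x ^+ 2).
rewrite !d2E !d20 !eqxx => /(_ erefl erefl erefl erefl) H.
rewrite (_ : (fun w => _) = fun w => cap t (u w) * dotp (d2 i) (u w) ^+ 2).
  rewrite H => [|//|x]; last by rewrite sqr_ge0.
  by congr Ex; apply/funext => w; rewrite dotp_delta.
by apply/funext => w; rewrite dotp_delta.
Qed.

Lemma cap_fourth_moment t (i j : 'I_n) :
  Ex P (fun w => cap t (u w) * u w (lift 0 i) 0 ^+ 4) =
  Ex P (fun w => cap t (u w) * u w (lift 0 j) 0 ^+ 4).
Proof.
have := @cap_sym t (d2 i) (d2 j) (fun x => x ^+ 4).
rewrite !d2E !d20 !eqxx => /(_ erefl erefl erefl erefl) H.
rewrite (_ : (fun w => _) = fun w => cap t (u w) * dotp (d2 i) (u w) ^+ 4).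
  rewrite H => [|//|x]; last by rewrite (_ : 4 = 2 * 2)%N// exprM sqr_ge0.
  by congr Ex; apply/funext => w; rewrite dotp_delta.
by apply/funext => w; rewrite dotp_delta.
Qed.

Let itg22 t (i j : 'I_n.+1) :
  itg P (fun w => cap t (u w) * (u w i 0 ^+ 2 * u w j 0 ^+ 2)).
Proof.
apply: (@cap_itg t (fun v => v i 0 ^+ 2 * v j 0 ^+ 2) 1) => //; first by mfun.
move=> v v1; rewrite ger0_norm; last by apply: mulr_ge0; exact: sqr_ge0.
by apply: mulr_ile1; (exact: sqr_ge0) || exact: sphere_coord.
Qed.

Let itg4 t (i : 'I_n.+1) : itg P (fun w => cap t (u w) * u w i 0 ^+ 4).
Proof.
have := itg22 t i i; congr (itg P _); apply/funext => w.
by rewrite -exprD.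
Qed.

(* Rotate by 45 degrees in the plane of the two coordinates. *)
Lemma cap_mixed_moment t (i j : 'I_n) : i != j ->
  Ex P (fun w => cap t (u w) * u w (lift 0 i) 0 ^+ 4) =
  3 * Ex P (fun w => cap t (u w) *
        (u w (lift 0 i) 0 ^+ 2 * u w (lift 0 j) 0 ^+ 2)).
Proof.
move=> ij; set A := LHS.
pose q : R := (Num.sqrt 2)^-1.
have q2 : q ^+ 2 = 2^-1 by rewrite /q exprVn sqr_sqrtr.
have rot (e : R) : e ^+ 2 = 1 -> A = Ex P (fun w => cap t (u w) *
    ((u w (lift 0 i) 0 + e * u w (lift 0 j) 0) ^+ 4 / 4)).
  move=> e2; pose b := q *: (d2 i + e *: d2 j).
  have b1 : dotp b b = 1.
    rewrite /b !(dotpZl, dotpDl, dotpZr, dotpDr) !d2E !eqxx (eq_sym j) (negbTE ij).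
    rewrite /= (_ : q * _ = q ^+ 2 * (1 + e ^+ 2)); last by ring.
    by rewrite q2 e2; field.
  have := @cap_sym t (d2 i) b (fun x => x ^+ 4).
  rewrite d2E eqxx d20 => /(_ erefl b1 erefl) H.
  rewrite /A (_ : (fun w => _) = fun w => cap t (u w) * dotp (d2 i) (u w) ^+ 4).
    rewrite H => [||//|x]; last by rewrite (_ : 4 = 2 * 2)%N// exprM sqr_ge0.
      congr Ex; apply/funext => w; rewrite /b dotpZl dotpDl dotpZl !dotp_delta.
      congr (_ * _); rewrite exprMn (_ : q ^+ 4 = (q ^+ 2) ^+ 2); last by rewrite -exprM.
      by rewrite q2; field.
    by rewrite /b mxE [X in _ * X]mxE [X in _ * (_ + X)]mxE !d20 mulr0 addr0 mulr0.
  by apply/funext => w; rewrite dotp_delta.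
have r1 := rot 1 (expr1n _ _).
have i4 := itg4 t (lift 0 i); have j4 := itg4 t (lift 0 j).
have ij22 := itg22 t (lift 0 i) (lift 0 j).
have itgr (e : R) : e ^+ 2 = 1 -> itg P (fun w => cap t (u w) *
    ((u w (lift 0 i) 0 + e * u w (lift 0 j) 0) ^+ 4 / 4)).
  move=> e2; apply: (@cap_itg t (fun v => (v (lift 0 i) 0 + e * v (lift 0 j) 0) ^+ 4 / 4) 4) => //.
    by mfun.
  move=> v v1; have := sphere_coord (lift 0 i) v1; have := sphere_coord (lift 0 j) v1.
  move: (v (lift 0 i) 0) (v (lift 0 j) 0) => x y y1 x1.
  rewrite (_ : 4 = 2 * 2)%N// exprM ger0_norm; last by rewrite divr_ge0// sqr_ge0.
  have : (x + e * y) ^+ 2 <= 4.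
    have : 0 <= (x - e * y) ^+ 2 by rewrite sqr_ge0.
    have -> : (x - e * y) ^+ 2 = x ^+ 2 - 2 * e * x * y + e ^+ 2 * y ^+ 2 by ring.
    have -> : (x + e * y) ^+ 2 = x ^+ 2 + 2 * e * x * y + e ^+ 2 * y ^+ 2 by ring.
    by rewrite e2; lra.
  by have := sqr_ge0 (x + e * y); nra.
have sqN1 : (-1 : R) ^+ 2 = 1 by rewrite sqrrN expr1n.
have Aij : A = Ex P (fun w => cap t (u w) * u w (lift 0 j) 0 ^+ 4).
  exact: cap_fourth_moment.
(* Add the identities for the signs 1 and -1: the odd terms cancel in [(x + y)^4 + (x - y)^4 = 2 x^4
   + 12 x^2 y^2 + 2 y^4]. *)
have : A + A = 2^-1 * A + (2^-1 * Ex P (fun w => cap t (u w) *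
    u w (lift 0 j) 0 ^+ 4) + 3 * Ex P (fun w => cap t (u w) *
        (u w (lift 0 i) 0 ^+ 2 * u w (lift 0 j) 0 ^+ 2))).
  rewrite {1}r1 {1}(rot (-1) sqN1) -ExD; [|exact: itgr (expr1n _ _)|exact: itgr].
  rewrite {1}/A -(ExZ 2^-1 i4) -(ExZ 2^-1 j4).
  rewrite -(ExZ 3 ij22).
  have ii := itgZ 2^-1 i4; have jj := itgZ 2^-1 j4; have kk := itgZ 3 ij22.
  rewrite -(ExD jj kk) -(ExD ii (itgD jj kk)).
  by congr Ex; apply/funext => w; field.
by rewrite -Aij; lra.
Qed.

Let cap_mass (t : R) := Ex P (fun w => cap t (u w)).

Let itg_cap t : itg P (fun w => cap t (u w)).
Proof.
have := @cap_itg t (fun=> 1) 1 (measurable_cst _); rewrite normr1 => /(_ _ _)H.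
have {}H := H (fun _ _ => lexx _) ler01.
by congr (itg P _): H; apply/funext => w; rewrite mulr1.
Qed.

Lemma capE t v : cap t v * \sum_(i < n) v (lift 0 i) 0 ^+ 2 = cap t v * (1 - v 0 0 ^+ 2).
Proof.
rewrite /cap; have [v1|] := eqVneq; last by rewrite !mulr0n !mul0r.
by rewrite -v1 dotpE big_ord_recl/= -expr2 addrAC subrr add0r.
Qed.

(** By symmetry the [n] second moments are equal; they add up to the mean of [1 - v_0^2] over the
    band, where [v_0^2 <= 1 / 4]. *)
Lemma cap_second_moment_ge (t : R) (i : 'I_n) : 0 < t -> t <= 1 / 2 ->
  3 / 4 * cap_mass t <= n%:R * Ex P (fun w => cap t (u w) * u w (lift 0 i) 0 ^+ 2).
Proof.
move=> t0 t1.
have i2 (j : 'I_n) : itg P (fun w => cap t (u w) * u w (lift 0 j) 0 ^+ 2).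
  apply: (@cap_itg t (fun v => v (lift 0 j) 0 ^+ 2) 1) => //; first by mfun.
  by move=> v v1; rewrite ger0_norm ?sqr_ge0// sphere_coord.
have -> : n%:R * Ex P (fun w => cap t (u w) * u w (lift 0 i) 0 ^+ 2) =
    \sum_(j < n) Ex P (fun w => cap t (u w) * u w (lift 0 j) 0 ^+ 2).
  rewrite (eq_bigr (fun=> Ex P (fun w => cap t (u w) * u w (lift 0 i) 0 ^+ 2))).
    by rewrite sumr_const card_ord mulr_natl.
  by move=> j _; exact: cap_second_moment.
rewrite /cap_mass -ExZ// -Ex_sum//; apply: Ex_le.
- exact: itgZ.
- exact: itg_sum.
move=> w; rewrite -mulr_sumr capE /cap.
case: (dotp _ _ == 1) => /=; last by rewrite mulr0n mulr0 mul0r.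
case: (leP `|u w 0 0| t) => /= ut; last by rewrite mulr0n mulr0 mul0r.
rewrite mulr1n mulr1 mul1r; have : `|u w 0 0| ^+ 2 <= 1 / 4.
  by have := normr_ge0 (u w 0 0); nra.
by rewrite real_normK ?num_real//; lra.
Qed.

(** Expand the square of [sum_(j >= 1) v_j^2 <= 1]: the [n] diagonal terms have mean [A], the
    [n (n - 1)] others [A / 3], so [n (n + 2) A / 3] is at most the mass of the band. *)
Lemma cap_fourth_moment_le t (i : 'I_n) :
  n%:R ^+ 2 * Ex P (fun w => cap t (u w) * u w (lift 0 i) 0 ^+ 4) <= 3 * cap_mass t.
Proof.
set A := Ex P _.
have mixed (j k : 'I_n) : Ex P (fun w => cap t (u w) *
    (u w (lift 0 j) 0 ^+ 2 * u w (lift 0 k) 0 ^+ 2)) =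
    A / 3 + (k == j)%:R * (2 / 3 * A).
  have Aj : A = Ex P (fun w => cap t (u w) * u w (lift 0 j) 0 ^+ 4).
    exact: cap_fourth_moment.
  have [->|kj] := eqVneq k j.
    transitivity A; last by rewrite mul1r; field.
    by rewrite Aj; congr Ex; apply/funext => w; rewrite -exprD.
  by rewrite mul0r addr0 Aj (cap_mixed_moment t (_ : j != k)) 1?eq_sym//; field.
have sq : Ex P (fun w => \sum_(j < n) \sum_(k < n) cap t (u w) *
    (u w (lift 0 j) 0 ^+ 2 * u w (lift 0 k) 0 ^+ 2)) <= cap_mass t.
  apply: Ex_le => //; first by do 2!(apply: itg_sum => ?); exact: itg22.
  move=> w; under eq_bigr do rewrite -mulr_sumr -mulr_sumr.
  rewrite -mulr_sumr -mulr_suml mulrA capE -mulrA mulrCA capE mulrCA /cap.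
  have [v1|] := eqVneq; last by rewrite !mulr0n !mul0r.
  have := sphere_coord 0 v1; have := sqr_ge0 (u w 0 0).
  case: (_ <= t); rewrite /= ?mulr1n ?mulr0n ?mul0r// mul1r; nra.
apply: le_trans (_ : 3 * (n%:R * (n%:R * (A / 3) + 2 / 3 * A)) <= _).
  have : 0 <= n%:R * A.
    rewrite mulr_ge0// Ex_ge0// => w; rewrite mulr_ge0 ?cap_ge0//.
    by rewrite (_ : 4 = 2 * 2)%N// exprM sqr_ge0.
  by nra.
rewrite ler_pM2l//; apply: le_trans sq.
rewrite Ex_sum => [|j]; last by apply: itg_sum => k; exact: itg22.
rewrite (eq_bigr (fun=> n%:R * (A / 3) + 2 / 3 * A)).
  by rewrite sumr_const card_ord mulr_natl.
move=> j _; rewrite Ex_sum => [|k]; last exact: itg22.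
rewrite (eq_bigr _ (fun k _ => mixed j k)) big_split/= sumr_const card_ord.
rewrite (mulr_natl (A / 3)) (bigD1 j)//= eqxx mul1r big1 ?addr0// => k /negbTE ->.
by rewrite mul0r.
Qed.

(* Paley-Zygmund: on the cap some other coordinate is at least [s] with
   conditional probability at least 1/12, which brings in the strip. *)
Lemma cap_mass_le (t : R) : (0 < n)%N -> 0 < t -> t <= 1 / 2 ->
  cap_mass t <= 216 * t * Num.sqrt n%:R.
Proof.
move=> n0 t0 t1; pose i := Ordinal n0.
have N0 : 0 < n%:R :> R by rewrite ltr0n.
set N : R := n%:R in N0 *; pose rN := Num.sqrt N.
have rN0 : 0 < rN by rewrite sqrtr_gt0.
have rN2 : rN ^+ 2 = N by rewrite sqr_sqrtr// ltW.
pose s := (2 * rN)^-1; have s0 : 0 < s by rewrite invr_gt0 mulr_gt0.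
have s2 : s ^+ 2 * N = 4^-1.
  rewrite /s -rN2; field; exact: lt0r_neq0.
pose e0 : 'cV[R]_n.+1 := delta_mx 0 0.
pose x w := u w (lift 0 i) 0.
pose E := [set w | (`|dotp e0 (u w)| <= t) && (s <= `|dotp (d2 i) (u w)|)].
have mE : measurable E.
  by apply: measurable_set_pred; mfun.
have pE : Ex P \1_E <= 9 * t / s.
  rewrite -lee_fin -Ex_indic//; apply: uniform_strip => //.
  - by rewrite dotp_delta mxE eqxx.
  - by rewrite dotp_delta d20.
have iE := itg_indic P mE.
have i4 := itg4 t (lift 0 i).
have i2 : itg P (fun w => cap t (u w) * x w ^+ 2).
  apply: (@cap_itg t (fun v => v (lift 0 i) 0 ^+ 2) 1) => //; first by mfun.
  by move=> v v1; rewrite ger0_norm ?sqr_ge0// sphere_coord.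
(* Where [|x| < s] the first term dominates, on [E] the other two do by the arithmetic-geometric
   mean inequality. After multiplication by [N] the left side is at least [3 / 4] of the mass and
   the right side at most half of it plus [3 P(E)]. So the mass is at most [12 P(E)], and
   [P(E) <= 18 t sqrt N] gives 216. *)
have : Ex P (fun w => cap t (u w) * x w ^+ 2) <=
    Ex P (fun w => s ^+ 2 * cap t (u w) +
      (3 / N * \1_E w + N / 12 * (cap t (u w) * x w ^+ 4))).
  have ii := itgZ (s ^+ 2) (itg_cap t); have jj := itgZ (3 / N) iE.
  have kk := itgZ (N / 12) i4.
  apply: Ex_le => //; first by apply: itgD => //; exact: itgD.
  move=> w; have c0 := cap_ge0 t (u w).
  have x4 : 0 <= x w ^+ 4 by rewrite (_ : 4 = 2 * 2)%N// exprM sqr_ge0.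
  have k0 : 0 <= N / 12 * (cap t (u w) * x w ^+ 4).
    by apply: mulr_ge0; [rewrite divr_ge0 ?ltW|exact: mulr_ge0].
  have E0 : 0 <= 3 / N * \1_E w.
    by apply: mulr_ge0; [rewrite divr_ge0 ?ltW|rewrite indicE].
  have [xs|xs] := ltP `|x w| s.
    apply: le_trans (_ : s ^+ 2 * cap t (u w) <= _); last first.
      by rewrite lerDl addr_ge0.
    rewrite mulrC ler_wpM2r// -(real_normK (num_real (x w))).
    by rewrite lerXn2r ?nnegrE// ltW.
  have [ut|ut] := leP `|u w 0 0| t; last first.
    have -> : cap t (u w) = 0 by rewrite /cap leNgt ut andbF.
    by rewrite !mul0r !mulr0 addr0 add0r.
  have -> : \1_E w = 1 :> R.
    by rewrite indicE mem_set//= /E/= !dotp_delta ut.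
  have c1 : cap t (u w) <= 1 by rewrite /cap lern1 leq_b1.
  have amgm : x w ^+ 2 <= 3 / N + N / 12 * x w ^+ 4.
    have : 0 <= (6 - N * x w ^+ 2) ^+ 2 / N by rewrite divr_ge0 ?sqr_ge0// ltW.
    have -> : (6 - N * x w ^+ 2) ^+ 2 / N = 36 / N - 12 * x w ^+ 2 + N * x w ^+ 4.
      by field; exact: lt0r_neq0.
    by lra.
  have s2c : 0 <= s ^+ 2 * cap t (u w) by rewrite mulr_ge0 ?sqr_ge0.
  have N3 : 0 <= 3 / N by rewrite divr_ge0// ltW.
  nra.
rewrite ExD; [|exact: itgZ|by apply: itgD; exact: itgZ].
rewrite ExD; [|exact: itgZ|exact: itgZ].
rewrite !ExZ// -/(cap_mass t).
have X2 := cap_second_moment_ge i t0 t1; have X4 := cap_fourth_moment_le t i.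
rewrite -/N in X2 X4; rewrite -/(x _) in X2 X4.
move: (Ex P (fun w => cap t (u w) * x w ^+ 2)) X2 => B2 X2.
move: (Ex P _) X4 => B4 X4.
rewrite -(ler_pM2l N0) !mulrDr.
have -> : N * (s ^+ 2 * cap_mass t) = 4^-1 * cap_mass t by rewrite mulrA (mulrC N) s2.
have -> : N * (3 / N * Ex P \1_E) = 3 * Ex P \1_E by field; exact: lt0r_neq0.
have -> : N * (N / 12 * B4) = N ^+ 2 * B4 / 12 by field.
have st : 9 * t / s = 18 * t * rN by rewrite /s invrK; ring.
rewrite st in pE; rewrite -/N -/rN => H; lra.
Qed.

Lemma uniform_anticoncentration (e : 'cV[R]_n.+1) (t : R) :
  (0 < n)%N -> dotp e e = 1 -> 0 < t ->
  ((1 - 216 * t * Num.sqrt n%:R)%:E <=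
   P [set w | (dotp (u w) (u w) == 1%R) && (t < `|dotp e (u w)|)%R])%E.
Proof.
move=> n0 e1 t0; have [t1|t1] := leP t (1 / 2); last first.
  apply: (@le_trans _ _ 0%E); last exact: measure_ge0.
  rewrite lee_fin.
  have : 1 <= Num.sqrt n%:R :> R by rewrite -[leLHS]sqrtr1 ler_sqrt// ler1n.
  by nra.
pose e0 : 'cV[R]_n.+1 := delta_mx 0 0.
have e01 : dotp e0 e0 = 1 by rewrite dotp_delta mxE eqxx.
have [Q [QT QQ Qe _]] := householder e1 e01.
have dQ x v : dotp x (Q *m v) = dotp (Q *m x) v by rewrite dotp_mull QT.
pose C := [set w | (dotp (u w) (u w) == 1) && (`|u w 0 0| <= t)].
have mC : measurable C by apply: measurable_set_pred; mfun.
have PC : (P C <= (216 * t * Num.sqrt n%:R)%:E)%E.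
  rewrite Ex_indic// lee_fin; apply: le_trans (cap_mass_le n0 t0 t1).
  rewrite /cap_mass le_eqVlt; apply/orP; left; apply/eqP; congr Ex.
  apply/funext => w; rewrite indicE /cap; congr (nat_of_bool _)%:R.
  by apply/idP/idP; rewrite inE.
pose q (v : 'cV[R]_n.+1) := (dotp v v == 1) && (t < `|v 0 0|).
have mq : measurable [set v | q v] by apply: measurable_set_pred; rewrite /q; mfun.
rewrite (@uniform_prob_rot Q (fun v => (dotp v v == 1) && (t < `|dotp e v|)) q) ?QT//.
  have mqu : measurable [set w | q (u w)].
    by have := mu measurableT mq; rewrite setTI.
  have P1 : (1 <= P [set w | q (u w)] + P C)%E.
    rewrite -unif.1; apply: le_trans (measureU2 _ mqu mC).
    apply: le_measure; rewrite ?inE//.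
    - have mS : measurable [set v : 'cV[R]_n.+1 | dotp v v == 1].
        by apply: measurable_set_pred; mfun.
      have := mu measurableT mS; rewrite setTI; congr (measurable _).
      by apply/seteqP; split => w /=; rewrite /unit_sphere/= enorm_eq1 => /eqP.
    - exact: measurableU.
    - move=> w; rewrite /preimage/= /unit_sphere/= enorm_eq1 => /eqP u1.
      by case: (leP `|u w 0 0| t) => ut; [right|left]; rewrite /C/q/= u1.
  rewrite EFinB leeBlDr//; apply: le_trans P1 _.
  exact: leeD2l.
move=> v; rewrite /q dQ mulmxA QQ mul1mx -[(Q *m v) 0 0]dotp_delta dQ.
by rewrite -/e0 -Qe mulmxA QQ mul1mx.
Qed.

End uniform_sphere.

(** * Chains driven by independent samples *)

Section markov_chain.
Context {R : realType} {disp dS dX : measure_display} {T : measurableType disp}.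
Context {S : measurableType dS} {U : measurableType dX}.
Variable P : probability T R.
Local Open Scope ereal_scope.

Let law d (V : measurableType d) (Y : T -> V) (mY : measurable_fun setT Y) :
  probability V R := distribution P (mfun_Sub (mem_set mY)).

(** The restriction of [P] to [E], normalised and pushed forward by [(Y, X)], agrees with the
    product law on rectangles, hence everywhere. The event [E] will hold future samples, so that
    independence of past and future survives a step of the chain. *)
Lemma independent_joint_law (Y : T -> S) (X : T -> U)
    (mY : measurable_fun setT Y) (mX : measurable_fun setT X) (E : set T) :
  measurable E ->
  (forall A B, measurable A -> measurable B ->
    P (Y @^-1` A `&` X @^-1` B `&` E) = P (Y @^-1` A) * P (X @^-1` B) * P E) ->
  forall D, measurable D ->
    P ((fun w => (Y w, X w)) @^-1` D `&` E) = (law mY \x law mX) D * P E.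
Proof.
move=> mE rect D mD.
have mYX : measurable_fun setT (fun w => (Y w, X w)) by exact: measurable_fun_pair.
have mYXD : measurable ((fun w => (Y w, X w)) @^-1` D).
  by have := mYX measurableT D mD; rewrite setTI.
have [PE0|PE0] := eqVneq (P E) 0.
  rewrite PE0 mule0; apply: (@subset_measure0 _ _ _ _ _ E) => //.
  exact: measurableI.
have PEfin : P E \is a fin_num by exact: fin_num_measure.
have c0 : (0 <= (fine (P E))^-1)%R by rewrite invr_ge0 fine_ge0.
pose m' := mscale (NngNum c0) (pushforward (mrestr P mE) (fun w => (Y w, X w))).
have cK : ((fine (P E))^-1%R)%:E * P E = 1.
  by rewrite -{2}(fineK PEfin) -EFinM mulVf// fine_eq0.
have -> : (law mY \x law mX) D = m' mYX D.
  apply: product_measure_unique => // A B mA mB.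
  change (((fine (P E))^-1%R)%:E * P (Y @^-1` A `&` X @^-1` B `&` E) =
    P (Y @^-1` A) * P (X @^-1` B)); rewrite rect//.
  by rewrite muleC -muleA (muleC (P E)) cK mule1.
by rewrite /m' /mscale/= /pushforward /mrestr muleAC cK mul1e.
Qed.

Variables (step : S * U -> S) (y0 : T -> S) (X : nat -> T -> U).
Hypotheses (mstep : measurable_fun setT step) (my0 : measurable_fun setT y0).
Hypotheses (mX : forall n, measurable_fun setT (X n)).
Hypotheses (indX : mutually_independent P X).
Hypotheses (ind0 : forall B E, measurable B -> generated_sigma_algebra X E ->
  P (y0 @^-1` B `&` E) = P (y0 @^-1` B) * P E).

Fixpoint chain (n : nat) (w : T) : S :=
  if n is n'.+1 then step (chain n' w, X n' w) else y0 w.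

Lemma measurable_chain n : measurable_fun setT (chain n).
Proof.
elim: n => [//|n IHn] /=; apply: measurableT_comp => //.
exact: measurable_fun_pair.
Qed.

Let tail (J : {fset nat}) (B : nat -> set U) := \bigcap_(j in [set` J]) X j @^-1` B j.

Let mpreX n B : measurable B -> measurable (X n @^-1` B).
Proof. by move=> mB; have := mX n measurableT mB; rewrite setTI. Qed.

Let measurable_tail J B : (forall j, measurable (B j)) -> measurable (tail J B).
Proof.
by move=> mB; apply: fin_bigcap_measurable => // j _; exact: mpreX.
Qed.

Let tail0 B : tail fset0 B = setT.
Proof. by apply/seteqP; split => // w _ j /=; rewrite in_fset0. Qed.

Let tailU1 n (J : {fset nat}) B C : n \notin J ->
  tail (n |` J)%fset (fun j => if j == n then C else B j) = X n @^-1` C `&` tail J B.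
Proof.
move=> nJ; apply/seteqP; split => w.
  move=> H; split; first by have := H n; rewrite /= eqxx; apply; rewrite in_fset1U eqxx.
  move=> j /= jJ; have := H j; rewrite /= in_fset1U jJ orbT.
  by case: eqVneq => [jn|_ /(_ isT)//]; rewrite -jn jJ in nJ.
move=> [Xn H] j /=; rewrite in_fset1U; case: eqVneq => [->//|_] /=.
exact: H.
Qed.

Let P_tailU1 n (J : {fset nat}) B C : n \notin J -> measurable C ->
  (forall j, measurable (B j)) ->
  P (X n @^-1` C `&` tail J B) = P (X n @^-1` C) * P (tail J B).
Proof.
move=> nJ mC mB; rewrite -tailU1// /tail !indX//; last first.
  by move=> j; case: ifP.
rewrite big_fsetU1//= eqxx; congr (_ * _).
rewrite big_seq [RHS]big_seq; apply: eq_bigr => j jJ.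
by case: eqVneq => // jn; rewrite -jn jJ in nJ.
Qed.

(** Induction over all finite families of future samples at once: the state at [n + 1] is a function
    of the state at [n] and of [X n], and the factorisation on their rectangles is the induction
    hypothesis with [X n] counted among the future samples. *)
Let chain_tail_indep n (J : {fset nat}) B A :
  (forall j, j \in J -> (n <= j)%N) -> (forall j, measurable (B j)) ->
  measurable A ->
  P (chain n @^-1` A `&` tail J B) = P (chain n @^-1` A) * P (tail J B).
Proof.
elim: n J B A => [|n IHn] J B A nJ mB mA.
  apply: ind0 => //.
  apply: (@fin_bigcap_measurable _ (g_sigma_algebraType _)) => // j _.
  by apply: sub_gen_smallest; exists j => //; exists (B j) => //; rewrite setTI.
have nnJ : n \notin J by apply/negP => /nJ; rewrite ltnn.
have mD : measurable (step @^-1` A) by have := mstep measurableT mA; rewrite setTI.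
have rect (K : {fset nat}) A' C : (forall j, j \in K -> (n < j)%N) ->
    measurable A' -> measurable C ->
    P (chain n @^-1` A' `&` X n @^-1` C `&` tail K B) =
    P (chain n @^-1` A') * P (X n @^-1` C) * P (tail K B).
  move=> nK mA' mC; have nnK : n \notin K by apply/negP => /nK; rewrite ltnn.
  rewrite -setIA -muleA -P_tailU1// -tailU1// IHn//.
    by move=> j; rewrite in_fset1U => /predU1P[->//|/nK/ltnW].
  by move=> j; case: ifP.
rewrite [chain n.+1 @^-1` A](_ : _ = (fun w => (chain n w, X n w)) @^-1` (step @^-1` A))//.
rewrite (@independent_joint_law (chain n) (X n) (measurable_chain n) (mX n))//; last 2 first.
- exact: measurable_tail.
- by move=> A' C mA' mC; exact: rect.
congr (_ * _).
have := @independent_joint_law (chain n) (X n) (measurable_chain n) (mX n) setT measurableT.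
move=> /(_ _ _ mD); rewrite setIT probability_setT mule1; move=> ->//.
move=> A' C mA' mC; have := @rect fset0 A' C.
rewrite tail0 probability_setT => ->//.
Qed.

Lemma chain_integral n (f : S * U -> \bar R) :
  measurable_fun setT f -> (forall z, 0 <= f z) ->
  \int[P]_w f (chain n w, X n w) = \int[P]_w \int[P]_w' f (chain n w, X n w').
Proof.
move=> mf f0; have mc := measurable_chain n.
have mp : measurable_fun setT (fun w => (chain n w, X n w)) by exact: measurable_fun_pair.
have := ge0_integral_pushforward mp P measurableT mf (fun x _ => f0 x).
rewrite preimage_setT => <-.
rewrite (eq_measure_integral (law mc \x law (mX n))); last first.
  move=> D mD _; have := @independent_joint_law _ _ mc (mX n) setT measurableT.
  move=> /(_ _ _ mD); rewrite setIT probability_setT mule1; apply.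
  move=> A C mA mC; have nnJ : n \notin fset0 by rewrite in_fset0.
  have := @chain_tail_indep n (n |` fset0)%fset (fun j => if j == n then C else setT) A.
  rewrite tailU1// tail0 !setIT ?probability_setT !mule1; apply => //.
    by move=> j; rewrite in_fset1U in_fset0 orbF => /eqP ->.
  by move=> j; case: ifP.
rewrite fubini_tonelli1//.
have mF : measurable_fun setT (fubini_F (law (mX n)) f).
  exact: measurable_fun_fubini_tonelli_F.
have F0 x : 0 <= fubini_F (law (mX n)) f x by apply: integral_ge0.
have := ge0_integral_pushforward mc P measurableT mF (fun x _ => F0 x).
rewrite preimage_setT => ->; apply: eq_integral => w _ /=.
have mfw : measurable_fun setT (fun y => f (chain n w, y)).
  by apply: measurableT_comp => //; exact: pair1_measurable.
have := ge0_integral_pushforward (mX n) P measurableT mfw (fun y _ => f0 _).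
by rewrite preimage_setT => <-.
Qed.

(** Plays the role of conditioning on the past: it is enough to bound the one-step mean with the
    current state frozen at an arbitrary [y]. *)
Lemma chain_integral_le n (f : S * U -> \bar R) (g : S -> \bar R) :
  measurable_fun setT f -> (forall z, 0 <= f z) -> measurable_fun setT g ->
  (forall y, \int[P]_w f (y, X n w) <= g y) ->
  \int[P]_w f (chain n w, X n w) <= \int[P]_w g (chain n w).
Proof.
move=> mf f0 mg fg; rewrite chain_integral//; have mc := measurable_chain n.
apply: ge0_le_integral => //.
- by move=> w _; apply: integral_ge0.
- have mF : measurable_fun setT (fubini_F (law (mX n)) f).
    exact: measurable_fun_fubini_tonelli_F.
  apply: eq_measurable_fun (measurableT_comp mF mc) => w _ /=.
  have mfw : measurable_fun setT (fun y => f (chain n w, y)).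
    by apply: measurableT_comp => //; exact: pair1_measurable.
  have := ge0_integral_pushforward (mX n) P measurableT mfw (fun y _ => f0 _).
  by rewrite preimage_setT => <-.
- exact: measurableT_comp.
Qed.

End markov_chain.

(** * Moments of isotropic subgaussian vectors *)

Section moments.
Context {R : realType} {disp : measure_display} {T : measurableType disp}.
Variables (P : probability T R) (d : nat) (Z : T -> 'cV[R]_d).
Hypotheses (mZ : measurable_fun setT Z) (sgZ : isotropic_subgaussian P Z).

(** The [psi_2] bound at [p = 4 k] reads [E |Y|^(4k) <= (4k)^(2k)]. Multiples of 4 suffice, since
    all increments will be dominated by fourth powers. *)
Lemma subgaussian_unit_moment (v : 'cV[R]_d) k : dotp v v = 1 -> (0 < k)%N ->
  (\int[P]_w (dotp v (Z w) ^+ (4 * k))%:E <= ((16 * k%:R ^+ 2) ^+ k)%:E)%E.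
Proof.
move=> v1 k0; have [_ _ psi] := sgZ.
pose p : R := (4 * k)%:R.
have p1 : 1 <= p by rewrite ler1n muln_gt0.
have p0 : 0 < p by apply: lt_le_trans p1.
have pn0 : p != 0 by rewrite gt_eqF.
have : ((p `^ (- 2^-1))%:E * 'N[P]_(p%:E)[EFin \o (fun w => dotp v (Z w))] <= 1)%E.
  apply: le_trans psi; apply: le_trans (ereal_sup_ubound _); last first.
    by exists v => //; rewrite /unit_sphere/= enorm_eq1.
  by apply: ereal_sup_ubound; exists p.
rewrite powRN -lee_pdivlMl ?invr_gt0 ?powR_gt0// invrK mule1 => Np.
have {Np} : ('N[P]_(p%:E)[EFin \o (fun w => dotp v (Z w))] `^ p <=
    (p `^ 2^-1)%:E `^ p)%E.
  by apply: (gt0_ler_poweR (ltW p0)) => //;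
    rewrite in_itv/= leey andbT ?Lnorm_ge0// lee_fin powR_ge0.
rewrite poweR_Lnorm// poweR_EFin -powRrM.
rewrite (_ : p `^ (2^-1 * p) = (16 * k%:R ^+ 2) ^+ k); last first.
  rewrite (_ : 2^-1 * p = (2 * k)%:R); last by rewrite /p !natrM; field.
  by rewrite powR_mulrn ?ltW// exprM; congr (_ ^+ k); rewrite /p natrM; ring.
move=> H; apply: le_trans H; rewrite le_eqVlt; apply/orP; left; apply/eqP.
apply: eq_integral => w _; rewrite /= powR_mulrn//.
by rewrite -normrX ger0_norm// exprn_even_ge0// oddM.
Qed.

Lemma even4_ge0 (x : R) k : 0 <= x ^+ (4 * k).
Proof. by rewrite exprn_even_ge0// oddM. Qed.

Lemma subgaussian_moment (a : 'cV[R]_d) k : (0 < k)%N ->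
  itg P (fun w => dotp a (Z w) ^+ (4 * k)) /\
  Ex P (fun w => dotp a (Z w) ^+ (4 * k)) <=
    (16 * k%:R ^+ 2) ^+ k * dotp a a ^+ (2 * k).
Proof.
move=> k0; apply: itg_of_bound => [||]; [by mfun| |].
  by move=> w; exact: even4_ge0.
have [->|a0] := eqVneq a 0.
  rewrite (eq_integral (cst 0%E)) ?integral_cst ?mul0e//.
    by rewrite lee_fin mulr_ge0 ?exprn_ge0 ?dotp_ge0.
  by move=> w _; rewrite /= dotpC dotp0r expr0n muln_eq0/= (gtn_eqF k0).
have aa : 0 < dotp a a by rewrite lt_neqAle eq_sym dotp_eq0 a0 dotp_ge0.
pose n := Num.sqrt (dotp a a); have n0 : 0 < n by rewrite sqrtr_gt0.
have n2 : n ^+ 2 = dotp a a by rewrite sqr_sqrtr// ltW.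
pose v := n^-1 *: a.
have v1 : dotp v v = 1.
  by rewrite /v dotpZl dotpZr -n2; field; rewrite gt_eqF.
have av : a = n *: v by rewrite /v scalerA divff ?scale1r ?gt_eqF.
rewrite (eq_integral (fun w =>
    (n ^+ (4 * k))%:E * (dotp v (Z w) ^+ (4 * k))%:E)%E); last first.
  by move=> w _; rewrite -EFinM -exprMn -dotpZl -av.
rewrite ge0_integralZl//; last 3 first.
- by apply/measurable_EFinP; mfun.
- by move=> w _; rewrite lee_fin even4_ge0.
- by rewrite lee_fin even4_ge0.
rewrite mulrC EFinM -n2 -exprM mulnA lee_wpmul2l ?lee_fin ?even4_ge0//.
exact: subgaussian_unit_moment.
Qed.

Lemma subgaussian_integrable_prod (a b : 'cV[R]_d) :
  itg P (fun w => dotp a (Z w) * dotp b (Z w)).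
Proof.
have [ia _] := subgaussian_moment a (ltnSn 0).
have [ib _] := subgaussian_moment b (ltnSn 0).
apply: (@itg_le _ _ _ _ _
  (fun w => 1 + (dotp a (Z w) ^+ (4 * 1) + dotp b (Z w) ^+ (4 * 1)))).
- by mfun.
- by apply: itgD; [exact: itg_cst|exact: itgD].
move=> w; move: (dotp a _) (dotp b _) => x y; rewrite muln1.
rewrite ler_norml; apply/andP; split.
  have : 0 <= (x + y) ^+ 2 by exact: sqr_ge0.
  have : 0 <= (x ^+ 2 - 1) ^+ 2 by exact: sqr_ge0.
  have : 0 <= (y ^+ 2 - 1) ^+ 2 by exact: sqr_ge0.
  by nra.
have : 0 <= (x - y) ^+ 2 by exact: sqr_ge0.
have : 0 <= (x ^+ 2 - 1) ^+ 2 by exact: sqr_ge0.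
have : 0 <= (y ^+ 2 - 1) ^+ 2 by exact: sqr_ge0.
by nra.
Qed.

Lemma isotropic_covariance (a b : 'cV[R]_d) :
  Ex P (fun w => dotp a (Z w) * dotp b (Z w)) = dotp a b.
Proof.
have [_ cov _] := sgZ.
have iZ i j : itg P (fun w => Z w i 0 * Z w j 0).
  have := subgaussian_integrable_prod (delta_mx i 0) (delta_mx j 0).
  by congr (itg P _); apply/funext => w; rewrite !dotp_delta.
have EZ i j : Ex P (fun w => Z w i 0 * Z w j 0) = (i == j)%:R.
  have := cov i j; rewrite mxE; rewrite unlock => H.
  rewrite /Ex -[RHS]/(fine (((i == j)%:R : R)%:E)) -H; congr fine.
  by apply: eq_integral => w _; rewrite mxE big_ord1 mxE.
rewrite (_ : (fun w => _) = fun w => \sum_i \sum_j (a i 0 * b j 0) * (Z w i 0 * Z w j 0)).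
  rewrite Ex_sum => [|i]; last by apply: itg_sum => j; exact: itgZ.
  rewrite dotpE; apply: eq_bigr => i _.
  rewrite Ex_sum => [|j]; last exact: itgZ.
  rewrite (bigD1 i)//= ExZ// EZ eqxx mulr1 big1 ?addr0// => j /negbTE ji.
  by rewrite ExZ// EZ eq_sym ji mulr0.
apply/funext => w; rewrite !dotpE mulr_suml; apply: eq_bigr => i _.
by rewrite mulr_sumr; apply: eq_bigr => j _; ring.
Qed.

End moments.

(** * Elementary inequalities *)

Section power_inequalities.
Context {R : realType}.

(** Induction by Chebyshev's sum inequality, that is, nonnegativity of the double sum of
    [(a_i - a_j) (a_i^(k+1) - a_j^(k+1))]. *)
Lemma power_mean d (a : 'I_d -> R) k : (forall i, 0 <= a i) ->
  (\sum_i a i) ^+ k.+1 <= d%:R ^+ k * \sum_i a i ^+ k.+1.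
Proof.
move=> a0; elim: k => [|k IHk]; first by rewrite expr0 mul1r.
have cheb : (\sum_i a i) * (\sum_i a i ^+ k.+1) <= d%:R * \sum_i a i ^+ k.+2.
  have : 0 <= \sum_i \sum_j (a i - a j) * (a i ^+ k.+1 - a j ^+ k.+1).
    apply: sumr_ge0 => i _; apply: sumr_ge0 => j _.
    have [ij|/ltW ji] := leP (a i) (a j).
      by rewrite mulr_le0// subr_le0// lerXn2r// nnegrE.
    by rewrite mulr_ge0// subr_ge0// lerXn2r// nnegrE.
  have -> : \sum_i \sum_j (a i - a j) * (a i ^+ k.+1 - a j ^+ k.+1) =
      2 * (d%:R * (\sum_i a i ^+ k.+2) - (\sum_i a i) * (\sum_i a i ^+ k.+1)).
    under eq_bigr => i _.
      under eq_bigr => j _.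
        rewrite (_ : _ * _ = a i ^+ k.+2 + a j ^+ k.+2 +
          - (a i * a j ^+ k.+1) + - (a i ^+ k.+1 * a j)); last by rewrite !(exprS _ k.+1); ring.
        over.
      rewrite !big_split/= !sumrN sumr_const card_ord -mulr_sumr -mulr_sumr.
      over.
    rewrite !big_split/= !sumrN sumr_const card_ord -!mulr_suml sumrMnl.
    by rewrite -(mulr_natl (\sum_i a i ^+ k.+2)); ring.
  by rewrite pmulr_rge0// subr_ge0.
rewrite exprS; apply: le_trans (_ : (\sum_i a i) * (d%:R ^+ k * \sum_i a i ^+ k.+1) <= _).
  by rewrite ler_wpM2l// sumr_ge0.
rewrite mulrCA exprSr -mulrA ler_wpM2l// exprn_ge0//.
Qed.

(** [k^k / k!] is a single term of the series of [exp k], and [exp 1 <= 4]. *)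
Lemma expn_self_le k : (k%:R : R) ^+ k <= 4 ^+ k * (k`!)%:R.
Proof.
have e4 : expR 1 <= 4 :> R.
  have h : 2^-1 <= expR (- 2^-1) :> R.
    by apply: le_trans (expR_ge1Dx _); lra.
  rewrite (_ : 1 = 2^-1 + 2^-1 :> R); last by field.
  rewrite expRD; have -> : expR 2^-1 = (expR (- 2^-1))^-1 :> R by rewrite expRN invrK.
  have : (expR (- 2^-1))^-1 <= 2 :> R.
    by rewrite -[leRHS]invrK lef_pV2 ?posrE ?expR_gt0.
  have := expR_gt0 (- 2^-1 : R); rewrite -invr_gt0; nra.
case: k => [|k]; first by rewrite !expr0 mul1r.
have f0 : 0 < (k.+1`!)%:R :> R by rewrite ltr0n fact_gt0.
rewrite -ler_pdivrMr//.
have H : (k.+1%:R : R) ^+ k.+1 / k.+1`!%:R <= expR k.+1%:R.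
  by apply: le_trans (expR_ge1Dxn k (ler0n _ _)); rewrite lerDr.
apply: le_trans H _; rewrite -[k.+1%:R]mulr1 mulrC -[1 * _]/(1 * k.+1%:R) expRM_natr.
by rewrite lerXn2r ?nnegrE ?expR_ge0.
Qed.

(** The higher terms of a binomial expansion when [k]-th moments grow like [k^(2k)]. As
    ['C(p, k) k^k <= (4 p)^k], each term is at most [(4 p k a)^k]. The one for [k = 2] is
    [64 p^2 a^2]; the others, by [k <= p], are at most [z^k] with [z = 4 p^2 a], and this geometric
    series fits into one more [p^2 a^2]. *)
Lemma binomial_tail (p : nat) (a : R) : 0 <= a -> 128 * p%:R ^+ 4 * a <= 1 ->
  \sum_(2 <= k < p.+1) 'C(p, k)%:R * (a * k%:R ^+ 2) ^+ k <= 65 * p%:R ^+ 2 * a ^+ 2.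
Proof.
move=> a0 ap.
case: p ap => [|[|p]] ap; try by rewrite big_geq// !mulr_ge0// ?exprn_ge0.
move: ap; set q := p.+2 => ap.
have q1 : 1 <= q%:R :> R by rewrite ler1n.
have term k : 'C(q, k)%:R * (a * k%:R ^+ 2) ^+ k <= (4 * q%:R * k%:R * a) ^+ k.
  rewrite (_ : a * _ = (k%:R * a) * k%:R); last by ring.
  rewrite exprMn mulrCA (_ : 4 * _ * _ * _ = k%:R * a * (4 * q%:R)); last by ring.
  rewrite [leRHS]exprMn ler_wpM2l ?exprn_ge0 ?mulr_ge0//.
  apply: le_trans (_ : 'C(q, k)%:R * (4 ^+ k * k`!%:R) <= _).
    by rewrite ler_wpM2l// expn_self_le.
  rewrite mulrCA exprMn ler_wpM2l ?exprn_ge0// -natrM -natrX ler_nat.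
  rewrite bin_ffact; elim: k => [|k IHk]; first by rewrite ffactn0.
  by rewrite ffactnSr expnSr leq_mul// leq_subr.
pose z := 4 * q%:R ^+ 2 * a.
have z0 : 0 <= z by rewrite !mulr_ge0// exprn_ge0.
have zq : z * (32 * q%:R ^+ 2) <= 1.
  by rewrite (_ : z * _ = 128 * q%:R ^+ 4 * a)// /z; ring.
have z2 : z <= 1 / 2.
  have : 1 <= q%:R ^+ 2 :> R by rewrite exprn_ege1.
  by nra.
have geo m : \sum_(j < m) z ^+ j <= 2.
  elim: m => [|m IHm]; first by rewrite big_ord0.
  rewrite big_ord_recl expr0.
  under eq_bigr do rewrite lift0 exprS.
  by rewrite -mulr_sumr; nra.
rewrite big_ltn//; apply: le_trans (_ : 64 * q%:R ^+ 2 * a ^+ 2 + 2 * z ^+ 3 <= _).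
  apply: lerD.
    by apply: le_trans (term 2) _; rewrite le_eqVlt; apply/orP; left; apply/eqP; ring.
  apply: le_trans (_ : \sum_(3 <= k < q.+1) z ^+ k <= _).
    rewrite [leLHS]big_nat [leRHS]big_nat; apply: ler_sum => k /andP[_ kq].
    apply: le_trans (term k) _; rewrite lerXn2r ?nnegrE ?mulr_ge0//.
    rewrite /z expr2 mulrA ler_wpM2r// ler_wpM2l ?mulr_ge0// ler_nat.
    by rewrite -ltnS.
  rewrite (big_addn 0 q.+1 3) big_mkord.
  under eq_bigr do rewrite exprD mulrC.
  by rewrite -mulr_sumr mulrC ler_wpM2r ?exprn_ge0.
have -> : 2 * z ^+ 3 = (128 * q%:R ^+ 4 * a) * (q%:R ^+ 2 * a ^+ 2).
  by rewrite /z; ring.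
have : 0 <= q%:R ^+ 2 * a ^+ 2 by rewrite mulr_ge0 ?exprn_ge0.
by nra.
Qed.

(** The linear term keeps a one-sided bound because it will carry the negative drift; only the
    higher terms may lose their sign. *)
Lemma expr1D_le (p : nat) (z u t : R) : z <= u -> `|z| <= t ->
  (1 + z) ^+ p <= 1 + p%:R * u + \sum_(2 <= k < p.+1) 'C(p, k)%:R * t ^+ k.
Proof.
move=> zu zt; have t0 : 0 <= t by apply: le_trans zt.
case: p => [|p]; first by rewrite expr0 mul0r addr0 big_geq// addr0.
rewrite exprDn -(big_mkord xpredT (fun i => (1 ^+ (p.+1 - i) * z ^+ i) *+ 'C(p.+1, i))).
rewrite big_ltn// big_ltn//= !expr1n expr0 expr1 !mul1r bin0 mulr1n bin1 addrA.
apply: lerD; first by rewrite lerD2l -mulr_natl ler_wpM2l.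
rewrite [leLHS]big_nat [leRHS]big_nat; apply: ler_sum => k _.
rewrite expr1n mul1r -mulr_natl ler_wpM2l//.
by rewrite (le_trans (ler_norm _))// normrX lerXn2r ?nnegrE.
Qed.

Lemma contraction_le (b x : R) : 0 < b -> b <= 1 / 2 -> 0 < x -> x <= b ->
  (1 + b)^-1 ^+ 2 * (1 + 2 * b - 2 * x) <= 1 - x.
Proof.
move=> b0 b2 x0 xb; rewrite exprVn mulrC ler_pdivrMr ?exprn_gt0//; last by lra.
have -> : (1 - x) * (1 + b) ^+ 2 = 1 + 2 * b - 2 * x + (x * (1 - 2 * b) + b ^+ 2 * (1 - x)) by ring.
by rewrite lerDl addr_ge0// mulr_ge0 ?sqr_ge0 ?(ltW x0)//; lra.
Qed.

(** Each noise term takes half of the budget [kap x N / 2]: the first through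
    [240 b^2 <= G b^2 / 4 <= kap x / 4], the one with the dimension through [40 d b^2 <= x / 4]. *)
Lemma noise_le (G p kap x b d N : R) : 1000 <= G -> 1 <= p -> 0 < b -> 0 < x ->
  0 < N -> 0 < kap -> kap * x = G * p * b ^+ 2 -> 160 * d * b ^+ 2 <= x ->
  80 * (3 * b ^+ 2 * N + kap * b ^+ 2 * d * N / 2) <= kap * x * N / 2.
Proof.
move=> G1 p1 b0 x0 N0 k0 kapE db.
have -> : 80 * (3 * b ^+ 2 * N + kap * b ^+ 2 * d * N / 2) =
    (240 * b ^+ 2 + kap * (40 * d * b ^+ 2)) * N by field.
have -> : kap * x * N / 2 = (kap * x / 4 + kap * (x / 4)) * N by field.
rewrite ler_pM2r// lerD//; last by rewrite ler_pM2l//; lra.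
have b20 : 0 < b ^+ 2 by rewrite exprn_gt0.
have G0 : 0 <= G by lra.
have Gp : G <= G * p by rewrite ler_peMr.
have : G * b ^+ 2 <= kap * x by rewrite kapE ler_pM2r.
have : 1000 * b ^+ 2 <= G * b ^+ 2 by rewrite ler_pM2r.
by lra.
Qed.

(** The first coordinate does not contract, so the tail yields only [- x Q]. The decrease of [tau]
    adds the missing [- 9/4 x], which gives [- x N]; half of it pays for the noise. *)
Lemma drift_le (kap A Q x K E N : R) : 0 < kap -> 0 < x -> A <= (1 - x) * Q ->
  N <= Q + 9 / 4 -> 0 <= K -> E <= 80 -> 80 * K <= kap * x * N / 2 ->
  kap * (A - Q - 9 / 4 * x) + K * E <= - (kap * x * N / 2).
Proof.
move=> k0 x0 AQ NQ K0 E80 K80.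
have KE : K * E <= 80 * K by rewrite mulrC ler_wpM2r.
have : kap * (A - Q - 9 / 4 * x) <= kap * - (x * N).
  rewrite ler_pM2l//; have : x * N <= x * (Q + 9 / 4) by rewrite ler_pM2l.
  by lra.
by rewrite mulrN mulrA; lra.
Qed.

Lemma sqr_near1 (M : R) : `|M - 1| <= 1 / 2 -> 1 / 4 <= M ^+ 2 /\ M ^+ 2 <= 9 / 4.
Proof. by rewrite ler_norml => /andP[M1 M2]; split; nra. Qed.

Lemma step_const_ge : 1000 <= 130 * 1600 ^+ 2 :> R /\ 1 <= 130 * 1600 ^+ 2 :> R.
Proof. by split; lra. Qed.

Lemma mulr_sqr_le1 (c q s x : R) : 0 <= c -> 0 <= q -> 0 <= s -> s ^+ 2 <= x ->
  c ^+ 2 * q ^+ 2 * x <= 1 -> c * q * s <= 1.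
Proof.
move=> c0 q0 s0 sx cq; have cqs : 0 <= c * q * s by rewrite !mulr_ge0.
rewrite -(@ler_pXn2r _ 2) ?nnegrE// expr1n; apply: le_trans cq.
by rewrite !exprMn ler_wpM2l// mulr_ge0 ?sqr_ge0.
Qed.

(** The coordinates are coupled through the sum only. [B] is a stationary level, with
    [52 = 16 (9/4 + 1)] since the stationary part of the sum is at most 1. The initial mass [q0]
    leaks into coordinate [k] at a rate linear in [m]: the sum is at most [2 q0 r^(2m)] plus that
    part, whence 32, doubled to 64 by [r^2 >= 1 / 2]. The condition on [N] keeps the total leakage
    below [q0]. *)
Lemma coupled_recursion n (N : nat) (a : nat -> 'I_n -> R) (rho l' B : 'I_n -> R)
    (b r : R) :
  (forall k, 0 <= a 0%N k) -> (forall k, 0 <= l' k) -> (forall k, 0 <= B k) ->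
  0 <= b -> (forall k, 0 <= rho k <= r) -> 1 / 2 <= r ^+ 2 ->
  (forall m k, a m.+1 k = rho k ^+ 2 * a m k +
     16 * b ^+ 2 * l' k * (9 / 4 + \sum_j a m j)) ->
  (forall k, 52 * b ^+ 2 * l' k <= (1 - rho k ^+ 2) * B k) ->
  N%:R * (64 * b ^+ 2 * \sum_k l' k) <= 1 -> \sum_k B k <= 1 ->
  forall m, (m <= N)%N ->
  \sum_k a m k <= 2 * r ^+ 2 ^+ m * \sum_k a 0%N k + \sum_k B k.
Proof.
move=> a0 l'0 B0 b0 rhor r2 aS BE NL B1; set q0 := \sum_k a 0%N k.
have q00 : 0 <= q0 by exact: sumr_ge0.
have b20 : 0 <= b ^+ 2 by exact: sqr_ge0.
have th0 : 0 < r ^+ 2 by lra.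
have sumle m (F : 'I_n -> R) : (m <= N)%N ->
    (forall k, F k <= r ^+ 2 ^+ m * (a 0%N k + m%:R * (64 * b ^+ 2 * l' k) * q0) + B k) ->
    \sum_k F k <= 2 * r ^+ 2 ^+ m * q0 + \sum_k B k.
  move=> mN FB; apply: le_trans (ler_sum _ (fun k _ => FB k)) _.
  rewrite big_split/= lerD2r -mulr_sumr big_split/= -/q0 -mulr_suml -mulr_sumr -mulr_sumr.
  rewrite (_ : 2 * _ * q0 = r ^+ 2 ^+ m * (q0 + q0)); last by ring.
  rewrite ler_pM2l ?(exprn_gt0 _ th0)// lerD2l.
  rewrite ler_piMl//; apply: le_trans NL; rewrite ler_wpM2r ?ler_nat//.
  by rewrite mulr_ge0 ?mulr_ge0 ?sumr_ge0.
have main m : (m <= N)%N -> forall k,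
    a m k <= r ^+ 2 ^+ m * (a 0%N k + m%:R * (64 * b ^+ 2 * l' k) * q0) + B k.
  elim: m => [_ k|m IHm mN k]; first by rewrite expr0 mul1r !mul0r addr0 lerDl.
  have {}IHm := IHm (ltnW mN); have qm := sumle _ _ (ltnW mN) IHm.
  have bl : 0 <= b ^+ 2 * l' k by exact: mulr_ge0.
  have /andP[rho0 rhor'] := rhor k.
  have rho2 : rho k ^+ 2 <= r ^+ 2 by rewrite lerXn2r ?nnegrE// (le_trans rho0).
  pose E := a 0%N k + m%:R * (64 * b ^+ 2 * l' k) * q0.
  have E0 : 0 <= E.
    by rewrite addr_ge0// mulr_ge0// mulr_ge0// -mulrA mulr_ge0.
  have t0 : 0 < r ^+ 2 ^+ m := exprn_gt0 _ th0.
  rewrite aS; apply: (@le_trans _ _ (rho k ^+ 2 * (r ^+ 2 ^+ m * E + B k) +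
      16 * b ^+ 2 * l' k * (9 / 4 + (2 * r ^+ 2 ^+ m * q0 + 1)))).
    apply: lerD; first by rewrite ler_wpM2l ?sqr_ge0//; exact: IHm.
    rewrite ler_wpM2l ?lerD2l//; first by rewrite -mulrA mulr_ge0.
    by apply: le_trans qm _; rewrite lerD2l.
  have s1 : rho k ^+ 2 * (r ^+ 2 ^+ m * E) <= r ^+ 2 * (r ^+ 2 ^+ m * E).
    by rewrite ler_wpM2r// mulr_ge0// ltW.
  have s2 : 32 * (b ^+ 2 * l' k) * (r ^+ 2 ^+ m * q0) <=
      r ^+ 2 * (64 * (b ^+ 2 * l' k) * (r ^+ 2 ^+ m * q0)).
    have : 0 <= (b ^+ 2 * l' k) * (r ^+ 2 ^+ m * q0).
      by rewrite mulr_ge0// mulr_ge0// ltW.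
    have -> : 32 * (b ^+ 2 * l' k) * (r ^+ 2 ^+ m * q0) =
       32 * ((b ^+ 2 * l' k) * (r ^+ 2 ^+ m * q0)) by ring.
    have -> : r ^+ 2 * (64 * (b ^+ 2 * l' k) * (r ^+ 2 ^+ m * q0)) =
       64 * (r ^+ 2 * ((b ^+ 2 * l' k) * (r ^+ 2 ^+ m * q0))) by ring.
    move: ((b ^+ 2 * l' k) * _) => v v0; have : 1 / 2 * v <= r ^+ 2 * v by rewrite ler_wpM2r.
    by clear; lra.
  have s3 := BE k.
  have -> : r ^+ 2 ^+ m.+1 * (a 0%N k + m.+1%:R * (64 * b ^+ 2 * l' k) * q0) + B k =
    r ^+ 2 * (r ^+ 2 ^+ m * E) + r ^+ 2 * (64 * (b ^+ 2 * l' k) * (r ^+ 2 ^+ m * q0)) + B k.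
    by rewrite /E exprS -natr1; ring.
  have -> : rho k ^+ 2 * (r ^+ 2 ^+ m * E + B k) +
      16 * b ^+ 2 * l' k * (9 / 4 + (2 * r ^+ 2 ^+ m * q0 + 1)) =
    rho k ^+ 2 * (r ^+ 2 ^+ m * E) + 32 * (b ^+ 2 * l' k) * (r ^+ 2 ^+ m * q0) +
    (rho k ^+ 2 * B k + 52 * b ^+ 2 * l' k) by field.
  apply: lerD; first exact: lerD.
  by clear -s3; lra.
by move=> m mN; apply: sumle => //; exact: main.
Qed.

End power_inequalities.

(** * Pathwise increments of the potential *)

Section increment_inequalities.
Context {R : realType}.

Lemma normr_prod_le (y z : R) : `|y * z| <= (2 + y ^+ 4 + z ^+ 4) / 4.
Proof.
have y2 : 0 <= (y ^+ 2 - 1) ^+ 2 by exact: sqr_ge0.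
have z2 : 0 <= (z ^+ 2 - 1) ^+ 2 by exact: sqr_ge0.
have y4 : (y ^+ 2 - 1) ^+ 2 = y ^+ 4 - 2 * y ^+ 2 + 1 by ring.
have z4 : (z ^+ 2 - 1) ^+ 2 = z ^+ 4 - 2 * z ^+ 2 + 1 by ring.
have yz : 0 <= (y - z) ^+ 2 by exact: sqr_ge0.
have yz' : 0 <= (y + z) ^+ 2 by exact: sqr_ge0.
have yzE : (y - z) ^+ 2 = y ^+ 2 - 2 * (y * z) + z ^+ 2 by ring.
have yzE' : (y + z) ^+ 2 = y ^+ 2 + 2 * (y * z) + z ^+ 2 by ring.
by rewrite ler_norml; apply/andP; split; lra.
Qed.

(** One quantity [W] controls every expression in the sample. The last bound uses the weighted
    square [(d Bn^2 - D)^2 >= 0], so that the dimension enters only as a factor [d]. *)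
Lemma dominated_products (d X0 Bn Cn D W4 : R) : 1 <= d -> 0 <= D ->
  D ^+ 2 <= d ^+ 2 * W4 -> 0 <= W4 ->
  let W := 1 + X0 ^+ 4 + Bn ^+ 4 + Cn ^+ 4 + W4 in
  [/\ 1 <= W, `|Bn * X0| <= W / 2, `|Bn * Cn| <= W / 2, (Bn * X0) ^+ 2 <= W / 2 &
      Bn ^+ 2 * D <= d * W / 2].
Proof.
move=> d1 D0 D2 W40 W.
have e4 (z : R) : 0 <= z ^+ 4 by rewrite exprn_even_ge0.
have X04 := e4 X0; have B4 := e4 Bn; have C4 := e4 Cn.
have WE : W = 1 + X0 ^+ 4 + Bn ^+ 4 + Cn ^+ 4 + W4 by [].
clearbody W; split.
- by clear -WE X04 B4 C4 W40; lra.
- by apply: le_trans (normr_prod_le _ _) _; clear -WE X04 B4 C4 W40; lra.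
- by apply: le_trans (normr_prod_le _ _) _; clear -WE X04 B4 C4 W40; lra.
- have : 0 <= (Bn ^+ 2 - X0 ^+ 2) ^+ 2 by exact: sqr_ge0.
  have -> : (Bn ^+ 2 - X0 ^+ 2) ^+ 2 = Bn ^+ 4 - 2 * (Bn * X0) ^+ 2 + X0 ^+ 4 by ring.
  by clear -WE X04 B4 C4 W40; lra.
have : 0 <= (d * Bn ^+ 2 - D) ^+ 2 by exact: sqr_ge0.
have -> : (d * Bn ^+ 2 - D) ^+ 2 = d ^+ 2 * Bn ^+ 4 - 2 * d * (Bn ^+ 2 * D) + D ^+ 2 by ring.
move=> H; have d0 : 0 < d by clear -d1; lra.
have : d * (2 * (Bn ^+ 2 * D)) <= d * (d * (Bn ^+ 4 + W4)).
  have -> : d * (2 * (Bn ^+ 2 * D)) = 2 * d * (Bn ^+ 2 * D) by ring.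
  have -> : d * (d * (Bn ^+ 4 + W4)) = d ^+ 2 * Bn ^+ 4 + d ^+ 2 * W4 by ring.
  by clear -H D2; lra.
rewrite ler_pM2l//.
have : d * (Bn ^+ 4 + W4) <= d * W.
  by rewrite ler_pM2l//; clear -WE X04 B4 C4; lra.
by clear; lra.
Qed.

Lemma noise_bounds (M Q nu W z : R) : 0 < nu -> nu ^+ 2 = M ^+ 2 + Q -> 0 <= Q ->
  1 <= W -> `|z| <= W / 2 -> z ^+ 2 <= W / 2 ->
  `|nu * z - M| <= 2 * nu * W /\ (nu * z - M) ^+ 2 <= 3 * nu ^+ 2 * W.
Proof.
move=> nu0 nu2 Q0 W1 z1 z2.
have Mnu : `|M| <= nu.
  rewrite -(@ler_pXn2r _ 2) ?nnegrE ?normr_ge0 ?(ltW nu0)// real_normK ?num_real// nu2.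
  by rewrite lerDl.
have nuW : nu <= nu * W by rewrite ler_peMr// ltW.
split.
  apply: le_trans (ler_normB _ _) _; rewrite normrM gtr0_norm//.
  have : nu * `|z| <= nu * (W / 2) by rewrite ler_pM2l.
  have : 0 < nu * W by apply: lt_le_trans nuW.
  by clear -nuW Mnu; lra.
have n2 : 0 < nu ^+ 2 by rewrite exprn_gt0.
have : 0 <= (nu * z + M) ^+ 2 by exact: sqr_ge0.
have -> : (nu * z + M) ^+ 2 = nu ^+ 2 * z ^+ 2 + 2 * (nu * z * M) + M ^+ 2 by ring.
have -> : (nu * z - M) ^+ 2 = nu ^+ 2 * z ^+ 2 - 2 * (nu * z * M) + M ^+ 2 by ring.
have : nu ^+ 2 * z ^+ 2 <= nu ^+ 2 * (W / 2) by rewrite ler_pM2l.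
have : M ^+ 2 <= nu ^+ 2 * W.
  apply: (@le_trans _ _ (nu ^+ 2)); first by rewrite nu2 lerDl.
  by rewrite ler_peMr// ltW.
by clear; lra.
Qed.

(** [T1] and [T2] are the linear and quadratic increments of the first coordinate, [T3], [T4], [T6]
    those of the tail, of degree 0, 2 and 4 in the sample, and [T5] is the decrease of [tau]. The
    second-order part [T2 + T6] gets a small one-sided bound, for the drift. The total gets a
    two-sided bound proportional to the root [h] of the potential: [b nu], [kap nu] and [|M - 1|]
    are at most [h], the first two thanks to [tau >= 9 / 4]. The separate constants
    [4 + 3 + 2 + 1 + 9 + 1/2] stay below 20. *)
Lemma increment_terms (M Q nu b x kap tau d h al W z BC BD : R) :
  0 < b -> b <= 1 / 2 -> 0 < x -> x <= b -> b ^+ 2 <= kap -> kap <= 1 ->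
  1 <= d -> d * b <= 1 -> 0 <= Q -> 0 < nu -> nu ^+ 2 = M ^+ 2 + Q ->
  `|M - 1| <= 1 / 2 -> 9 / 4 <= tau -> 0 < h ->
  h ^+ 2 = (M - 1) ^+ 2 + kap * (Q + tau) -> 0 < al -> al * (1 + b) = 1 ->
  1 <= W -> `|z| <= W / 2 -> z ^+ 2 <= W / 2 -> `|BC| <= W / 2 ->
  0 <= BD -> BD <= d * W / 2 ->
  let T1 := 2 * (M - 1) * (al * b) * (nu * z - M) in
  let T2 := (al * b) ^+ 2 * (nu * z - M) ^+ 2 in
  let T3 := kap * (al ^+ 2 * Q - Q) in
  let T4 := kap * (al ^+ 2 * (2 * b * (nu ^+ 2 * BC))) in
  let T5 := 9 / 4 * (kap * x) in
  let T6 := kap * (al ^+ 2 * (b ^+ 2 * (nu ^+ 2 * BD))) in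
  T2 + T6 <= (3 * b ^+ 2 * nu ^+ 2 + kap * b ^+ 2 * d * nu ^+ 2 / 2) * W /\
  `|T1 + T2 + T3 + T4 - T5 + T6| <= 20 * (b * nu * h) * W.
Proof.
move=> b0 b2 x0 xb bk k1 d1 db Q0 nu0 nu2 M1 tau9 h0 h2 al0 alb W1 z1 z2 BC1 BD0 BD1.
have b20 : 0 < b ^+ 2 by rewrite exprn_gt0.
have k0 : 0 < kap by apply: lt_le_trans bk.
have [eta1 eta2] := noise_bounds nu0 nu2 Q0 W1 z1 z2.
set eta := nu * z - M in eta1 eta2 *.
have n20 : 0 < nu ^+ 2 by rewrite exprn_gt0.
have W0 : 0 <= W by clear -W1; lra.
have al1 : al <= 1.
  by rewrite -alb ler_peMr ?(ltW al0)//; clear -b0; lra.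
have al2 : al ^+ 2 <= 1 by rewrite expr_le1// ltW.
have al20 : 0 <= al ^+ 2 by exact: sqr_ge0.
have al2b : 1 - 2 * b <= al ^+ 2.
  have E : al = 1 - b * al by clear -alb; lra.
  have : 0 <= (b * al) ^+ 2 by exact: sqr_ge0.
  have -> : al ^+ 2 = 1 - 2 * (b * al) + (b * al) ^+ 2 by rewrite {1}E; ring.
  have : b * al <= b * 1 by rewrite ler_pM2l.
  by clear; lra.
have alb0 : 0 <= al * b by rewrite mulr_ge0// ltW.
have albb : al * b <= b by rewrite ler_piMl// ltW.
have /andP[M1l M1r] : 1 / 2 <= M <= 3 / 2.
  by move: M1; rewrite ler_norml; clear => /andP[? ?]; apply/andP; split; lra.
have /andP[M94l M94r] : 1 / 4 <= M ^+ 2 <= 9 / 4.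
  by clear -M1l M1r; apply/andP; split; nra.
have M10 : 0 <= (M - 1) ^+ 2 by exact: sqr_ge0.
have knh : kap * nu ^+ 2 <= h ^+ 2.
  rewrite h2; apply: (@le_trans _ _ (kap * (Q + tau))); last by rewrite lerDr.
  by rewrite ler_pM2l// nu2; clear -M94r tau9; lra.
have hle (y : R) : 0 <= y -> y ^+ 2 <= h ^+ 2 -> y <= h.
  by move=> y0; rewrite ler_pXn2r ?nnegrE ?(ltW h0).
have bn : b * nu <= h.
  apply: hle; first by rewrite mulr_ge0 ?ltW.
  by apply: le_trans knh; rewrite exprMn ler_pM2r.
have kn : kap * nu <= h.
  apply: hle; first by rewrite mulr_ge0 ?ltW.
  apply: le_trans knh; rewrite exprMn ler_pM2r// expr2.
  by rewrite ler_piMr// ltW.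
have M1h : `|M - 1| <= h.
  apply: hle => //; rewrite real_normK ?num_real// h2 lerDl mulr_ge0 ?(ltW k0)//.
  by clear -Q0 tau9; lra.
have bn0 : 0 < b * nu by exact: mulr_gt0.
have kb0 : 0 < kap * b by exact: mulr_gt0.
move=> T1 T2 T3 T4 T5 T6.
have s1 : T2 <= 3 * b ^+ 2 * nu ^+ 2 * W.
  rewrite /T2 (_ : _ * W = b ^+ 2 * (3 * nu ^+ 2 * W)); last by ring.
  by apply: ler_pM => //; rewrite ?sqr_ge0// lerXn2r ?nnegrE// ltW.
have s2 : T6 <= kap * b ^+ 2 * d * nu ^+ 2 / 2 * W.
  have -> : kap * b ^+ 2 * d * nu ^+ 2 / 2 * W = kap * (1 * (b ^+ 2 * (nu ^+ 2 * (d * W / 2)))).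
    by field.
  have BD2 : 0 <= b ^+ 2 * (nu ^+ 2 * BD).
    by apply: mulr_ge0; [exact: ltW|apply: mulr_ge0 => //; exact: ltW].
  by rewrite /T6 ler_pM2l//; apply: ler_pM => //; rewrite ler_pM2l// ler_pM2l.
split; first by rewrite mulrDl lerD.
set e := b * nu * h.
have e0 : 0 < e by exact: mulr_gt0.
have bbe : (b * nu) ^+ 2 <= e by rewrite expr2 /e ler_pM2l.
have kbe : kap * b * nu ^+ 2 <= e.
  by rewrite (_ : _ * _ = (b * nu) * (kap * nu)) /e ?ler_pM2l//; ring.
have eW : e <= e * W by rewrite ler_peMr// ltW.
have t1 : `|T1| <= 4 * (e * W).
  rewrite /T1 (_ : _ * eta = 2 * ((M - 1) * (al * b) * eta)); last by ring.
  rewrite normrM ger0_norm// (_ : 4 * (e * W) = 2 * (h * b * (2 * nu * W))); last by rewrite /e; ring.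
  rewrite ler_pM2l// normrM; apply: ler_pM => //.
  by rewrite normrM (ger0_norm alb0); apply: ler_pM.
have t2 : T2 <= 3 * (e * W).
  apply: le_trans s1 _; rewrite (_ : _ * W = 3 * ((b * nu) ^+ 2 * W)); last by ring.
  by rewrite ler_pM2l// ler_wpM2r.
have t20 : 0 <= T2 by rewrite mulr_ge0 ?sqr_ge0.
have t3 : `|T3| <= 2 * e.
  have Qn : Q <= nu ^+ 2 by rewrite nu2 lerDr sqr_ge0.
  have kbQ : kap * b * Q <= e by apply: le_trans kbe; rewrite ler_pM2l.
  have : kap * ((1 - 2 * b) * Q - Q) <= T3.
    by rewrite ler_pM2l// lerD2r ler_wpM2r.
  have : T3 <= kap * 0 by rewrite ler_pM2l// subr_le0 ler_piMl.
  by rewrite ler_norml; clear -kbQ e0 => H1 H2; apply/andP; split; lra.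
have t4 : `|T4| <= e * W.
  rewrite /T4 (_ : kap * _ = (kap * b * nu ^+ 2) * (al ^+ 2 * (2 * BC))); last by ring.
  have kbn : 0 < kap * b * nu ^+ 2 by exact: mulr_gt0.
  rewrite normrM (gtr0_norm kbn); apply: ler_pM => //; first exact: ltW.
  rewrite normrM -[leRHS]mul1r ger0_norm//; apply: ler_pM => //.
  by rewrite normrM ger0_norm//; clear -BC1; lra.
have [t50 t5] : 0 <= T5 /\ T5 <= 9 * e.
  have k1x : kap * x <= kap * b by rewrite ler_pM2l.
  have k2x : kap * b * (1 / 4) <= kap * b * nu ^+ 2.
    by rewrite ler_pM2l// nu2; clear -M94l Q0; lra.
  have k3x : 0 < kap * x by exact: mulr_gt0.
  by rewrite /T5; clear -k1x k2x k3x kbe; split; lra.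
have t6 : T6 <= 1 / 2 * (e * W).
  apply: le_trans s2 _.
  rewrite (_ : _ * W = 1 / 2 * ((d * b) * (kap * b * nu ^+ 2) * W)); last by field.
  have d0 : 0 <= d by exact: le_trans d1.
  rewrite ler_pM2l// ler_wpM2r// -[leRHS]mul1r; apply: ler_pM => //.
    by rewrite mulr_ge0// ltW.
  by rewrite mulr_ge0 ?(ltW n20)// ltW.
have t60 : 0 <= T6.
  apply: mulr_ge0; first exact: ltW.
  apply: mulr_ge0; first by [].
  by apply: mulr_ge0; [exact: ltW|apply: mulr_ge0 => //; exact: ltW].
clearbody T1 T2 T3 T4 T5 T6 e.
move: t1 t3 t4; rewrite !ler_norml => /andP[u1 v1] /andP[u3 v3] /andP[u4 v4].
have -> : 20 * e * W = 20 * (e * W) by ring.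
clear -t2 t20 t5 t50 t6 t60 e0 eW u1 v1 u3 v3 u4 v4.
by apply/andP; split; lra.
Qed.

Lemma potential_increment (M Q nu b x kap tau d X0 Bn Cn D W4 h : R) :
  0 < b -> b <= 1 / 2 -> 0 < x -> x <= b -> b ^+ 2 <= kap -> kap <= 1 ->
  1 <= d -> d * b <= 1 -> 0 <= Q -> 0 < nu -> nu ^+ 2 = M ^+ 2 + Q ->
  `|M - 1| <= 1 / 2 -> 0 <= D -> D ^+ 2 <= d ^+ 2 * W4 -> 0 <= W4 ->
  9 / 4 <= tau -> 0 < h -> h ^+ 2 = (M - 1) ^+ 2 + kap * (Q + tau) ->
  let W := 1 + X0 ^+ 4 + Bn ^+ 4 + Cn ^+ 4 + W4 in
  let al := (1 + b)^-1 in
  let M' := al * (M + b * (nu * Bn * X0)) in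
  let Q' := al ^+ 2 * (Q + 2 * b * (nu ^+ 2 * (Bn * Cn)) + b ^+ 2 * (nu ^+ 2 * Bn ^+ 2 * D)) in
  let dH := (M' - 1) ^+ 2 + kap * (Q' + (tau - 9 / 4 * x)) - h ^+ 2 in
  dH <= 2 * (M - 1) * (al * b) * (nu * Bn * X0 - M) +
        kap * (al ^+ 2 * (Q + 2 * b * (nu ^+ 2 * (Bn * Cn))) - Q - 9 / 4 * x) +
        (3 * b ^+ 2 * nu ^+ 2 + kap * b ^+ 2 * d * nu ^+ 2 / 2) * W /\
  `|dH| <= 20 * (b * nu * h) * W.
Proof.
move=> b0 b2 x0 xb bk k1 d1 db Q0 nu0 nu2 M1 D0 D2 W40 tau9 h0 h2 W al M' Q' dH.
have [W1 BX BC BX2 BD] := dominated_products X0 Bn Cn d1 D0 D2 W40.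
rewrite -/W in W1 BX BC BX2 BD.
have b10 : 0 < 1 + b by clear -b0; lra.
have al0 : 0 < al by rewrite invr_gt0.
have alb : al * (1 + b) = 1 by rewrite mulVf// gt_eqF.
have BD0 : 0 <= Bn ^+ 2 * D by rewrite mulr_ge0 ?sqr_ge0.
have [] := increment_terms b0 b2 x0 xb bk k1 d1 db Q0 nu0 nu2 M1 tau9 h0 h2 al0 alb
  W1 BX BX2 BC BD0 BD.
have M'E : M' - 1 = (M - 1) + al * b * (nu * (Bn * X0) - M).
  rewrite /M'; have -> : M - 1 = al * (1 + b) * M - 1 by rewrite alb mul1r.
  by ring.
have dHE : dH = 2 * (M - 1) * (al * b) * (nu * (Bn * X0) - M) +
    (al * b) ^+ 2 * (nu * (Bn * X0) - M) ^+ 2 + kap * (al ^+ 2 * Q - Q) +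
    kap * (al ^+ 2 * (2 * b * (nu ^+ 2 * (Bn * Cn)))) - 9 / 4 * (kap * x) +
    kap * (al ^+ 2 * (b ^+ 2 * (nu ^+ 2 * (Bn ^+ 2 * D)))).
  by rewrite /dH h2 M'E /Q'; clear; ring.
rewrite -dHE => H1 H2; split => //.
apply: (@le_trans _ _ (2 * (M - 1) * (al * b) * (nu * Bn * X0 - M) +
   kap * (al ^+ 2 * (Q + 2 * b * (nu ^+ 2 * (Bn * Cn))) - Q - 9 / 4 * x) +
   ((al * b) ^+ 2 * (nu * (Bn * X0) - M) ^+ 2 +
    kap * (al ^+ 2 * (b ^+ 2 * (nu ^+ 2 * (Bn ^+ 2 * D))))))); last by rewrite lerD2l.
by rewrite dHE le_eqVlt; apply/orP; left; apply/eqP; clear; ring.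
Qed.

End increment_inequalities.

(** * One step of the recursion *)

Section one_step.
Context {R : realType} {disp : measure_display} {T : measurableType disp}.
Variables (P : probability T R) (n : nat) (xi : T -> 'cV[R]_n.+1) (l : 'I_n.+1 -> R).
Hypotheses (mxi : measurable_fun setT xi)
  (ixi : forall a b, itg P (fun w => dotp a (xi w) * dotp b (xi w)))
  (cov : forall a b, Ex P (fun w => dotp a (xi w) * dotp b (xi w)) =
     \sum_i l i * (a i 0 * b i 0))
  (mom : forall a k, (0 < k)%N -> itg P (fun w => dotp a (xi w) ^+ (4 * k)) /\
     Ex P (fun w => dotp a (xi w) ^+ (4 * k)) <=
       (16 * k%:R ^+ 2) ^+ k * (\sum_i l i * a i 0 ^+ 2) ^+ (2 * k))
  (l0 : l 0 = 1) (l01 : forall i, 0 <= l i <= 1).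

Lemma unit_moment a k : (0 < k)%N -> dotp a a <= 1 ->
  Ex P (fun w => dotp a (xi w) ^+ (4 * k)) <= (16 * k%:R ^+ 2) ^+ k.
Proof.
move=> k0 a1; apply: le_trans (mom a k0).2 _.
rewrite ler_piMr//.
have s0 : 0 <= \sum_i l i * a i 0 ^+ 2.
  by apply: sumr_ge0 => i _; rewrite mulr_ge0 ?sqr_ge0//; case/andP: (l01 i).
rewrite exprn_ile1//; apply: le_trans a1; rewrite dotpE; apply: ler_sum => i _.
by rewrite -expr2 ler_piMl ?sqr_ge0//; case/andP: (l01 i).
Qed.

(** The [W] of the increment bounds. Averaging the fourth powers over the coordinates keeps its
    moments free of the dimension. *)
Definition dominator (a c : 'cV[R]_n.+1) (v : 'cV[R]_n.+1) : R :=
  1 + v 0 0 ^+ 4 + dotp a v ^+ 4 + dotp c v ^+ 4 +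
  n.+1%:R^-1 * \sum_i v i 0 ^+ 4.

Lemma measurable_dominator a c : measurable_fun setT (fun w => dominator a c (xi w)).
Proof. by rewrite /dominator; mfun. Qed.

Lemma dominator_ge1 a c v : 1 <= dominator a c v.
Proof.
have e4 (z : R) : 0 <= z ^+ 4 by rewrite exprn_even_ge0.
rewrite /dominator -!addrA lerDl !addr_ge0// mulr_ge0 ?invr_ge0//.
by apply: sumr_ge0.
Qed.

(** Power means, once over the five summands and once inside the average; 80 is 5 times the 16 of
    the moment bounds. *)
Lemma dominator_moment a c k : (0 < k)%N -> dotp a a <= 1 -> dotp c c <= 1 ->
  itg P (fun w => dominator a c (xi w) ^+ k) /\
  Ex P (fun w => dominator a c (xi w) ^+ k) <= (80 * k%:R ^+ 2) ^+ k.
Proof.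
move=> k0 a1 c1; pose m : R := (16 * k%:R ^+ 2) ^+ k.
have m1 : 1 <= m.
  rewrite exprn_ege1//; have : 1 <= k%:R ^+ 2 :> R by rewrite exprn_ege1// ler1n.
  by lra.
pose e i : 'cV[R]_n.+1 := delta_mx i 0.
have e1 i : dotp (e i) (e i) <= 1 by rewrite dotp_delta mxE !eqxx.
pose g w := dotp (e 0) (xi w) ^+ (4 * k) + (dotp a (xi w) ^+ (4 * k) +
  (dotp c (xi w) ^+ (4 * k) + n.+1%:R^-1 * \sum_i dotp (e i) (xi w) ^+ (4 * k))).
have is_ : itg P (fun w => n.+1%:R^-1 * \sum_i dotp (e i) (xi w) ^+ (4 * k)).
  by apply: itgZ; apply: itg_sum => i; case: (mom (e i) k0).
have ia := (mom a k0).1; have ic := (mom c k0).1; have i0 := (mom (e 0) k0).1.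
have ig : itg P g by do 3 apply: itgD => //.
have iG : itg P (fun w => 5 ^+ k.-1 * (1 + g w)).
  by apply: itgZ; apply: itgD => //; exact: itg_cst.
have e4 (z : R) : 0 <= z ^+ 4 by rewrite exprn_even_ge0.
have dg w : dominator a c (xi w) ^+ k <= 5 ^+ k.-1 * (1 + g w).
  pose S4 := n.+1%:R^-1 * \sum_i xi w i 0 ^+ 4.
  have S40 : 0 <= S4 by rewrite mulr_ge0 ?invr_ge0 ?sumr_ge0.
  pose s := [:: 1; xi w 0 0 ^+ 4; dotp a (xi w) ^+ 4; dotp c (xi w) ^+ 4; S4].
  have := @power_mean R 5 (fun i => s`_i) k.-1.
  rewrite prednK// !big_ord_recl !big_ord0/= !addr0 => pm.
  have {pm} pm : dominator a c (xi w) ^+ k <= 5 ^+ k.-1 * (1 ^+ k +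
     ((xi w 0 0 ^+ 4) ^+ k + ((dotp a (xi w) ^+ 4) ^+ k +
     ((dotp c (xi w) ^+ 4) ^+ k + S4 ^+ k)))).
    rewrite (_ : dominator _ _ _ = 1 + (xi w 0 0 ^+ 4 + (dotp a (xi w) ^+ 4 +
      (dotp c (xi w) ^+ 4 + S4)))); last by rewrite /dominator/S4; ring.
    by apply: pm => -[[|[|[|[|[|i]]]]] hi] //=; exact: e4.
  apply: le_trans pm _; rewrite ler_pM2l ?exprn_gt0// expr1n lerD2l /g dotp_delta.
  rewrite !exprM !lerD2l /S4 exprMn.
  have pm := @power_mean R n.+1 (fun i => xi w i 0 ^+ 4) k.-1 (fun i => e4 _).
  rewrite prednK// in pm.
  apply: le_trans (_ : n.+1%:R^-1 ^+ k * (n.+1%:R ^+ k.-1 *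
      \sum_i (xi w i 0 ^+ 4) ^+ k) <= _).
    by rewrite ler_wpM2l// exprn_ge0// invr_ge0.
  rewrite mulrA -{1}(prednK k0) exprS -(mulrA _ (_ ^+ _)) -exprMn.
  rewrite mulVf ?pnatr_eq0// expr1n mulr1 le_eqVlt; apply/orP; left; apply/eqP.
  by congr (_ * _); apply: eq_bigr => i _; rewrite dotp_delta exprM.
have d0 w : 0 <= dominator a c (xi w) ^+ k.
  by rewrite exprn_ge0// (le_trans _ (dominator_ge1 _ _ _)).
have id : itg P (fun w => dominator a c (xi w) ^+ k).
  apply: itg_le iG _; first by apply: measurable_funX; exact: measurable_dominator.
  by move=> w; rewrite ger0_norm.
split => //; apply: le_trans (Ex_le id iG dg) _.
rewrite ExZ; last by apply: itgD => //; exact: itg_cst.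
rewrite ExD ?Ex_cst//; last exact: itg_cst.
rewrite /g ExD//; last by do 2 apply: itgD => //.
rewrite ExD//; last by apply: itgD => //.
rewrite ExD// ExZ; last by apply: itg_sum => i; case: (mom (e i) k0).
rewrite Ex_sum => [|i]; last by case: (mom (e i) k0).
have Es : n.+1%:R^-1 * \sum_i Ex P (fun w => dotp (e i) (xi w) ^+ (4 * k)) <= m.
  rewrite mulrC ler_pdivrMr//; apply: le_trans (_ : \sum_(i < n.+1) m <= _).
    by apply: ler_sum => i _; exact: unit_moment.
  by rewrite sumr_const card_ord mulr_natr.
have := unit_moment k0 a1; have := unit_moment k0 c1; have := unit_moment k0 (e1 0).
rewrite -/m => h1 h2 h3.
rewrite (_ : 80 * k%:R ^+ 2 = 5 * (16 * k%:R ^+ 2)); last by ring.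
rewrite exprMn -/m (_ : 5 ^+ k = 5 ^+ k.-1 * 5); last by rewrite -exprSr prednK.
rewrite -mulrA ler_pM2l ?exprn_gt0//.
rewrite (_ : 5 * m = m + (m + (m + (m + m)))); last by ring.
by do 4 apply: lerD => //.
Qed.

Definition pca_step (b : R) (y v : 'cV[R]_n.+1) : 'cV[R]_n.+1 :=
  (1 + b)^-1 *: (y + (b * dotp v y) *: v).

Definition tail_sq (y : 'cV[R]_n.+1) : R := \sum_(i < n) y (lift 0 i) 0 ^+ 2.

(* For [kap] of order [p * r] with [p] about [ln (1 / r)], the [p]-th power of
   the potential is a supermartingale as long as the first coordinate stays in
   [1/2, 3/2]; [tau] is a deterministic term decreasing by [9/4 x] per step that
   absorbs the noise. *)
Definition potential (kap tau : R) (y : 'cV[R]_n.+1) : R :=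
  (y 0 0 - 1) ^+ 2 + kap * (tail_sq y + tau).

Lemma dotp_tail_sq y : dotp y y = y 0 0 ^+ 2 + tail_sq y.
Proof. by rewrite dotpE big_ord_recl -expr2. Qed.

Lemma tail_sq_ge0 y : 0 <= tail_sq y.
Proof. by apply: sumr_ge0 => i _; exact: sqr_ge0. Qed.

Lemma pca_stepE b y v i :
  pca_step b y v i 0 = (1 + b)^-1 * (y i 0 + b * (dotp y v * v i 0)).
Proof. by rewrite !mxE dotpC mulrA. Qed.

Let e0 : 'cV[R]_n.+1 := delta_mx 0 0.

Lemma tail_sq_pca_step b y v : tail_sq (pca_step b y v) =
  (1 + b)^-1 ^+ 2 * (tail_sq y + 2 * b * (dotp y v * dotp (y - y 0 0 *: e0) v) +
    b ^+ 2 * (dotp y v ^+ 2 * tail_sq v)).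
Proof.
have -> : dotp (y - y 0 0 *: e0) v = \sum_(i < n) y (lift 0 i) 0 * v (lift 0 i) 0.
  by rewrite dotpBl dotpZl dotp_delta dotpE big_ord_recl addrAC subrr add0r.
rewrite /tail_sq !mulr_sumr -!big_split/= mulr_sumr; apply: eq_bigr => i _.
by rewrite pca_stepE; ring.
Qed.

(** With [B = <y, xi>] and [X = xi_i], the product [B^2 X^2] is split with weights [N / l'] and
    [l' / N], and both halves have mean at most [8 l' N]. So the noise in coordinate [i] is
    proportional to [l'], a positive number above the eigenvalue [l i], which itself may vanish. *)
Lemma coord_step_second_moment (b l' : R) (y : 'cV[R]_n.+1) i :
  0 < b -> 0 < l' -> l i <= l' -> 0 < dotp y y ->
  (\int[P]_w (pca_step b y (xi w) i 0 ^+ 2)%:E <=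
   (((1 + b * l i) / (1 + b)) ^+ 2 * y i 0 ^+ 2 + 16 * b ^+ 2 * l' * dotp y y)%:E)%E.
Proof.
move=> b0 l'0 ll' y0; set N := dotp y y in y0 *.
pose ei : 'cV[R]_n.+1 := delta_mx i 0; pose al := (1 + b)^-1.
have al0 : 0 < al by rewrite invr_gt0; lra.
have al1 : al <= 1 by rewrite invf_le1; lra.
have lge0 j : 0 <= l j by case/andP: (l01 j).
have i4 := (mom ei (ltnSn 0)).1; have y4 := (mom y (ltnSn 0)).1.
have iy := ixi y ei.
pose g w := al ^+ 2 * (y i 0 ^+ 2) +
  (al ^+ 2 * (2 * b * y i 0) * (dotp y (xi w) * dotp ei (xi w)) +
  (b ^+ 2 / 2 * (N / l') * dotp ei (xi w) ^+ (4 * 1) +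
   b ^+ 2 / 2 * (l' / N) * dotp y (xi w) ^+ (4 * 1))).
have ii := itgZ (al ^+ 2 * (2 * b * y i 0)) iy.
have jj := itgZ (b ^+ 2 / 2 * (N / l')) i4.
have kk := itgZ (b ^+ 2 / 2 * (l' / N)) y4.
have ig : itg P g.
  by apply: itgD; [exact: itg_cst|apply: itgD => //; exact: itgD].
have Ll : N / l' * l' = N by rewrite mulfVK// gt_eqF.
have LN : l' / N * N = l' by rewrite mulfVK// gt_eqF.
apply: (@le_trans _ _ (\int[P]_w (g w)%:E)%E).
  apply: ge0_le_integral => //.
  - by move=> w _; rewrite lee_fin sqr_ge0.
  - apply/measurable_EFinP; rewrite (_ : (fun w => _) = fun w =>
      (al * (y i 0 + b * (dotp y (xi w) * xi w i 0))) ^+ 2); first by mfun.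
    by apply/funext => w; rewrite pca_stepE.
  - by apply/measurable_EFinP; exact: (itg_measurable ig).
  - move=> w _; rewrite lee_fin pca_stepE -/al /g dotp_delta muln1.
    move: (xi w i 0) (dotp y (xi w)) => X B.
    have am : B ^+ 2 * X ^+ 2 <= N / l' / 2 * X ^+ 4 + l' / N / 2 * B ^+ 4.
      have : 0 <= (N * X ^+ 2 - l' * B ^+ 2) ^+ 2 / (2 * (N * l')).
        by rewrite divr_ge0 ?sqr_ge0// !mulr_ge0// ltW.
      have -> : (N * X ^+ 2 - l' * B ^+ 2) ^+ 2 / (2 * (N * l')) =
          N / l' / 2 * X ^+ 4 + l' / N / 2 * B ^+ 4 - B ^+ 2 * X ^+ 2.
        by field; rewrite !gt_eqF.
      by rewrite subr_ge0.
    have -> : (al * (y i 0 + b * (B * X))) ^+ 2 = al ^+ 2 * y i 0 ^+ 2 +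
      (al ^+ 2 * (2 * b * y i 0) * (B * X) + al ^+ 2 * (b ^+ 2 * (B ^+ 2 * X ^+ 2))).
      by ring.
    rewrite !lerD2l; apply: (@le_trans _ _ (1 * (b ^+ 2 * (B ^+ 2 * X ^+ 2)))).
      rewrite ler_wpM2r ?expr_le1// ?(ltW al0)//.
      by do 2 (apply: mulr_ge0; first exact: sqr_ge0); exact: sqr_ge0.
    rewrite mul1r; apply: le_trans (_ : b ^+ 2 * (N / l' / 2 * X ^+ 4 + l' / N / 2 * B ^+ 4) <= _).
      by rewrite ler_pM2l// exprn_gt0.
    by rewrite le_eqVlt; apply/orP; left; apply/eqP; ring.
rewrite (ExE ig) lee_fin /g ExD ?Ex_cst//; [|exact: itg_cst|by apply: itgD => //; exact: itgD].
rewrite ExD//; last exact: itgD.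
rewrite ExD// !ExZ// cov.
have -> : \sum_j l j * (y j 0 * ei j 0) = l i * y i 0.
  rewrite (bigD1 i)//= !mxE !eqxx mulr1 big1 ?addr0// => j /negbTE ji.
  by rewrite !mxE ji !mulr0.
have Ei : Ex P (fun w => dotp ei (xi w) ^+ (4 * 1)) <= 16 * l' ^+ 2.
  apply: le_trans (mom ei (ltnSn 0)).2 _; rewrite expr1 expr1n mulr1 ler_pM2l//.
  rewrite (bigD1 i)//= !mxE !eqxx expr1n mulr1 big1 ?addr0 => [|j /negbTE ji].
    by rewrite lerXn2r ?nnegrE// ltW.
  by rewrite !mxE ji expr0n mulr0.
have Ey : Ex P (fun w => dotp y (xi w) ^+ (4 * 1)) <= 16 * N ^+ 2.
  apply: le_trans (mom y (ltnSn 0)).2 _; rewrite expr1 expr1n mulr1 ler_pM2l//.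
  rewrite lerXn2r ?nnegrE ?(ltW y0)//.
    by apply: sumr_ge0 => j _; rewrite mulr_ge0 ?sqr_ge0.
  rewrite /N dotpE; apply: ler_sum => j _; rewrite -expr2 ler_piMl ?sqr_ge0//.
  by case/andP: (l01 j).
have b20 : 0 < b ^+ 2 by rewrite exprn_gt0.
have h1 : b ^+ 2 / 2 * (N / l') * Ex P (fun w => dotp ei (xi w) ^+ (4 * 1)) <=
    8 * b ^+ 2 * l' * N.
  apply: (@le_trans _ _ (b ^+ 2 / 2 * (N / l') * (16 * l' ^+ 2))).
    by rewrite ler_wpM2l// !mulr_ge0// ?invr_ge0 ltW.
  by rewrite le_eqVlt; apply/orP; left; apply/eqP; field; rewrite gt_eqF.
have h2 : b ^+ 2 / 2 * (l' / N) * Ex P (fun w => dotp y (xi w) ^+ (4 * 1)) <=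
    8 * b ^+ 2 * l' * N.
  apply: (@le_trans _ _ (b ^+ 2 / 2 * (l' / N) * (16 * N ^+ 2))).
    by rewrite ler_wpM2l// !mulr_ge0// ?invr_ge0 ltW.
  by rewrite le_eqVlt; apply/orP; left; apply/eqP; field; rewrite gt_eqF.
have h3 : al ^+ 2 * y i 0 ^+ 2 + al ^+ 2 * (2 * b * y i 0) * (l i * y i 0) <=
    ((1 + b * l i) / (1 + b)) ^+ 2 * y i 0 ^+ 2.
  rewrite -/al (_ : _ ^+ 2 * y i 0 ^+ 2 = al ^+ 2 * y i 0 ^+ 2 +
     al ^+ 2 * (2 * b * y i 0) * (l i * y i 0) + (al * b * l i * y i 0) ^+ 2); last by ring.
  by rewrite lerDl sqr_ge0.
by lra.
Qed.

Lemma measurable_potential (kap tau : R) : measurable_fun setT (potential kap tau).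
Proof. by rewrite /potential /tail_sq; mfun. Qed.

Lemma measurable_pca_step b : measurable_fun setT (fun z => pca_step b z.1 z.2).
Proof.
apply: measurable_fun_matrix => i j; rewrite ord1.
rewrite (_ : (fun z => _) = fun z : 'cV[R]_n.+1 * 'cV[R]_n.+1 =>
  (1 + b)^-1 * (z.1 i 0 + b * (dotp z.1 z.2 * z.2 i 0))).
  have m1 : measurable_fun setT (fst : 'cV[R]_n.+1 * 'cV[R]_n.+1 -> _).
    exact: measurable_fst.
  have m2 : measurable_fun setT (snd : 'cV[R]_n.+1 * 'cV[R]_n.+1 -> _).
    exact: measurable_snd.
  by mfun.
by apply/funext => z; rewrite pca_stepE.
Qed.

Lemma potential_ge (kap tau : R) (y : 'cV[R]_n.+1) : 0 <= kap -> 9 / 4 <= tau -> `|y 0 0 - 1| <= 1 / 2 ->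
  kap * dotp y y <= potential kap tau y.
Proof.
move=> k0 t9; rewrite ler_norml => /andP[M1 M2].
rewrite /potential dotp_tail_sq; apply: ler_wpDl; first exact: sqr_ge0.
by rewrite ler_wpM2l// addrC lerD2l; nra.
Qed.

(** Expand [(1 + dH / H)^p]. The linear term has mean at most [- p kap x N / (2 H)], the terms of
    order at least 2 are bounded by the moments of the dominator, and [kap] is chosen so that the
    two cancel. *)
Lemma potential_step (b x kap tau : R) (p : nat) (y : 'cV[R]_n.+1) :
  0 < b -> b <= 1 / 2 -> 0 < x -> x <= b ->
  (forall i, i != 0 -> b * l i <= b - x) ->
  kap * x = 130 * 1600 ^+ 2 * p%:R * b ^+ 2 -> kap <= 1 -> 160 * n.+1%:R * b ^+ 2 <= x ->
  n.+1%:R * b <= 1 -> (0 < p)%N -> (128 * 1600) ^+ 2 * p%:R ^+ 8 * x <= 1 ->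
  9 / 4 <= tau -> `|y 0 0 - 1| <= 1 / 2 ->
  (\int[P]_w (potential kap (tau - 9 / 4 * x) (pca_step b y (xi w)) ^+ p)%:E <=
   (potential kap tau y ^+ p)%:E)%E.
Proof.
move=> b0 b2 x0 xb lb kapE k1 db2 db p0 p8 t9 M1.
have p1 : 1 <= p%:R :> R by rewrite ler1n.
have [G1 G10] := @step_const_ge R.
have [G GE] : exists G : R, G = 130 * 1600 ^+ 2 by eexists.
rewrite -GE in kapE G1 G10.
have G0 : 0 < G by exact: lt_le_trans G10.
have b20 : 0 < b ^+ 2 by rewrite exprn_gt0.
have k0 : 0 < kap.
  by rewrite -(pmulr_lgt0 _ x0) kapE mulr_gt0// mulr_gt0 ?ltr0n.
have Gp : 1 <= G * p%:R by rewrite (le_trans G10)// ler_peMr// ltW.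
have x1 : x <= 1 by apply: le_trans xb (le_trans b2 _); lra.
have bk : b ^+ 2 <= kap.
  apply: (@le_trans _ _ (kap * x)); last by rewrite ler_piMr// ltW.
  by rewrite kapE ler_peMl// ltW.
set M := y 0 0; set Q := tail_sq y; set N := dotp y y.
have NE : N = M ^+ 2 + Q by exact: dotp_tail_sq.
have Q0 : 0 <= Q by exact: tail_sq_ge0.
have [M14 M94] := sqr_near1 M1; rewrite -/M in M14 M94.
have N0 : 0 < N by rewrite NE ltr_wpDr// (lt_le_trans _ M14)// divr_gt0.
pose nu := Num.sqrt N; have nu0 : 0 < nu by rewrite sqrtr_gt0.
have nu2 : nu ^+ 2 = N by rewrite sqr_sqrtr// ltW.
have kN := potential_ge (ltW k0) t9 M1.
set H := potential kap tau y in kN *; rewrite -/N in kN.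
have kN0 : 0 < kap * N by exact: mulr_gt0.
have H0 : 0 < H by apply: lt_le_trans kN.
pose h := Num.sqrt H; have h0 : 0 < h by rewrite sqrtr_gt0.
have h2 : h ^+ 2 = H by rewrite sqr_sqrtr// ltW.
pose y' := y - M *: e0.
pose a := nu^-1 *: y; pose c := nu^-1 *: y'.
have y'N : dotp y' y' = Q.
  rewrite /y' dotpBl !dotpBr !dotpZl !dotpZr (dotpC y e0) !dotp_delta -/N NE mxE eqxx.
  by rewrite /= -/M; ring.
have a1 : dotp a a <= 1.
  by rewrite /a dotpZl dotpZr mulrA -invfM -expr2 nu2 mulVf// gt_eqF.
have c1 : dotp c c <= 1.
  rewrite /c dotpZl dotpZr mulrA -invfM -expr2 nu2 y'N mulrC ler_pdivrMr// mul1r NE.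
  by rewrite lerDr sqr_ge0.
pose al := (1 + b)^-1.
pose d : R := n.+1%:R.
have d1 : 1 <= d by rewrite ler1n.
pose K := 3 * b ^+ 2 * N + kap * b ^+ 2 * d * N / 2.
pose W w := dominator a c (xi w).
(* The first two terms stay exact because they are small in the mean only: the one of the first
   coordinate is centred. *)
pose U w := 2 * (M - 1) * (al * b) * (dotp y (xi w) * dotp e0 (xi w) - M) +
  kap * (al ^+ 2 * (Q + 2 * b * (dotp y (xi w) * dotp y' (xi w))) - Q - 9 / 4 * x) +
  K * W w.
pose dH w := potential kap (tau - 9 / 4 * x) (pca_step b y (xi w)) - H.
have inc w : dH w <= U w /\ `|dH w| <= 20 * (b * nu * h) * W w.
  pose X := xi w.
  have D0 : 0 <= tail_sq X by exact: tail_sq_ge0.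
  have e4 (z : R) : 0 <= z ^+ 4 by rewrite exprn_even_ge0.
  have W40 : 0 <= n.+1%:R^-1 * \sum_i X i 0 ^+ 4.
    by rewrite mulr_ge0 ?invr_ge0 ?sumr_ge0.
  have D2 : tail_sq X ^+ 2 <= d ^+ 2 * (n.+1%:R^-1 * \sum_i X i 0 ^+ 4).
    have -> : d ^+ 2 * (n.+1%:R^-1 * \sum_i X i 0 ^+ 4) = d * \sum_i X i 0 ^+ 4.
      by rewrite expr2 mulrA -(mulrA d) divff ?pnatr_eq0// mulr1.
    apply: le_trans (power_mean 1 (fun i => sqr_ge0 (X (lift 0 i) 0))) _.
    rewrite expr1; apply: ler_pM => //; first by apply: sumr_ge0 => i _; exact: sqr_ge0.
      by rewrite ler_nat.
    rewrite [leRHS]big_ord_recl; under eq_bigr do rewrite -exprM.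
    by rewrite lerDr.
  have yB : dotp y X = nu * dotp a X by rewrite /a dotpZl mulVKf ?gt_eqF.
  have yC : dotp y' X = nu * dotp c X by rewrite /c dotpZl mulVKf ?gt_eqF.
  have hE : h ^+ 2 = (M - 1) ^+ 2 + kap * (Q + tau) by rewrite h2.
  have nuE : nu ^+ 2 = M ^+ 2 + Q by rewrite nu2.
  have := @potential_increment R M Q nu b x kap tau d (X 0 0) (dotp a X) (dotp c X)
    (tail_sq X) (n.+1%:R^-1 * \sum_i X i 0 ^+ 4) h b0 b2 x0 xb bk k1 d1 db Q0 nu0
    nuE M1 D0 D2 W40 t9 h0 hE.
  rewrite /= -/al.
  have -> : (al * (M + b * (nu * dotp a X * X 0 0)) - 1) ^+ 2 +
    kap * (al ^+ 2 * (Q + 2 * b * (nu ^+ 2 * (dotp a X * dotp c X)) +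
      b ^+ 2 * (nu ^+ 2 * dotp a X ^+ 2 * tail_sq X)) + (tau - 9 / 4 * x)) - h ^+ 2 = dH w.
    rewrite /dH h2 /potential tail_sq_pca_step pca_stepE -/al -/M -/Q -/X -/y' yB yC.
    by ring.
  rewrite /U /K -/X dotp_delta yB yC nu2.
  rewrite (_ : nu * dotp a X * (nu * dotp c X) = N * (dotp a X * dotp c X)); last first.
    by rewrite -nu2; ring.
  by [].
have iW k (k0' : (0 < k)%N) := dominator_moment k0' a1 c1.
have [iW1 EW1] : itg P W /\ Ex P W <= 80.
  have WE : (fun w => dominator a c (xi w) ^+ 1) = W.
    by apply/funext => w; rewrite expr1.
  by have := iW 1%N isT; rewrite WE expr1 expr1n mulr1.
have iye := ixi y e0; have iyy := ixi y y'.
have Eye : Ex P (fun w => dotp y (xi w) * dotp e0 (xi w)) = M.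
  rewrite cov (bigD1 0)//= l0 !mxE !eqxx mul1r mulr1 big1 ?addr0// => i /negbTE i0.
  by rewrite !mxE i0 !mulr0.
set q := Ex P (fun w => dotp y (xi w) * dotp y' (xi w)).
(* [y'] has no first coordinate, so only eigenvalues with [b * l i <= b - x] enter. *)
have bq : b * q <= (b - x) * Q.
  rewrite /q cov big_ord_recl !mxE /= mulr1 subrr !mulr0 add0r !mulr_sumr.
  apply: ler_sum => i _; rewrite !mxE /= mulr0 subr0 -expr2 mulrA.
  by rewrite ler_wpM2r ?sqr_ge0// lb.
have iU : itg P U.
  apply: itgD; last exact: itgZ.
  apply: itgD; first by apply: itgZ; apply: itgB => //; exact: itg_cst.
  apply: itgZ; apply: itgB; last exact: itg_cst.
  apply: itgB; last exact: itg_cst.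
  by apply: itgZ; apply: itgD; [exact: itg_cst|exact: itgZ].
have EU : Ex P U <= - (kap * x * N / 2).
  have -> : Ex P U = kap * (al ^+ 2 * (Q + 2 * b * q) - Q - 9 / 4 * x) + K * Ex P W.
    rewrite /U ExD; [|apply: itgD|exact: itgZ]; last 2 first.
    - by apply: itgZ; apply: itgB => //; exact: itg_cst.
    - apply: itgZ; apply: itgB; last exact: itg_cst.
      apply: itgB; last exact: itg_cst.
      by apply: itgZ; apply: itgD; [exact: itg_cst|exact: itgZ].
    rewrite ExD; last 2 first.
    - by apply: itgZ; apply: itgB => //; exact: itg_cst.
    - apply: itgZ; apply: itgB; last exact: itg_cst.
      apply: itgB; last exact: itg_cst.
      by apply: itgZ; apply: itgD; [exact: itg_cst|exact: itgZ].
    rewrite ExZ; last by apply: itgB => //; exact: itg_cst.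
    rewrite ExB ?Ex_cst ?Eye ?subrr ?mulr0 ?add0r//; last exact: itg_cst.
    rewrite !ExZ//; last first.
      apply: itgB; last exact: itg_cst.
      apply: itgB; last exact: itg_cst.
      by apply: itgZ; apply: itgD; [exact: itg_cst|exact: itgZ].
    rewrite ExB ?Ex_cst//; last 2 first.
    - apply: itgB; last exact: itg_cst.
      by apply: itgZ; apply: itgD; [exact: itg_cst|exact: itgZ].
    - exact: itg_cst.
    rewrite ExB ?Ex_cst//; last 2 first.
    - by apply: itgZ; apply: itgD; [exact: itg_cst|exact: itgZ].
    - exact: itg_cst.
    rewrite ExZ; last by apply: itgD; [exact: itg_cst|exact: itgZ].
    by rewrite ExD ?Ex_cst ?ExZ//; [exact: itg_cst|exact: itgZ].
  have contr : al ^+ 2 * (Q + 2 * b * q) <= (1 - x) * Q.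
    apply: (@le_trans _ _ (al ^+ 2 * ((1 + 2 * b - 2 * x) * Q))).
      rewrite ler_wpM2l ?sqr_ge0//.
      rewrite (_ : (1 + 2 * b - 2 * x) * Q = Q + 2 * ((b - x) * Q)); last by ring.
      by rewrite lerD2l -mulrA ler_pM2l.
    by rewrite mulrA ler_wpM2r// contraction_le.
  have NQ : N <= Q + 9 / 4.
    by rewrite NE addrC lerD2l.
  have KE : 80 * K <= kap * x * N / 2 by apply: (noise_le G1 p1).
  have K0 : 0 <= K.
    have N00 := ltW N0; have k00 := ltW k0; have b200 := ltW b20.
    have d0 : 0 <= d by exact: le_trans d1.
    apply: addr_ge0; first by do 2 apply: mulr_ge0 => //.
    by apply: divr_ge0 => //; do 3 apply: mulr_ge0 => //.
  exact: drift_le.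
(* Relative size of one increment: [|dH| / H <= 20 s W], and [s^2 <= x]. The 80 of
   [dominator_moment] turns [20 s] into [1600 s]. *)
pose s := b * nu / h.
have s0 : 0 <= s by rewrite divr_ge0 ?mulr_ge0 ?(ltW b0) ?(ltW nu0) ?(ltW h0).
have sE : s ^+ 2 = b ^+ 2 * N / H by rewrite /s !exprMn exprVn nu2 h2.
have s2x : s ^+ 2 <= x.
  rewrite sE ler_pdivrMr//; apply: le_trans (_ : x * (kap * N) <= _); last by rewrite ler_pM2l.
  by rewrite mulrA ler_pM2r// (mulrC x) kapE ler_peMl ?(ltW b20).
have sp : 128 * p%:R ^+ 4 * (1600 * s) <= 1.
  rewrite (_ : _ * (1600 * s) = 128 * 1600 * p%:R ^+ 4 * s); last by ring.
  apply: (mulr_sqr_le1 _ _ s0 s2x).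
  - exact: mulr_ge0 (ler0n _ _) (ler0n _ _).
  - exact: exprn_ge0.
  - by rewrite -exprM.
pose S w := \sum_(2 <= k < p.+1) 'C(p, k)%:R * (20 * s) ^+ k * W w ^+ k.
have iWk k : itg P (fun w => W w ^+ k).
  case: k => [|k]; last exact: (iW k.+1 isT).1.
  exact: itg_cst.
have iS : itg P S by apply: itg_sum => k; exact: itgZ.
have ES : Ex P S <= 65 * p%:R ^+ 2 * (1600 * s) ^+ 2.
  have s16 : 0 <= 1600 * s by exact: mulr_ge0 (ler0n _ _) s0.
  apply: le_trans (binomial_tail s16 sp).
  rewrite Ex_sum => [|k]; last exact: itgZ.
  rewrite [leLHS]big_nat [leRHS]big_nat; apply: ler_sum => k /andP[k2 _].
  have kp : (0 < k)%N by apply: leq_trans k2.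
  rewrite ExZ// -mulrA ler_wpM2l//.
  rewrite (_ : 1600 * s * _ = 20 * s * (80 * k%:R ^+ 2)); last by ring.
  have s20 : 0 <= 20 * s by exact: mulr_ge0 (ler0n _ _) s0.
  rewrite [leRHS]exprMn; apply: ler_wpM2l; first exact: exprn_ge0.
  exact: (iW k kp).2.
pose g w := H ^+ p * (1 + (p%:R / H * U w + S w)).
have ig : itg P g.
  by apply: itgZ; apply: itgD; [exact: itg_cst|apply: itgD => //; exact: itgZ].
apply: (@le_trans _ _ (\int[P]_w (g w)%:E)%E).
  apply: ge0_le_integral => //.
  - move=> w _; rewrite lee_fin exprn_ge0// /potential addr_ge0 ?sqr_ge0//.
    rewrite mulr_ge0 ?(ltW k0)// addr_ge0 ?tail_sq_ge0// subr_ge0.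
    by apply: le_trans t9; rewrite ler_piMr ?divr_ge0.
  - apply/measurable_EFinP; apply: measurable_funX.
    apply: (measurableT_comp (measurable_potential _ _)).
    apply: (measurableT_comp (f := fun z => pca_step b z.1 z.2) (g := fun w => (y, xi w))).
      exact: measurable_pca_step.
    exact: measurable_fun_pair.
  - by apply/measurable_EFinP; exact: (itg_measurable ig).
  move=> w _; rewrite lee_fin.
  have [dU dW] := inc w.
  rewrite (_ : potential _ _ _ = H * (1 + dH w / H)); last first.
    by rewrite /dH; field; rewrite gt_eqF.
  rewrite exprMn /g ler_pM2l ?exprn_gt0//.
  have zU : dH w / H <= U w / H by rewrite ler_pM2r ?invr_gt0.
  have zW : `|dH w / H| <= 20 * s * W w.
    rewrite normrM normfV (gtr0_norm H0) ler_pdivrMr//; apply: le_trans dW _.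
    rewrite le_eqVlt; apply/orP; left; apply/eqP; rewrite -h2 /s; field.
    by rewrite gt_eqF.
  apply: le_trans (expr1D_le p zU zW) _; rewrite -addrA lerD2l lerD//.
    by rewrite le_eqVlt; apply/orP; left; apply/eqP; ring.
  rewrite le_eqVlt; apply/orP; left; apply/eqP; apply: eq_bigr => k _.
  by rewrite exprMn mulrA.
rewrite (ExE ig) lee_fin /g ExZ; last first.
  by apply: itgD; [exact: itg_cst|apply: itgD => //; exact: itgZ].
rewrite ler_piMr ?exprn_ge0 ?(ltW H0)//.
rewrite ExD ?Ex_cst; [|exact: itg_cst|by apply: itgD => //; exact: itgZ].
rewrite ExD//; last exact: itgZ.
rewrite ExZ// gerDl.
have : p%:R / H * Ex P U <= p%:R / H * - (kap * x * N / 2).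
  by rewrite ler_wpM2l// divr_ge0// ltW.
(* Exact balance with the higher terms: in [kap], 130 is twice the 65 of [binomial_tail], and 1600
   is [20 * 80]. *)
have : p%:R / H * - (kap * x * N / 2) = - (65 * p%:R ^+ 2 * (1600 * s) ^+ 2).
  rewrite kapE GE exprMn sE; field; exact: lt0r_neq0.
move: (p%:R / H * Ex P U) (p%:R / H * _) (65 * _ * _) ES => v1 v2 v3 ES -> v13.
by rewrite -(subrr v3) addrC lerD.
Qed.

End one_step.

(** * The killed chain *)

Section killed_chain.
Context {R : realType} {disp : measure_display} {T : measurableType disp}.
Variables (P : probability T R) (n : nat) (X : nat -> T -> 'cV[R]_n.+1).
Variables (A : 'M[R]_n.+1) (b : R) (y0 : T -> 'cV[R]_n.+1).

Definition alive (y : 'cV[R]_n.+1) : bool := `|y 0 0 - 1| <= 1 / 2.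

(* Once its first coordinate leaves [1/2, 3/2] the chain is sent to the
   absorbing state 0, so that survival up to time [m] is readable on the
   state at time [m]. *)
Definition killed_step (z : 'cV[R]_n.+1 * 'cV[R]_n.+1) : 'cV[R]_n.+1 :=
  let y := pca_step b z.1 (A *m z.2) in
  if alive z.1 && alive y then y else 0.

Lemma alive0 : alive 0 = false.
Proof. by rewrite /alive mxE sub0r normrN normr1; apply/negbTE; rewrite -ltNge; lra. Qed.

Lemma measurable_alive : measurable_fun setT alive.
Proof. by rewrite /alive; mfun. Qed.

Let m1 : measurable_fun setT (fst : 'cV[R]_n.+1 * 'cV[R]_n.+1 -> _).
Proof. exact: measurable_fst. Qed.

Let mpre : measurable_fun setT
  (fun z : 'cV[R]_n.+1 * 'cV[R]_n.+1 => pca_step b z.1 (A *m z.2)).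
Proof.
apply: (measurableT_comp (f := fun z => pca_step b z.1 z.2)
  (g := fun z : 'cV[R]_n.+1 * 'cV[R]_n.+1 => (z.1, A *m z.2))).
  exact: measurable_pca_step.
apply: measurable_fun_pair => //; apply: measurable_fun_mulmx.
exact: measurable_snd.
Qed.

Let malive1 : measurable_fun setT
  (fun z : 'cV[R]_n.+1 * 'cV[R]_n.+1 => alive z.1).
Proof. exact: (measurableT_comp measurable_alive). Qed.

Lemma measurable_killed_step : measurable_fun setT killed_step.
Proof.
rewrite /killed_step; apply: measurable_fun_ifT => //.
by apply: measurable_and => //; exact: (measurableT_comp measurable_alive).
Qed.

Hypotheses (mX : forall j, measurable_fun setT (X j)) (my0 : measurable_fun setT y0).
Hypotheses (indX : mutually_independent P X).
Hypotheses (ind0 : forall B E, measurable B -> generated_sigma_algebra X E ->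
  (P (y0 @^-1` B `&` E) = P (y0 @^-1` B) * P E)%E).

Let Y := chain killed_step y0 X.

Lemma killed_chain_alive m w : alive (Y m.+1 w) ->
  alive (Y m w) /\ Y m.+1 w = pca_step b (Y m w) (A *m X m w).
Proof.
rewrite /Y/= /killed_step/=; case: ifP => [/andP[]//|_].
by rewrite alive0.
Qed.

Lemma measurable_killed_chain m : measurable_fun setT (Y m).
Proof. exact: measurable_chain measurable_killed_step my0 mX m. Qed.

Lemma measurable_alive_chain m : measurable [set w | alive (Y m w)].
Proof.
apply: measurable_set_pred; apply: (measurableT_comp measurable_alive).
exact: measurable_killed_chain.
Qed.

Section survival.
Variables (kap x B : R) (p : nat).
Hypotheses (kap0 : 0 <= kap).
Hypothesis (pot : forall j y tau, 9 / 4 <= tau -> alive y ->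
  (\int[P]_w (potential kap (tau - 9 / 4 * x) (pca_step b y (A *m X j w)) ^+ p)%:E
   <= (potential kap tau y ^+ p)%:E)%E).

(** When the first coordinate leaves [1/2, 3/2] the potential is at least 1/4, so replacing its
    [p]-th power by [c] from then on only lowers the mean. *)
Let c : R := 4^-1 ^+ p.
Let g tau (y : 'cV[R]_n.+1) : R := if alive y then potential kap tau y ^+ p else c.

Let pot_ge0 tau (y : 'cV[R]_n.+1) : 0 <= tau -> 0 <= potential kap tau y.
Proof.
by move=> t0; rewrite /potential addr_ge0 ?sqr_ge0// mulr_ge0// addr_ge0// tail_sq_ge0.
Qed.

Let c0 : 0 < c. Proof. by rewrite exprn_gt0// invr_gt0. Qed.

Let g_ge0 tau y : 0 <= tau -> 0 <= g tau y.
Proof.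
by move=> t0; rewrite /g; case: ifP => _; [apply/exprn_ge0/pot_ge0|exact: ltW].
Qed.

Let mg tau : measurable_fun setT (g tau).
Proof.
apply: measurable_fun_ifT => //; first exact: measurable_alive.
by apply: measurable_funX; exact: measurable_potential.
Qed.

Let survival_step m tau : 0 <= x -> 9 / 4 <= tau - 9 / 4 * x ->
  (\int[P]_w (g (tau - 9 / 4 * x) (Y m.+1 w))%:E <= \int[P]_w (g tau (Y m w))%:E)%E.
Proof.
move=> x0 t9; set tau' := tau - 9 / 4 * x in t9 *.
have t0' : 0 <= tau' by lra.
have t9' : 9 / 4 <= tau by move: t9; rewrite /tau'; lra.
pose f (z : 'cV[R]_n.+1 * 'cV[R]_n.+1) : R :=
  if alive z.1 then potential kap tau' (pca_step b z.1 (A *m z.2)) ^+ p else c.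
have mf : measurable_fun setT f.
  apply: measurable_fun_ifT => //; apply: measurable_funX.
  exact: (measurableT_comp (measurable_potential _ _)).
have f0 z : 0 <= f z.
  by rewrite /f; case: ifP => _; [apply/exprn_ge0/pot_ge0|exact: ltW].
apply: (@le_trans _ _ (\int[P]_w (f (Y m w, X m w))%:E)%E).
  apply: ge0_le_integral => //.
  - by move=> w _; rewrite lee_fin g_ge0.
  - apply/measurable_EFinP; apply: (measurableT_comp (mg _)).
    exact: measurable_killed_chain.
  - apply/measurable_EFinP; apply: (measurableT_comp mf).
    by apply: measurable_fun_pair => //; exact: measurable_killed_chain.
  move=> w _; rewrite lee_fin /f /g/= -/Y /killed_step/=.
  case: (boolP (alive (Y m w))) => am /=; last by rewrite alive0.
  case: (boolP (alive (pca_step _ _ _))) => [->//|]; rewrite alive0.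
  rewrite /alive -ltNge => dead.
  rewrite /c lerXn2r ?nnegrE ?invr_ge0 ?pot_ge0//.
  rewrite /potential; apply: ler_wpDr.
    by rewrite mulr_ge0// addr_ge0 ?tail_sq_ge0.
  by rewrite -(real_normK (num_real _)); nra.
apply: (@chain_integral_le _ _ _ _ _ _ _ P killed_step y0 X measurable_killed_step
  my0 mX indX ind0 m (fun z => (f z)%:E) (fun y => (g tau y)%:E)).
- exact/measurable_EFinP.
- by move=> z; rewrite lee_fin.
- exact/measurable_EFinP.
move=> y; rewrite /f /g /=; case: ifP => ay; first exact: pot.
by rewrite integral_prob_cst.
Qed.

(** Markov's inequality at the level [c = 4^(- p)], which is the origin of the factor 4. The term
    [tau] starts at [9/4 + 9/4 x N] so as to be still [9/4] at time [N]. *)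
Lemma survival_probability N : 0 <= x -> 0 <= B ->
  (forall w, alive (y0 w) ->
     potential kap (9 / 4 + 9 / 4 * x * N%:R) (y0 w) <= B) ->
  (P [set w | ~~ alive (Y N w)] <=
   P [set w | ~~ alive (y0 w)] + ((4 * B) ^+ p)%:E)%E.
Proof.
move=> x0 B0 y0B; pose tau m := 9 / 4 + 9 / 4 * x * (N%:R - m%:R).
have mD m : measurable [set w | ~~ alive (Y m w)].
  have := measurableC (measurable_alive_chain m).
  by congr (measurable _); apply/seteqP; split => w /= /negP.
have mono m : (m <= N)%N -> (\int[P]_w (g (tau m) (Y m w))%:E <=
    \int[P]_w (g (tau 0%N) (y0 w))%:E)%E.
  elim: m => [//|m IHm] mN; apply: le_trans (IHm (ltnW mN)).
  have -> : tau m.+1 = tau m - 9 / 4 * x by rewrite /tau -natr1; ring.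
  apply: survival_step => //.
  rewrite (_ : tau m - _ = tau m.+1); last by rewrite /tau -natr1; ring.
  by rewrite /tau lerDl !mulr_ge0// subr_ge0 ler_nat.
have up : (\int[P]_w (g (tau 0%N) (y0 w))%:E <=
    c%:E * P [set w | ~~ alive (y0 w)] + (B ^+ p)%:E)%E.
  pose D0 := [set w | ~~ alive (y0 w)].
  have mD0 : measurable D0 by exact: mD 0%N.
  apply: (@le_trans _ _ (\int[P]_w (c * \1_D0 w + B ^+ p)%:E)%E).
    apply: ge0_le_integral => //.
    - move=> w _; rewrite lee_fin g_ge0// /tau subr0.
      by rewrite addr_ge0// !mulr_ge0.
    - by apply/measurable_EFinP; apply: (measurableT_comp (mg _)).
    - by apply/measurable_EFinP; mfun; exact: measurable_indic.
    move=> w _; rewrite lee_fin /g indicE; case: ifP => aw.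
      rewrite (_ : (w \in D0) = false) ?mulr0 ?add0r; last first.
        by apply/negbTE; rewrite notin_setE /D0/= aw.
      rewrite lerXn2r ?nnegrE ?pot_ge0//.
        by rewrite /tau subr0 addr_ge0// !mulr_ge0.
      by rewrite /tau subr0; exact: y0B.
    have wD : w \in D0 by rewrite inE /D0/= aw.
    by rewrite wD mulr1 lerDl exprn_ge0.
  under eq_integral do rewrite EFinD EFinM.
  rewrite ge0_integralD//; last 3 first.
  - by move=> w _; rewrite -EFinM lee_fin mulr_ge0// ltW.
  - by apply/measurable_EFinP; mfun; exact: measurable_indic.
  - by move=> w _; rewrite lee_fin exprn_ge0.
  rewrite ge0_integralZl//; last 2 first.
  - by apply/measurable_EFinP; exact: measurable_indic.
  - by rewrite lee_fin ltW.
  by rewrite integral_indic// setIT integral_prob_cst.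
have low : (c%:E * P [set w | ~~ alive (Y N w)] <= \int[P]_w (g (tau N) (Y N w))%:E)%E.
  have mDN := mD N; set DN := [set w | _] in mDN *.
  rewrite -(setIT DN) -integral_indic// -ge0_integralZl//; last 2 first.
  - by apply/measurable_EFinP; exact: measurable_indic.
  - by rewrite lee_fin ltW.
  have tN : 0 <= tau N by rewrite /tau subrr mulr0 addr0.
  apply: ge0_le_integral => //.
  - by move=> w _; rewrite -EFinM lee_fin mulr_ge0// ltW.
  - by apply: emeasurable_funM => //; apply/measurable_EFinP; exact: measurable_indic.
  - apply/measurable_EFinP; apply: (measurableT_comp (mg _)).
    exact: measurable_killed_chain.
  move=> w _; rewrite -EFinM lee_fin indicE /g; case: ifP => aw.
    rewrite (_ : (w \in DN) = false) ?mulr0; first by rewrite exprn_ge0 ?pot_ge0.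
    by apply/negbTE; rewrite notin_setE /DN/= aw.
  by rewrite ler_piMr ?(ltW c0)// lern1 leq_b1.
have fin (D : set T) : measurable D -> P D \is a fin_num by move=> mD'; exact: fin_num_measure.
have := le_trans low (le_trans (mono N (leqnn N)) up).
rewrite -(fineK (fin _ (mD N))) -(fineK (fin _ (mD 0%N))) -!EFinM -!EFinD !lee_fin.
rewrite -(ler_pM2l c0 (fine _) (fine _ + _)) mulrDr => /le_trans; apply.
rewrite lerD2l /c exprMn mulrA -exprMn mulVf ?pnatr_eq0// expr1n mul1r//.
Qed.

End survival.

Section second_moments.
Variables (rho l' alpha0 : 'I_n -> R).
Hypothesis (l'0 : forall k, 0 <= l' k).
Hypothesis (sec : forall j y k, alive y ->
  (\int[P]_w (pca_step b y (A *m X j w) (lift 0 k) 0 ^+ 2)%:E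
   <= (rho k ^+ 2 * y (lift 0 k) 0 ^+ 2 + 16 * b ^+ 2 * l' k * dotp y y)%:E)%E).

(** The one-step estimate iterated with equality, as [coupled_recursion] requires; [9 / 4] bounds
    the square of the first coordinate of a living state. *)
Fixpoint moment_bound (m : nat) (k : 'I_n) : R :=
  if m is m'.+1 then
    rho k ^+ 2 * moment_bound m' k +
    16 * b ^+ 2 * l' k * (9 / 4 + \sum_j moment_bound m' j)
  else alpha0 k.

Hypothesis (init : forall k, itg P (fun w => y0 w (lift 0 k) 0 ^+ 2) /\
  Ex P (fun w => y0 w (lift 0 k) 0 ^+ 2) <= alpha0 k).

Lemma killed_chain_moments m k : itg P (fun w => Y m w (lift 0 k) 0 ^+ 2) /\
  Ex P (fun w => Y m w (lift 0 k) 0 ^+ 2) <= moment_bound m k.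
Proof.
elim: m k => [|m IHm] k; first exact: init.
have mY := measurable_killed_chain m; have mYS := measurable_killed_chain m.+1.
pose f (z : 'cV[R]_n.+1 * 'cV[R]_n.+1) : R :=
  if alive z.1 then pca_step b z.1 (A *m z.2) (lift 0 k) 0 ^+ 2 else 0.
have mf : measurable_fun setT f.
  by apply: measurable_fun_ifT => //; apply: measurable_funX; apply: measurable_coord.
have f0 z : 0 <= f z by rewrite /f; case: ifP => _ //; exact: sqr_ge0.
have bl0 : 0 <= 16 * b ^+ 2 * l' k.
  by apply: mulr_ge0 => //; apply: mulr_ge0 => //; exact: sqr_ge0.
pose g (y : 'cV[R]_n.+1) : R := rho k ^+ 2 * y (lift 0 k) 0 ^+ 2 +
  16 * b ^+ 2 * l' k * (9 / 4 + \sum_j y (lift 0 j) 0 ^+ 2).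
have g0 y : 0 <= g y.
  apply: addr_ge0; first by rewrite mulr_ge0 ?sqr_ge0.
  by rewrite mulr_ge0// addr_ge0 ?divr_ge0// sumr_ge0// => j _; exact: sqr_ge0.
have mg : measurable_fun setT g by rewrite /g; mfun.
have is1 : itg P (fun w => \sum_j Y m w (lift 0 j) 0 ^+ 2).
  by apply: itg_sum => j; exact: (IHm j).1.
have is2 : itg P (fun w => 9 / 4 + \sum_j Y m w (lift 0 j) 0 ^+ 2).
  by apply: itgD => //; exact: itg_cst.
have ig : itg P (fun w => g (Y m w)).
  by apply: itgD; apply: itgZ => //; exact: (IHm k).1.
have Eg : Ex P (fun w => g (Y m w)) <= moment_bound m.+1 k.
  rewrite /g ExD; [|apply: itgZ; exact: (IHm k).1|exact: itgZ].
  rewrite ExZ; last exact: (IHm k).1.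
  rewrite ExZ// ExD//; last exact: itg_cst.
  rewrite Ex_cst Ex_sum => [|j]; last exact: (IHm j).1.
  apply: lerD; first by rewrite ler_wpM2l ?sqr_ge0//; exact: (IHm k).2.
  by rewrite ler_wpM2l// lerD2l; apply: ler_sum => j _; exact: (IHm j).2.
apply: itg_of_bound; [by mfun|by move=> w; exact: sqr_ge0|].
apply: (@le_trans _ _ (\int[P]_w (f (Y m w, X m w))%:E)%E).
  apply: ge0_le_integral => //.
  - by move=> w _; rewrite lee_fin sqr_ge0.
  - by apply/measurable_EFinP; mfun.
  - apply/measurable_EFinP; apply: (measurableT_comp mf).
    exact: measurable_fun_pair.
  move=> w _; rewrite lee_fin /f /= -/Y /killed_step/=.
  case: (boolP (alive (Y m w))) => am /=; last by rewrite mxE expr0n.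
  by case: ifP => // _; rewrite mxE expr0n sqr_ge0.
apply: (@le_trans _ _ (\int[P]_w (g (Y m w))%:E)%E); last by rewrite (ExE ig) lee_fin.
apply: (@chain_integral_le _ _ _ _ _ _ _ P killed_step y0 X measurable_killed_step
  my0 mX indX ind0 m (fun z => (f z)%:E) (fun y => (g y)%:E)).
- exact/measurable_EFinP.
- by move=> z; rewrite lee_fin.
- exact/measurable_EFinP.
move=> y; rewrite /f /=; case: (boolP (alive y)) => ay; last first.
  by rewrite integral_prob_cst lee_fin.
apply: le_trans (sec m k ay) _; rewrite lee_fin lerD2l; apply: ler_wpM2l => //.
by rewrite dotp_tail_sq lerD2r; exact: (sqr_near1 ay).2.
Qed.

End second_moments.

End killed_chain.

(** * Step sizes *)

Section step_size.
Context {R : realType}.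
Implicit Types (x l eps delta : R).

Lemma ln1B_bounds x : 0 < x -> x <= 1 / 2 -> x <= - ln (1 - x) /\ - ln (1 - x) <= 2 * x.
Proof.
move=> x0 x2; split.
  by have := @le_ln1Dx R (- x); rewrite lerNr => -> //; lra.
have e2 : 1 + 2 * x <= expR (2 * x) by exact: expR_ge1Dx.
rewrite lerNl -[leLHS]expRK ler_ln ?posrE ?expR_gt0//; last by lra.
rewrite expRN; have x1 : 0 < 1 - x by lra.
rewrite -[leRHS]invrK lef_pV2 ?posrE ?expR_gt0 ?invr_gt0//.
apply: le_trans e2; rewrite -div1r ler_pdivrMr//; nra.
Qed.

(** [- ln (1 - x)] lies between [x] and [2 x], and rounding up costs the additional [x]. *)
Lemma rescaled_time_bounds (lam1 lam2 beta l : R) (s : R) :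
  let x := beta * (lam1 - lam2) in
  lam1 ^- 2 * (lam1 - lam2) * beta^-1 = expR l -> 0 < x -> x <= 1 / 2 ->
  0 < s -> 0 < l ->
  s * l / (2 * x) <= (rescaled_time lam1 lam2 beta s)%:~R /\
  (rescaled_time lam1 lam2 beta s)%:~R * x <= s * l + x.
Proof.
move=> x le x0 x2 s0 l0; rewrite /rescaled_time le expRK -/x.
have [x3 x4] := ln1B_bounds x0 x2.
set y := - ln (1 - x) in x3 x4 *.
have y0 : 0 < y by apply: lt_le_trans x3.
have sl : 0 < s * l by exact: mulr_gt0.
split.
  apply: le_trans (ceil_ge _); rewrite ler_pM2l// lef_pV2 ?posrE//.
  by rewrite mulr_gt0.
have /andP[c1 _] := ceil_itv (s * l / y).
rewrite intrB in c1.
have c2 : (Num.ceil (s * l / y))%:~R <= s * l / y + 1 by rewrite ltW// -ltrBlDr.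
apply: le_trans (_ : (s * l / y + 1) * x <= _); first by rewrite ler_pM2r.
rewrite mulrDl mul1r lerD2r -mulrA ler_piMr ?(ltW sl)//.
by rewrite mulrC ler_pdivrMr// mul1r.
Qed.

(* Since [N*_(beta,2) >= 1 / r], the second step-size condition with [C3 = 1]
   forces [ln (1 / r) <= r^(-2 eps)]; the first one then bounds
   [d r ln (1 / r)]. *)
Lemma step_size_bounds (lam1 lam2 beta eps delta L0 : R) (d : nat) :
  let b := beta * lam1 in
  let x := beta * (lam1 - lam2) in
  let r := lam1 ^+ 2 * (lam1 - lam2)^-1 * beta in
  let l := - ln r in
  0 < lam1 -> 0 <= lam2 -> lam2 < lam1 -> 0 < beta -> 0 < eps < 1 / 8 ->
  0 < delta -> delta < 1 / 2 -> (2 <= d)%N -> 1 <= L0 ->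
  d%:R * r `^ (1 - 2 * eps) <= expR (- L0) * delta ^+ 2 ->
  4 * d%:R * (rescaled_time lam1 lam2 beta 2)%:~R * expR (- 1 * r `^ (- 2 * eps)) <= delta ->
  [/\ r = expR (- l), L0 <= l, b ^+ 2 = r * x, 0 < x <= b &
      [/\ b <= r, d%:R * r * l * L0 <= delta ^+ 2 &
      (rescaled_time lam1 lam2 beta 3)%:~R * x <= 4 * l]].
Proof.
move=> b x r l lam10 lam20 gap0 beta0 /andP[eps0 eps8] delta0 delta2 d2 L01 H1 H2.
have g0 : 0 < lam1 - lam2 by rewrite subr_gt0.
have x0 : 0 < x by exact: mulr_gt0.
have xb : x <= b by rewrite ler_pM2l// gerBl.
have b0 : 0 < b by exact: mulr_gt0.
have r0 : 0 < r by rewrite !mulr_gt0 ?invr_gt0 ?exprn_gt0.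
have rE : r = expR (- l) by rewrite opprK lnK.
have b2 : b ^+ 2 = r * x by rewrite /b /r /x; field; rewrite gt_eqF.
have br : b <= r.
  by rewrite -(ler_pM2r x0) -b2 expr2 ler_pM2l.
have dr0 : 0 < d%:R :> R by rewrite ltr0n; apply: leq_trans d2.
have dr2 : 2 <= d%:R :> R by rewrite ler_nat.
have d4 : delta ^+ 2 <= 1 / 4.
  by rewrite (_ : 1 / 4 = (1 / 2) ^+ 2); [rewrite lerXn2r ?nnegrE ?(ltW delta0) ?(ltW delta2)|field].
have L00 : 0 < L0 by exact: lt_le_trans L01.
have e1 : expR (- l * (1 - 2 * eps)) <= expR (- L0).
  rewrite expRM -rE; apply: le_trans (_ : d%:R * r `^ (1 - 2 * eps) <= _).
    by rewrite ler_peMl ?powR_ge0//; lra.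
  by apply: le_trans H1 _; rewrite ler_piMr ?expR_ge0//; lra.
have l1 : L0 <= l * (1 - 2 * eps) by rewrite ler_expR in e1; lra.
have e0' : 0 < 1 - 2 * eps by lra.
have l0 : 0 < l by rewrite -(pmulr_lgt0 _ e0'); apply: lt_le_trans l1.
have Ll : L0 <= l by apply: le_trans l1 _; rewrite ler_piMr ?(ltW l0)//; lra.
have r2 : r <= 1 / 2.
  rewrite rE expRN -[leRHS]invrK lef_pV2 ?posrE ?expR_gt0// invf_div divr1.
  by apply: le_trans (expR_ge1Dx _); lra.
have x2 : x <= 1 / 2 by apply: le_trans xb (le_trans br r2).
have invE : lam1 ^- 2 * (lam1 - lam2) * beta^-1 = expR l.
  rewrite -[l]opprK expRN -rE /r; field.
  by rewrite !gt_eqF.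
have [N2 _] := rescaled_time_bounds invE x0 x2 (ltr0n _ 2 : 0 < 2) l0.
have [_ N3] := rescaled_time_bounds invE x0 x2 (ltr0n _ 3 : 0 < 3) l0.
rewrite -/x in N2 N3.
set n2 : R := (rescaled_time _ _ _ 2)%:~R in H2 N2.
have n2e : expR l <= n2.
  apply: le_trans N2; rewrite -mulf_div divff ?pnatr_eq0// mul1r ler_pdivlMr//.
  apply: le_trans (_ : expR l * r <= _).
    by rewrite ler_pM2l ?expR_gt0// (le_trans xb).
  rewrite rE -expRD subrr expR0; lra.
pose E := r `^ (- 2 * eps).
have EE : E = expR (l * (2 * eps)) by rewrite /E rE -expRM; congr expR; ring.
have lE : l <= E.
  rewrite -subr_ge0 -oppr_le0 opprB -ler_expR expR0 expRB -expRN.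
  have : 4 * d%:R * expR l * expR (- E) <= 1 / 2.
    apply: le_trans (ltW delta2); rewrite -[- E]mulN1r; apply: le_trans H2.
    by rewrite ler_pM2r ?expR_gt0// ler_pM2l// mulr_gt0.
  have : 0 < expR l * expR (- E) by rewrite mulr_gt0 ?expR_gt0.
  rewrite -!mulrA; move: (expR l * _) => v v0 h.
  have : 2 * v <= d%:R * v by rewrite ler_pM2r.
  by lra.
split => //; first by rewrite x0.
split => //.
  have -> : d%:R * r * l * L0 = d%:R * (r * l) * L0 by ring.
  have rl : r * l <= r `^ (1 - 2 * eps).
    apply: le_trans (_ : r * E <= _); first by rewrite ler_pM2l.
    by rewrite EE {1 2}rE -expRM -expRD le_eqVlt; apply/orP; left; apply/eqP; congr expR; ring.
  (* The constant [expR (- L0)] leaves room for a factor [L0], since [L0 exp (- L0) <= 1]. *)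
  apply: le_trans (_ : expR (- L0) * delta ^+ 2 * L0 <= _).
    by rewrite ler_pM2r//; apply: le_trans H1; rewrite ler_pM2l.
  rewrite mulrAC ler_piMl ?sqr_ge0// expRN mulrC ler_pdivrMr ?expR_gt0// mul1r.
  by apply: le_trans (expR_ge1Dx _); rewrite lerDr.
by apply: le_trans N3 _; lra.
Qed.

End step_size.

(** * Choice of the power, the weight and the numerical constants *)

Section step_constants.
Context {R : realType}.
Implicit Types (x b r l delta : R).

Lemma expR1_le4 : expR 1 <= 4 :> R.
Proof.
have h : 1 / 2 <= expR (- (1 / 2)) :> R by apply: le_trans (expR_ge1Dx _); lra.
have : expR 1 * expR (- (1 / 2)) ^+ 2 = 1 :> R.
  by rewrite -expRM_natl -expRD -[RHS]expR0; congr expR; lra.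
have := expR_gt0 (1 : R); move: (expR 1) (expR _) h => u v h u0 uv.
have : u * (1 / 2) ^+ 2 <= u * v ^+ 2 by rewrite ler_pM2l// lerXn2r ?nnegrE//; lra.
by rewrite uv; lra.
Qed.

(** Eight of the nine powers serve [p^8 x] with [p] of order [l]; the ninth is exchanged for a
    factor [L0 <= l]. *)
Lemma expR_ge_pow9 l : 0 <= l -> l ^+ 9 <= 9 ^+ 9 * expR l.
Proof.
move=> l0; have -> : expR l = expR (l / 9) ^+ 9.
  by rewrite -expRM_natl; congr expR; field.
rewrite -exprMn lerXn2r ?nnegrE ?mulr_ge0 ?expR_ge0//.
have := expR_ge1Dx (l / 9); lra.
Qed.

(* [G], [K], [C] and [F] stand for [130 * 1600^2], [216^2], [(128 * 1600)^2] and
   [9^9]; they stay symbolic because numerals are unary. *)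
Definition log_threshold (G K C F : R) : R :=
  32 * G * K + 320 * G * F + C * 256 * F + 512.

Lemma log_threshold_consts (G K C F l : R) : 0 <= G -> 1 <= K -> 0 <= C -> 0 <= F ->
  log_threshold G K C F <= l ->
  [/\ 512 <= l, G <= l, 32 * (G * K) + 320 * (G * F) <= l & C * 256 * F <= l].
Proof.
move=> G0 K1 C0 F0; have GK : 0 <= G * K by rewrite mulr_ge0// (le_trans _ K1).
have GK1 : G <= G * K by rewrite ler_peMr.
have GF : 0 <= G * F by rewrite mulr_ge0.
have CF : 0 <= C * F by rewrite mulr_ge0.
by rewrite /log_threshold => h; split; clear -h GK GK1 GF CF G0; lra.
Qed.

(** Several of the products carry a spare factor [L0], so that a later division by [L0] beats the
    fixed numerical constants. *)
Lemma step_size_smallness (D F L0 r l delta : R) : 2 <= D -> l ^+ 9 * r <= F -> 0 < r ->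
  512 <= L0 -> L0 <= l -> D * r * l * L0 <= delta ^+ 2 -> 0 < delta -> delta < 1 / 2 ->
  [/\ r * l ^+ 8 * L0 <= F, r * l ^+ 2 * L0 <= F, r <= delta &
  [/\ 512 * (D * r * l) <= 1, D / delta ^+ 2 * (r * l) * L0 <= 1 & 8 * (r * l) * L0 <= 1]].
Proof.
move=> D2 l9 r0 L512 Ll DrL d0 d2.
have L00 : 0 < L0 by clear -L512; lra.
have l1 : 1 <= l by clear -L512 Ll; lra.
have l0 : 0 < l by apply: lt_le_trans l1.
have dd0 : 0 < delta ^+ 2 by rewrite exprn_gt0.
have dd4 : delta ^+ 2 <= 1 / 4 by clear -d0 d2; nra.
have rl8 : r * l ^+ 8 * L0 <= F.
  apply: le_trans l9; rewrite (exprSr l 8) (_ : l ^+ 8 * l * r = r * l ^+ 8 * l).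
    by rewrite ler_pM2l// mulr_gt0// exprn_gt0.
  by ring.
have rl0 : 0 < r * l by rewrite mulr_gt0.
have rlL : 2 * (r * l * L0) <= delta ^+ 2.
  by apply: le_trans DrL; rewrite -!mulrA ler_pM2r// !mulr_gt0.
have e1 : r * l * 512 <= r * l * L0 by rewrite ler_pM2l.
have e2 : D * r * l * 512 <= D * r * l * L0.
  by rewrite ler_pM2l// !mulr_gt0//; apply: lt_le_trans D2.
have e3 : r <= r * l by rewrite ler_pMr.
split.
- exact: rl8.
- apply: le_trans rl8; rewrite ler_pM2r// ler_pM2l//.
  by rewrite ler_weXn2l.
- clear -rlL e1 e3 d0 d2 r0; nra.
split.
- clear -e2 DrL dd4; lra.
- rewrite (_ : D / _ * _ * _ = D * r * l * L0 / delta ^+ 2); last by ring.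
  by rewrite ler_pdivrMr// mul1r.
- clear -rlL dd4; lra.
Qed.

Lemma potential_small (G K F D kap r l L0 delta : R) : 0 < G -> 1 <= K -> 2 <= D ->
  0 < delta -> 0 < l -> 0 < L0 -> 32 * (G * K) + 320 * (G * F) <= L0 ->
  kap <= 2 * G * (r * l) -> r * l ^+ 2 * L0 <= F ->
  D / delta ^+ 2 * (r * l) * L0 <= 1 ->
  4 * (kap * (K * D / delta ^+ 2 + 10 * l)) <= 1 / 4.
Proof.
move=> G0 K1 D2 d0 l0 L00 GKF kl rl2 Drl.
have dd0 : 0 < delta ^+ 2 by rewrite exprn_gt0.
have K0 : 0 < K by apply: lt_le_trans K1.
have D0 : 0 < D by apply: lt_le_trans D2.
have y0 : 0 <= K * D / delta ^+ 2 + 10 * l.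
  by rewrite ltW// addr_gt0// ?divr_gt0 ?mulr_gt0.
apply: (@le_trans _ _ (4 * (2 * G * (r * l) * (K * D / delta ^+ 2 + 10 * l)))).
  by rewrite ler_pM2l// ler_wpM2r.
rewrite -(ler_pM2r L00).
rewrite (_ : _ * L0 = 8 * (G * K) * (D / delta ^+ 2 * (r * l) * L0) +
   80 * G * (r * l ^+ 2 * L0)); last by field; rewrite gt_eqF.
have GK0 : 0 < 8 * (G * K) by rewrite !mulr_gt0.
have h1 : 8 * (G * K) * (D / delta ^+ 2 * (r * l) * L0) <= 8 * (G * K).
  by rewrite ler_piMr// ltW.
have h2 : 80 * G * (r * l ^+ 2 * L0) <= 80 * G * F by rewrite ler_pM2l// mulr_gt0.
clear -h1 h2 GKF; lra.
Qed.

(** [p] is the first integer above [l] and [kap = G p r], hence [kap x = G p b^2] by [b^2 = r x].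
    Four times the bound on the initial potential is at most [1/4 <= exp (- 1)], so its [p]-th power
    is at most [exp (- l) = r <= delta]. *)
Lemma survival_constants (G K C D b x r l delta : R) :
  0 < G -> 1 <= K -> 0 <= C -> 2 <= D ->
  let L0 := log_threshold G K C (9 ^+ 9) in
  r = expR (- l) -> L0 <= l -> b ^+ 2 = r * x -> 0 < x <= b -> b <= r ->
  D * r * l * L0 <= delta ^+ 2 -> 0 < delta -> delta < 1 / 2 ->
  exists (p : nat) (kap : R),
   [/\ (0 < p)%N, 0 < kap <= 1, kap * x = G * p%:R * b ^+ 2, 160 * D * b ^+ 2 <= x &
   [/\ D * b <= 1, C * p%:R ^+ 8 * x <= 1, b <= 1 / 2,
       (4 * (kap * (K * D / delta ^+ 2 + 10 * l))) ^+ p <= delta &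
       512 * (D * r * l) <= 1 /\ 512 <= l]].
Proof.
move=> G0 K1 C0 D2 L0; have : exists F : R, F = 9 ^+ 9 by eexists.
move=> [F FE]; rewrite -FE in L0 *; have F0 : 0 < F by rewrite FE exprn_gt0.
move=> rE Ll bE /andP[x0 xb] br DrL d0 d2.
have [L512 GL GKF CFL] := log_threshold_consts (ltW G0) K1 C0 (ltW F0) (lexx L0).
have r0 : 0 < r by rewrite rE expR_gt0.
have l512 : 512 <= l by exact: le_trans Ll.
have l0 : 0 < l by clear -l512; lra.
have L00 : 0 < L0 by clear -L512; lra.
have l9 : l ^+ 9 * r <= F.
  have := expR_ge_pow9 (ltW l0); rewrite -FE => h; rewrite rE expRN.
  by rewrite ler_pdivrMr ?expR_gt0.
have [rl8 rl2 rd [Dr1 Drl rlL]] := step_size_smallness D2 l9 r0 L512 Ll DrL d0 d2.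
have pl := truncnS_gt l.
have p2l : (Num.truncn l).+1%:R <= 2 * l.
  have /andP[pl' _] := truncn_itv (ltW l0).
  rewrite -natr1; clear -pl' l512; lra.
move: (Num.truncn l).+1 (ltn0Sn (Num.truncn l)) pl p2l => p pgt0 pl p2l.
have p0 : 0 < p%:R :> R by rewrite ltr0n.
exists p, (G * p%:R * r).
have Gp0 : 0 < G * p%:R by exact: mulr_gt0.
have kl : G * p%:R * r <= 2 * G * (r * l).
  rewrite (_ : 2 * G * (r * l) = G * (2 * l) * r); last by ring.
  by rewrite ler_pM2r// ler_pM2l.
have rl0 : 0 < r * l by exact: mulr_gt0.
have Grl : G * (r * l) <= L0 * (r * l) by rewrite ler_pM2r.
have D0 : 0 < D by apply: lt_le_trans D2.
have Dr : D * r <= D * r * l.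
  by rewrite ler_peMr ?mulr_ge0 ?(ltW D0) ?(ltW r0)//; clear -l512; lra.
have Db : D * b <= D * r by rewrite ler_pM2l.
have D2b : 2 * b <= D * b by rewrite ler_pM2r// (lt_le_trans x0).
split => //.
- by rewrite mulr_gt0//=; clear -kl Grl rlL; lra.
- by rewrite bE mulrA.
- by rewrite bE !mulrA ler_piMl ?(ltW x0)//; clear -Dr Dr1 rl0; nra.
split.
- clear -Dr Db Dr1 rl0; lra.
- have p8 : p%:R ^+ 8 <= 256 * l ^+ 8.
    rewrite (_ : 256 * _ = (2 * l) ^+ 8); last by ring.
    by rewrite lerXn2r ?nnegrE ?mulr_ge0 ?(ltW p0) ?(ltW l0).
  apply: (@le_trans _ _ (C * (256 * l ^+ 8) * r)).
    apply: ler_pM; rewrite ?mulr_ge0 ?exprn_ge0 ?(ltW x0) ?(ltW p0)//.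
      by rewrite ler_wpM2l.
    exact: le_trans xb br.
  rewrite -(ler_pM2r L00) mul1r (_ : _ * L0 = C * 256 * (r * l ^+ 8 * L0)); last by ring.
  by apply: le_trans CFL; apply: ler_wpM2l rl8; apply: mulr_ge0; [exact: C0|exact: ler0n].
- clear -Dr Db D2b Dr1; lra.
- have B4 := potential_small G0 K1 D2 d0 l0 L00 GKF kl rl2 Drl.
  apply: (@le_trans _ _ (expR (- 1) ^+ p)).
    rewrite lerXn2r ?nnegrE ?expR_ge0//.
      rewrite !mulr_ge0 ?addr_ge0 ?mulr_ge0 ?invr_ge0 ?sqr_ge0 ?(ltW G0) ?(ltW p0)
        ?(ltW r0) ?(ltW D0) ?(ltW l0)//.
      by rewrite (le_trans _ K1).
    apply: le_trans B4 _.
    rewrite expRN div1r lef_pV2 ?posrE ?expR_gt0//; exact: expR1_le4.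
  rewrite -expRM_natl mulrN1; apply: le_trans rd.
  by rewrite rE ler_expR lerN2 ltW.
- by split.
Qed.

(** The rate [1 - x / (1 + b)] exceeds [1 - x] by a factor of at most [exp (2 b x)]. Over [m] steps,
    squared, this costs [exp (4 b m x)], at most [exp 1 <= 4] because [m x <= 4 l] and
    [16 r l <= 1]. *)
Lemma contraction_power b x r l (m : nat) : 0 < x -> x <= b -> b <= r -> r <= 1 / 8 ->
  16 * (r * l) <= 1 -> m%:R * x <= 4 * l ->
  1 / 2 <= ((1 + b - x) / (1 + b)) ^+ 2 /\
  ((1 + b - x) / (1 + b)) ^+ 2 ^+ m <= 4 * (1 - x) ^+ (2 * m).
Proof.
move=> x0 xb br r8 rl ml; set rho := (1 + b - x) / (1 + b).
have b0 : 0 < b by exact: lt_le_trans xb.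
have x8 : x <= 1 / 8 by apply: le_trans xb (le_trans br r8).
have b1 : 0 < 1 + b by lra.
have x1 : 0 < 1 - x by lra.
have bx : 0 < b * x by exact: mulr_gt0.
have rho0 : 1 - x <= rho by rewrite ler_pdivlMr//; lra.
have rho1 : rho <= (1 - x) * expR (2 * (b * x)).
  apply: (@le_trans _ _ ((1 - x) * (1 + 2 * (b * x)))); last first.
    by rewrite ler_pM2l// expR_ge1Dx.
  rewrite ler_pdivrMr//.
  have -> : (1 - x) * (1 + 2 * (b * x)) * (1 + b) =
    (1 + b - x) + b * x * (2 * ((1 - x) * (1 + b)) - 1) by ring.
  have xb' : 0 <= (1 / 8 - x) * b by rewrite mulr_ge0 ?subr_ge0 ?(ltW b0).
  by rewrite lerDl mulr_ge0 ?(ltW bx)//; clear -xb' x8 b0; lra.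
split; first by nra.
rewrite -exprM; apply: (@le_trans _ _ (((1 - x) * expR (2 * (b * x))) ^+ (2 * m))).
  apply: lerXn2r rho1; rewrite nnegrE; first exact: le_trans (ltW x1) rho0.
  by apply: mulr_ge0; [exact: ltW|exact: expR_ge0].
rewrite exprMn mulrC ler_pM2r ?exprn_gt0// -expRM_natl.
apply: le_trans expR1_le4; rewrite ler_expR natrM.
have -> : 2 * m%:R * (2 * (b * x)) = 4 * (b * (m%:R * x)) by ring.
apply: le_trans rl; have -> : 16 * (r * l) = 4 * (r * (4 * l)) by ring.
by rewrite ler_pM2l// ler_pM// ?mulr_ge0// ltW.
Qed.

(** [B] is the stationary level for [coupled_recursion] and, up to a constant, the summand of the
    final error: [1 - rho^2 >= b (1 - lk) / 2] turns 52 into 104. Since [b^2 = r x] and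
    [b (1 - lk) >= x], each [B k] is at most [208 r]. *)
Lemma noise_budget (n N : nat) (lk l' : 'I_n -> R) b x r l :
  let rho k := (1 + b * lk k) / (1 + b) in
  let B k := 104 * b * l' k / (1 - lk k) in
  0 < x -> x <= b -> b <= r -> b ^+ 2 = r * x -> 1 <= l -> b <= 1 ->
  512 * (n%:R * r * l) <= 1 -> N%:R * x <= 4 * l ->
  (forall k, 0 <= lk k) -> (forall k, b * lk k <= b - x) ->
  (forall k, 0 <= l' k <= 2) ->
  [/\ forall k, 0 <= rho k <= (1 + b - x) / (1 + b),
      forall k, 0 <= B k,
      forall k, 52 * b ^+ 2 * l' k <= (1 - rho k ^+ 2) * B k,
      N%:R * (64 * b ^+ 2 * \sum_k l' k) <= 1 &
      \sum_k B k <= 1].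
Proof.
move=> rho B x0 xb br bE l1 b_le1 nrl Nx lk0 lkb l'02.
have b0 : 0 < b by exact: lt_le_trans xb.
have b1 : 0 < 1 + b by lra.
have r0 : 0 < r by exact: lt_le_trans br.
have lk1 k : 0 < 1 - lk k by have := lkb k; nra.
have l'0 k : 0 <= l' k by case/andP: (l'02 k).
have B0 k : 0 <= B k by rewrite !mulr_ge0 ?invr_ge0 ?(ltW (lk1 k)) ?(ltW b0).
have nr0 : 0 <= n%:R * r by rewrite mulr_ge0 ?ler0n// ltW.
have nr : n%:R * r <= n%:R * r * l by rewrite ler_peMr.
split => //.
- move=> k; rewrite divr_ge0 ?(ltW b1)/= ?addr_ge0 ?mulr_ge0 ?(ltW b0)//.
  by rewrite ler_pM2r ?invr_gt0//; have := lkb k; lra.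
- move=> k; have rhoE : 1 - rho k = b * (1 - lk k) / (1 + b).
    by rewrite /rho; field; rewrite gt_eqF.
  have rho0 : 0 <= rho k.
    by rewrite divr_ge0 ?(ltW b1)/= ?addr_ge0 ?mulr_ge0 ?(ltW b0).
  have rho2 : b * (1 - lk k) / 2 <= 1 - rho k ^+ 2.
    have -> : 1 - rho k ^+ 2 = (1 - rho k) * (1 + rho k) by ring.
    have -> : 1 + rho k = (2 + b + b * lk k) / (1 + b).
      by rewrite /rho; field; rewrite gt_eqF.
    rewrite rhoE -(ler_pM2r (mulr_gt0 b1 b1)).
    have -> : b * (1 - lk k) / (1 + b) * ((2 + b + b * lk k) / (1 + b)) *
      ((1 + b) * (1 + b)) = b * (1 - lk k) / 2 * (2 * (2 + b + b * lk k)).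
      by field; rewrite gt_eqF.
    have blk : 0 <= b * lk k by rewrite mulr_ge0 ?(ltW b0).
    by rewrite ler_wpM2l ?divr_ge0 ?mulr_ge0 ?(ltW b0) ?(ltW (lk1 k))//; nra.
  apply: le_trans (_ : b * (1 - lk k) / 2 * B k <= _); last by rewrite ler_wpM2r.
  rewrite le_eqVlt; apply/orP; left; apply/eqP; rewrite /B; field.
  by rewrite gt_eqF.
- have s2 : \sum_k l' k <= 2 * n%:R.
    rewrite -[n in leRHS]card_ord mulr_natr -sumr_const.
    by apply: ler_sum => k _; case/andP: (l'02 k).
  apply: le_trans nrl.
  apply: (@le_trans _ _ (N%:R * (64 * b ^+ 2 * (2 * n%:R)))).
    by rewrite ler_wpM2l// ler_wpM2l// mulr_ge0 ?sqr_ge0.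
  rewrite bE (_ : _ * _ = 128 * (n%:R * r) * (N%:R * x)); last by ring.
  rewrite (_ : 512 * _ = 128 * (n%:R * r) * (4 * l)); last by ring.
  by rewrite ler_wpM2l// mulr_ge0.
- have Bk k : B k <= 208 * r.
    have xl : x <= b * (1 - lk k) by have := lkb k; clear; lra.
    have c0 : 0 <= 104 * b ^+ 2 by rewrite mulr_ge0 ?sqr_ge0 ?ler0n.
    rewrite ler_pdivrMr// -(ler_pM2l b0).
    rewrite (_ : b * (208 * r * _) = r * (b * (1 - lk k)) * 208); last by ring.
    apply: (@le_trans _ _ (r * x * 208)).
      rewrite (_ : b * _ = 104 * b ^+ 2 * l' k); last by ring.
      rewrite (_ : r * x * 208 = 104 * b ^+ 2 * 2); last by rewrite bE; ring.
      by rewrite ler_wpM2l//; case/andP: (l'02 k).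
    by apply: ler_wpM2r; [exact: ler0n|rewrite ler_pM2l].
  apply: (@le_trans _ _ (\sum_(k < n) 208 * r)); first by apply: ler_sum.
  rewrite sumr_const card_ord -mulr_natr; clear -nr nrl nr0; lra.
Qed.

End step_constants.

(** * The algorithm in the eigenbasis *)

Section rotated_samples.
Context {R : realType} {disp : measure_display} {T : measurableType disp}.
Variables (P : probability T R) (n : nat) (Z : T -> 'cV[R]_n.+1).
Variables (M : 'M[R]_n.+1) (l : 'I_n.+1 -> R).
Hypotheses (mZ : measurable_fun setT Z) (sgZ : isotropic_subgaussian P Z)
  (MM : M *m M^T = diag_mx (\row_i l i)).

Let dotp_rot (a b : 'cV[R]_n.+1) : dotp (M^T *m a) (M^T *m b) = \sum_i l i * (a i 0 * b i 0).
Proof.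
rewrite dotp_mull trmxK mulmxA MM dotpE; apply: eq_bigr => i _.
by rewrite mul_diag_mx !mxE; ring.
Qed.

Let dotpM (a : 'cV[R]_n.+1) w : dotp a (M *m Z w) = dotp (M^T *m a) (Z w).
Proof. by rewrite dotp_mull trmxK. Qed.

Lemma measurable_rotated : measurable_fun setT (fun w => M *m Z w).
Proof. exact: measurable_fun_mulmx. Qed.

Lemma rotated_integrable_prod a b :
  itg P (fun w => dotp a (M *m Z w) * dotp b (M *m Z w)).
Proof.
have := subgaussian_integrable_prod mZ sgZ (M^T *m a) (M^T *m b).
by congr (itg P _); apply/funext => w; rewrite !dotpM.
Qed.

Lemma rotated_covariance a b :
  Ex P (fun w => dotp a (M *m Z w) * dotp b (M *m Z w)) = \sum_i l i * (a i 0 * b i 0).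
Proof.
rewrite -dotp_rot -(isotropic_covariance mZ sgZ); congr Ex.
by apply/funext => w; rewrite !dotpM.
Qed.

Lemma rotated_moment a k : (0 < k)%N -> itg P (fun w => dotp a (M *m Z w) ^+ (4 * k)) /\
  Ex P (fun w => dotp a (M *m Z w) ^+ (4 * k)) <=
    (16 * k%:R ^+ 2) ^+ k * (\sum_i l i * a i 0 ^+ 2) ^+ (2 * k).
Proof.
move=> k0; have := subgaussian_moment mZ sgZ (M^T *m a) k0.
rewrite dotp_rot; congr (itg P _ /\ Ex P _ <= _ * _ ^+ _).
- by apply/funext => w; rewrite !dotpM.
- by apply/funext => w; rewrite !dotpM.
Qed.

End rotated_samples.

Section pca_in_eigenbasis.
Context {R : realType} (n : nat).
Variables (V : 'M[R]_n.+1) (lam1 beta : R).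
Hypotheses (VV : V^T *m V = 1%:M) (lam10 : 0 < lam1) (beta0 : 0 < beta).
Implicit Types (u y v : 'cV[R]_n.+1).

(* Projecting onto the sphere only rescales, so in the eigenbasis the algorithm
   follows, up to a scalar, the linear recursion without projection. *)
Definition eigen_coords u y : Prop := dotp u u = 1 /\ exists c, u = c *: (V *m y).

Lemma dotp_orth y v : dotp (V *m y) (V *m v) = dotp y v.
Proof. by rewrite dotp_mull mulmxA VV mul1mx. Qed.

Lemma mulmx_orthr : V *m V^T = 1%:M. Proof. exact: mulmx1C. Qed.

Lemma proj_sphere_unit (w : 'cV[R]_n.+1) : w != 0 -> dotp (proj_sphere w) (proj_sphere w) = 1.
Proof.
move=> w0; rewrite /proj_sphere dotpZl dotpZr mulrA -invfM -expr2 /enorm sqr_sqrtr ?dotp_ge0//.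
by rewrite mulVf// dotp_eq0.
Qed.

(** Dividing the samples by [sqrt lam1] and multiplying [beta] by [lam1] leaves the rank-one update
    unchanged, while the factor [1 / (1 + b)] and the projection go into the scalar. With [y']
    nonzero, the projected vector is nonzero. *)
Lemma eigen_coords_step u y (x : 'cV[R]_n.+1) :
  let y' := pca_step (beta * lam1) y ((Num.sqrt lam1)^-1 *: V^T *m x) in
  eigen_coords u y -> y' != 0 ->
  eigen_coords (proj_sphere (u + beta *: (x *m x^T *m u))) y'.
Proof.
move=> y' [u1 [c uE]] y'0.
have b1 : 1 + beta * lam1 != 0 by rewrite gt_eqF// addr_gt0// mulr_gt0.
have Vy' : (1 + beta * lam1) *: (V *m y') = V *m y + beta *: (x *m x^T *m (V *m y)).
  rewrite /y' /pca_step -scalemxAr scalerA divff// scale1r mulmxDr; congr (_ + _).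
  rewrite mulmx_outer -scalemxAl -!scalemxAr mulmxA mulmx_orthr mul1mx !scalerA.
  congr (_ *: _); rewrite dotpZl dotp_mull trmxK.
  have s2 : (Num.sqrt lam1)^-1 * (Num.sqrt lam1)^-1 = lam1^-1.
    by rewrite -invfM -expr2 sqr_sqrtr// ltW.
  rewrite [LHS](_ : _ = beta * lam1 * ((Num.sqrt lam1)^-1 * (Num.sqrt lam1)^-1) *
     dotp x (V *m y)); last by ring.
  by rewrite s2 mulfK ?gt_eqF.
have wE : u + beta *: (x *m x^T *m u) = (c * (1 + beta * lam1)) *: (V *m y').
  rewrite -scalerA Vy' scalerDr -uE; congr (_ + _).
  by rewrite uE -scalemxAr !scalerA mulrC.
have c0 : c != 0.
  apply/eqP => c0; move: u1; rewrite uE c0 scale0r dotp0r => /eqP.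
  by rewrite eq_sym oner_eq0.
split.
  apply: proj_sphere_unit; rewrite wE scaler_eq0 mulf_eq0 (negbTE c0) (negbTE b1)/=.
  by rewrite -dotp_eq0 dotp_orth dotp_eq0.
by exists ((enorm (u + beta *: (x *m x^T *m u)))^-1 * (c * (1 + beta * lam1)));
  rewrite /proj_sphere {2}wE scalerA.
Qed.

Lemma sqr_tan_eigen_coords u y : eigen_coords u y -> y 0 0 != 0 ->
  sqr_tan (angle u (V *m delta_mx 0 0)) = (tail_sq y / y 0 0 ^+ 2)%:E.
Proof.
move=> [u1 [c uE]] y00; set e := V *m _.
have ue : dotp u e = c * y 0 0 by rewrite uE dotpZl dotp_orth dotpC dotp_delta.
have sq1 : (c * y 0 0) ^+ 2 + c ^+ 2 * tail_sq y = 1.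
  by rewrite -u1 {1 2}uE dotpZl dotpZr dotp_orth dotp_tail_sq; ring.
have c0 : c != 0.
  apply/eqP => c0; move: sq1; rewrite c0 mul0r expr0n/= mul0r addr0 => /eqP.
  by rewrite eq_sym oner_eq0.
have le1 : `|c * y 0 0| <= 1.
  rewrite -(@ler_pXn2r _ 2) ?nnegrE// real_normK ?num_real// expr1n -sq1 lerDl.
  by rewrite mulr_ge0 ?sqr_ge0 ?tail_sq_ge0.
move: le1; rewrite ler_norml => le1; have [_ ca] := acos_def le1.
rewrite /sqr_tan /angle ue ca mulf_eq0 (negbTE c0) (negbTE y00)/=; congr EFin.
rewrite /tan sin_acos// ca expr_div_n sqr_sqrtr; last first.
  by rewrite -sq1 addrAC subrr add0r mulr_ge0 ?sqr_ge0 ?tail_sq_ge0.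
rewrite -{1}sq1 addrAC subrr add0r; field.
by rewrite c0 y00.
Qed.

End pca_in_eigenbasis.

(** * The starting point in the eigenbasis *)

Section initial_state.
Context {R : realType} (n : nat).
Variables (V : 'M[R]_n.+1) (t : R).
Hypotheses (VV : V^T *m V = 1%:M) (t0 : 0 < t).
Let e : 'cV[R]_n.+1 := V *m delta_mx 0 0.

Definition good_start (u : 'cV[R]_n.+1) : bool := (dotp u u == 1) && (t < `|dotp e u|).

(** A bad start is sent to the dead state 0, so that it counts as killed at time 0. *)
Definition start_coords (u : 'cV[R]_n.+1) : 'cV[R]_n.+1 :=
  if good_start u then (dotp e u)^-1 *: (V^T *m u) else 0.

Let coord0 u : (V^T *m u) 0 0 = dotp e u.
Proof. by rewrite /e dotp_mull dotp_delta. Qed.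

Let dotp_neq0 u : good_start u -> dotp e u != 0.
Proof. by case/andP => _; rewrite -normr_gt0; exact: lt_trans. Qed.

Lemma start_coords0 u : good_start u -> start_coords u 0 0 = 1.
Proof.
by move=> gu; rewrite /start_coords gu mxE coord0 mulVf// dotp_neq0.
Qed.

Lemma alive_start_coords u : alive (start_coords u) = good_start u.
Proof.
have [gu|gu] := boolP (good_start u).
  by rewrite /alive start_coords0// subrr normr0; lra.
by rewrite /start_coords (negbTE gu) alive0.
Qed.

Lemma tail_sq_start_coords u : tail_sq (start_coords u) <= t ^- 2.
Proof.
have [gu|gu] := boolP (good_start u); last first.
  rewrite /start_coords (negbTE gu) /tail_sq big1 => [|i _]; last by rewrite mxE expr0n.
  by rewrite invr_ge0 sqr_ge0.
have y0 := start_coords0 gu; have e0 := dotp_neq0 gu.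
have /andP[/eqP u1 te] := gu.
have yy : dotp (start_coords u) (start_coords u) = (dotp e u) ^- 2.
  rewrite /start_coords gu dotpZl dotpZr dotp_mull trmxK mulmxA.
  by rewrite mulmx_orthr// mul1mx u1 mulr1 -invfM.
apply: (@le_trans _ _ (dotp (start_coords u) (start_coords u))).
  by rewrite dotp_tail_sq lerDr sqr_ge0.
have e2 : 0 < dotp e u ^+ 2 by rewrite exprn_even_gt0.
rewrite yy lef_pV2 ?posrE ?e2 ?(exprn_gt0 _ t0)//.
rewrite -[leRHS]real_normK ?num_real//; apply: lerXn2r; rewrite ?nnegrE //; exact: ltW.
Qed.

Lemma start_coordsP u : good_start u -> eigen_coords V u (start_coords u).
Proof.
move=> gu; have e0 := dotp_neq0 gu; have /andP[/eqP u1 _] := gu; split => //.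
exists (dotp e u); rewrite /start_coords gu -scalemxAr scalerA divff// scale1r.
by rewrite mulmxA mulmx_orthr// mul1mx.
Qed.

Lemma measurable_good_start : measurable_fun setT good_start.
Proof.
rewrite /good_start; apply: measurable_and.
  by apply: measurable_fun_eqr; mfun.
apply: measurable_fun_ltr; first by mfun.
by apply: measurable_fun_normr; mfun.
Qed.

Lemma measurable_start_coords : measurable_fun setT start_coords.
Proof.
apply: measurable_fun_ifT; [exact: measurable_good_start| |exact: measurable_cst].
apply: measurable_fun_matrix => i j.
rewrite (_ : (fun x => _) = fun u => (dotp e u)^-1 * (V^T *m u) i j); last first.
  by apply/funext => u; rewrite mxE.
apply: measurable_funM; first by apply: measurable_fun_invr; mfun.
by apply: measurable_coord; exact: measurable_fun_mulmx.
Qed.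

End initial_state.

(** * From the killed chain to the iterates *)

Section alignment.
Context {R : realType} {dispZ disp : measure_display}.
Context {TZ : measurableType dispZ} {T : measurableType disp}.
Variables (PZ : probability TZ R) (P : probability T R) (n : nat).
Variables (Z : TZ -> 'cV[R]_n.+1) (X : nat -> T -> 'cV[R]_n.+1) (u0 : T -> 'cV[R]_n.+1).
Variables (S V : 'M[R]_n.+1) (l : 'I_n.+1 -> R) (lam1 beta t : R).
Hypotheses (VV : V^T *m V = 1%:M) (lam10 : 0 < lam1) (beta0 : 0 < beta) (t0 : 0 < t).
Hypotheses (ST : S^T = S) (diagS : V^T *m (S *m S) *m V = lam1 *: diag_mx (\row_i l i)).
Hypotheses (l0 : l 0 = 1) (l01 : forall i, 0 <= l i <= 1).
Hypotheses (mZ : measurable_fun setT Z) (sgZ : isotropic_subgaussian PZ Z).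
Hypotheses (mX : forall j, measurable_fun setT (X j))
  (lawX : forall j, same_law P (X j) PZ (fun w => S *m Z w))
  (indX : mutually_independent P X).
Hypotheses (mu0 : measurable_fun setT u0) (ind0 : independent_of_family P u0 X).

Let A := (Num.sqrt lam1)^-1 *: V^T.
Let b := beta * lam1.
Let y0 w := start_coords V t (u0 w).

Definition eigen_chain := chain (killed_step A b) y0 X.
Let Y := eigen_chain.

Let b0 : 0 < b. Proof. exact: mulr_gt0. Qed.

Let my0 : measurable_fun setT y0.
Proof. exact: (measurableT_comp (measurable_start_coords V t)). Qed.

Let indy0 B E : measurable B -> generated_sigma_algebra X E ->
  (P (y0 @^-1` B `&` E) = P (y0 @^-1` B) * P E)%E.
Proof.
move=> mB gE; rewrite -[y0 @^-1` B]/(u0 @^-1` (start_coords V t @^-1` B)).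
apply: ind0 => //; rewrite -[_ @^-1` _]setTI.
exact: measurable_start_coords.
Qed.

Let MM : (A *m S) *m (A *m S)^T = diag_mx (\row_i l i).
Proof.
rewrite trmx_mul ST /A linearZ/= trmxK -!scalemxAl -!scalemxAr.
rewrite scalerA -invfM -expr2 sqr_sqrtr ?(ltW lam10)//.
by rewrite -mulmxA [S *m _]mulmxA mulmxA diagS scalerA mulVf ?scale1r// gt_eqF.
Qed.

(** [X j] is known only through its law, that of [S Z]; this carries means over to the space of [Z],
    where the one-step estimates are available. *)
Let transfer (f : 'cV[R]_n.+1 -> \bar R) j : measurable_fun setT f -> (forall v, 0 <= f v)%E ->
  (\int[P]_w f (A *m X j w) = \int[PZ]_w f ((A *m S) *m Z w))%E.
Proof.
move=> mf f0; have mA : measurable_fun setT (fun v : 'cV[R]_n.+1 => A *m v).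
  exact: measurable_fun_mulmx.
rewrite (same_law_integral (f := fun v => f (A *m v)) (mX j) _ (lawX j))//.
- by apply: eq_integral => w _; rewrite mulmxA.
- exact: measurable_fun_mulmx.
- exact: (measurableT_comp mf).
Qed.

Let mstep (y : 'cV[R]_n.+1) : measurable_fun setT (pca_step b y).
Proof.
apply: (measurableT_comp (f := fun z => pca_step b z.1 z.2)
  (g := fun v : 'cV[R]_n.+1 => (y, v))); first exact: measurable_pca_step.
exact: measurable_fun_pair.
Qed.

Lemma measurable_eigen_alive m : measurable [set w | alive (Y m w)].
Proof. exact: measurable_alive_chain. Qed.

Lemma eigen_chain_coords m w : alive (Y m w) ->
  eigen_coords V (online_pca beta X u0 m w) (Y m w).
Proof.
elim: m => [|m IHm] aY.
  by apply: start_coordsP => //; rewrite -alive_start_coords.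
have [aYm YE] := killed_chain_alive aY.
rewrite -[Y m.+1 w]/(chain (killed_step A b) y0 X m.+1 w) in aY *.
rewrite YE /=; apply: eigen_coords_step => //; first exact: IHm.
apply/eqP => y'0; move: aY; rewrite YE.
by rewrite -/b -/A y'0 alive0.
Qed.

(** A good start has first coordinate 1, so its potential reduces to [kap] times the tail, at most
    [t^-2], plus the initial [tau], at most [c]. *)
Lemma eigen_chain_survival (x kap c : R) (p N : nat) :
  0 < x -> x <= b -> b <= 1 / 2 -> (forall i, i != 0 -> b * l i <= b - x) ->
  0 < kap <= 1 -> kap * x = 130 * 1600 ^+ 2 * p%:R * b ^+ 2 ->
  160 * n.+1%:R * b ^+ 2 <= x -> n.+1%:R * b <= 1 -> (0 < p)%N ->
  (128 * 1600) ^+ 2 * p%:R ^+ 8 * x <= 1 -> 9 / 4 * (1 + x * N%:R) <= c ->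
  (P [set w | ~~ alive (Y N w)] <=
   P [set w | ~~ good_start V t (u0 w)] + ((4 * (kap * (t ^- 2 + c))) ^+ p)%:E)%E.
Proof.
move=> x0 xb b2 lb /andP[k0 k1] kx h160 db p0 p8 Nc.
have -> : [set w | ~~ good_start V t (u0 w)] = [set w | ~~ alive (y0 w)].
  by apply/seteqP; split => w /=; rewrite alive_start_coords.
have c0 : 0 <= c by apply: le_trans Nc; rewrite mulr_ge0// addr_ge0// mulr_ge0// ltW.
apply: (survival_probability mX my0 indX indy0 (ltW k0) _ (ltW x0)).
- move=> j y tau t9 ay.
  rewrite (transfer (f := fun v => (potential kap (tau - 9 / 4 * x) (pca_step b y v) ^+ p)%:E)).
  + apply: (potential_step (measurable_rotated (A *m S) mZ)
      (rotated_integrable_prod (A *m S) mZ sgZ) (rotated_covariance mZ sgZ MM)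
      (rotated_moment mZ sgZ MM) l0 l01) => //.
  + apply/measurable_EFinP; apply: measurable_funX.
    exact: (measurableT_comp (measurable_potential _ _)).
  + move=> v; rewrite lee_fin exprn_ge0// addr_ge0 ?sqr_ge0// mulr_ge0 ?(ltW k0)//.
    by rewrite addr_ge0 ?tail_sq_ge0//; lra.
- by rewrite mulr_ge0 ?(ltW k0)// addr_ge0// invr_ge0 sqr_ge0.
move=> w; rewrite alive_start_coords// => gw.
rewrite /potential /y0 start_coords0// subrr expr0n/= add0r.
rewrite ler_wpM2l ?(ltW k0)// lerD ?tail_sq_start_coords//.
by apply: le_trans Nc; rewrite mulrDr mulr1 mulrA.
Qed.

Lemma eigen_alive_mono m N w : (m <= N)%N -> alive (Y N w) -> alive (Y m w).
Proof.
elim: N => [|N IHN]; first by rewrite leqn0 => /eqP ->.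
rewrite leq_eqVlt => /orP[/eqP -> //|mN] aY.
by apply: IHN => //; have [] := killed_chain_alive aY.
Qed.

Let tail_sq0 m w : alive (Y m w) ->
  tail_sq (Y m w) / Y m w 0 0 ^+ 2 <= 4 * tail_sq (Y m w).
Proof.
move=> aY; have [h _] := sqr_near1 aY.
have y2 : 0 < Y m w 0 0 ^+ 2 by lra.
rewrite ler_pdivrMr// mulrAC ler_peMl ?tail_sq_ge0//; lra.
Qed.

Lemma eigen_chain_second_moment (rmax : R) (l' B : 'I_n -> R) (N m : nat) :
  let rho k := (1 + b * l (lift 0 k)) / (1 + b) in
  (forall k, 0 < l' k) -> (forall k, l (lift 0 k) <= l' k) ->
  (forall k, 0 <= rho k <= rmax) -> 1 / 2 <= rmax ^+ 2 -> (forall k, 0 <= B k) ->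
  (forall k, 52 * b ^+ 2 * l' k <= (1 - rho k ^+ 2) * B k) ->
  N%:R * (64 * b ^+ 2 * \sum_k l' k) <= 1 -> \sum_k B k <= 1 -> (m <= N)%N ->
  (\int[P]_w (tail_sq (Y m w))%:E <=
   (2 * rmax ^+ 2 ^+ m * t ^- 2 + \sum_k B k)%:E)%E.
Proof.
move=> rho l'0 ll' rhor r2 B0 BE NL B1 mN.
have mc k : measurable_fun setT (fun w => y0 w (lift 0 k) 0 ^+ 2).
  by apply: measurable_funX; apply: measurable_coord.
have ib k : itg P (fun w => y0 w (lift 0 k) 0 ^+ 2).
  apply: (@itg_bounded _ _ _ P _ (t ^- 2)) => // w.
  rewrite ger0_norm ?sqr_ge0//; apply: le_trans (tail_sq_start_coords VV t0 (u0 w)).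
  rewrite /tail_sq (bigD1 k)//= lerDl; apply: sumr_ge0 => i _; exact: sqr_ge0.
pose alpha0 k := Ex P (fun w => y0 w (lift 0 k) 0 ^+ 2).
have sec j (y : 'cV[R]_n.+1) k : alive y ->
    (\int[P]_w (pca_step b y (A *m X j w) (lift 0 k) 0 ^+ 2)%:E
     <= (rho k ^+ 2 * y (lift 0 k) 0 ^+ 2 + 16 * b ^+ 2 * l' k * dotp y y)%:E)%E.
  move=> ay; rewrite (transfer (f := fun v => (pca_step b y v (lift 0 k) 0 ^+ 2)%:E)).
  - apply: (coord_step_second_moment (measurable_rotated (A *m S) mZ)
      (rotated_integrable_prod (A *m S) mZ sgZ) (rotated_covariance mZ sgZ MM)
      (rotated_moment mZ sgZ MM) l01) => //.
    have [h _] := sqr_near1 ay; have := tail_sq_ge0 y; rewrite dotp_tail_sq; lra.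
  - apply/measurable_EFinP; apply: measurable_funX; exact: measurable_coord.
  - by move=> v; rewrite lee_fin sqr_ge0.
have mom := killed_chain_moments mX my0 indX indy0 (fun k => ltW (l'0 k)) sec
  (fun k => conj (ib k) (lexx (alpha0 k))).
have alpha00 k : 0 <= alpha0 k by apply: Ex_ge0 => w; exact: sqr_ge0.
have rec := coupled_recursion (a := moment_bound b rho l' alpha0) alpha00
  (fun k => ltW (l'0 k)) B0 (ltW b0) rhor r2 (fun _ _ => erefl) BE NL B1 mN.
have im k : itg P (fun w => Y m w (lift 0 k) 0 ^+ 2) by exact: (mom m k).1.
have it : itg P (fun w => tail_sq (Y m w)) by apply: itg_sum.
rewrite ExE// lee_fin /tail_sq Ex_sum//.
apply: le_trans (ler_sum _ (fun k _ => (mom m k).2)) _.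
apply: le_trans rec _; rewrite lerD2r.
apply: ler_wpM2l; first by apply: mulr_ge0 => //; exact/exprn_ge0/sqr_ge0.
rewrite /= -Ex_sum// -(Ex_cst P (t ^- 2)); apply: Ex_le.
- by apply: itg_sum.
- exact: itg_cst.
- by move=> w; exact: (tail_sq_start_coords VV t0 (u0 w)).
Qed.

Lemma integral_sqr_tan (c : R) (N m : nat) : (m <= N)%N ->
  (\int[P]_w (tail_sq (Y m w))%:E <= c%:E)%E ->
  (\int[P]_(w in [set w : T | alive (Y N w)])
      sqr_tan (angle (online_pca beta X u0 m w) (V *m delta_mx 0 0)%R)
   <= (4 * c)%:E)%E.
Proof.
move=> mN Yc; have mA := measurable_eigen_alive N.
have mY : measurable_fun setT (Y m) by exact: measurable_killed_chain.
rewrite (eq_integral (fun w => (tail_sq (Y m w) / Y m w 0 0 ^+ 2)%:E)); last first.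
  move=> w; rewrite inE /= => aN; have am := eigen_alive_mono mN aN.
  apply: sqr_tan_eigen_coords => //; first exact: eigen_chain_coords.
  have [h _] := sqr_near1 am; rewrite -sqrf_eq0 gt_eqF//; lra.
apply: (@le_trans _ _ (\int[P]_(w in [set w : T | alive (Y N w)]) (4 * tail_sq (Y m w))%:E)%E).
  apply: ge0_le_integral => //.
  - by move=> w _; rewrite lee_fin divr_ge0 ?tail_sq_ge0 ?sqr_ge0.
  - apply/measurable_EFinP; apply: measurable_funTS; rewrite /tail_sq.
    apply: measurable_funM; first by mfun.
    by apply: measurable_fun_invr; mfun.
  - by apply/measurable_EFinP; apply: measurable_funTS; rewrite /tail_sq; mfun.
  - by move=> w aN; rewrite lee_fin tail_sq0//; exact: eigen_alive_mono aN.
apply: (@le_trans _ _ (\int[P]_w (4 * tail_sq (Y m w))%:E)%E).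
  apply: ge0_subset_integral => //.
  - by apply/measurable_EFinP; rewrite /tail_sq; mfun.
  - by move=> w _; rewrite lee_fin mulr_ge0 ?tail_sq_ge0.
under eq_integral do rewrite EFinM.
rewrite ge0_integralZl//.
- by rewrite EFinM lee_pmul2l.
- by apply/measurable_EFinP; rewrite /tail_sq; mfun.
- by move=> w _; rewrite lee_fin tail_sq_ge0.
Qed.

End alignment.

(** * Assembling the bound *)

Section spectral_data.
Context {R : realType} (n : nat).
Variables (Sigma S : 'M[R]_n.+1) (lam : n.+1.-tuple R) (ustar : 'cV[R]_n.+1).
Hypotheses (psd : sym_psd Sigma) (spec : spectrum_of Sigma lam).

Lemma spectrum_tail_le (k : nat) : (0 < k < n.+1)%N -> lam`_k <= lam`_1.
Proof.
case/andP => k0 kn; have [srt _] := spec.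
have tr : transitive (>=%R : rel R) by move=> u v w vu uw; exact: le_trans uw vu.
have := sorted_leq_nth tr (fun v => lexx v) 0 srt; apply; rewrite ?inE ?size_tuple//.
exact: leq_ltn_trans kn.
Qed.

Lemma spectral_data : enorm ustar = 1 -> Sigma *m ustar = lam`_0 *: ustar ->
  exists V : 'M[R]_n.+1, [/\ V^T *m V = 1%:M, V *m delta_mx 0 0 = ustar,
    V^T *m Sigma *m V = diag_mx (\row_i lam`_i) & forall i : 'I_n.+1, 0 <= lam`_i].
Proof.
move=> /enorm_eq1 us1 us; have [sym pos] := psd; have [_ chi] := spec.
have [V [VV Ve VS]] := spectral_theorem_head (size_tuple lam) sym chi us1 us.
(* The [i]-th eigenvalue is the quadratic form of [Sigma] at the [i]-th column of [V]. *)
exists V; split=> // i; have := pos (V *m delta_mx i 0).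
rewrite dotp_mull !mulmxA VS dotp_delta mul_diag_mx !mxE !eqxx.
by rewrite mulr1.
Qed.

End spectral_data.

Section final_bounds.
Context {R : realType}.

(** The constant [32 * 216^2] collects 4 from the denominator of [tan^2], 2 from
    [coupled_recursion], 4 from [contraction_power] and [216^2] from [t^-2]. *)
Lemma error_bound (n : nat) (q w delta t2 s : R) : 0 < delta -> delta <= 1 ->
  0 <= w -> q <= 4 * w -> t2 = 216 ^+ 2 * n%:R / delta ^+ 2 -> 0 <= s ->
  4 * (2 * q * t2 + 104 * s) <=
  32 * 216 ^+ 2 * delta ^- 4 * n.+1%:R ^+ 2 * w + 32 * 216 ^+ 2 * s.
Proof.
move=> d0 d1 w0 qw t2E s0.
have [K [KE K1]] : exists K : R, K = 216 ^+ 2 /\ 13 <= K by eexists; split => //; lra.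
rewrite -KE in t2E *.
have dd : delta ^- 2 <= delta ^- 4.
  by rewrite lef_pV2 ?posrE ?exprn_gt0// ler_wiXn2l ?(ltW d0).
have nn : n%:R <= n.+1%:R ^+ 2 :> R.
  by rewrite -natrX ler_nat; apply: leq_trans (leqnSn n) _; rewrite leq_pmulr.
have q1 : 4 * (2 * q * t2) <= 32 * K * delta ^- 4 * n.+1%:R ^+ 2 * w.
  apply: (@le_trans _ _ (32 * K * (delta ^- 2 * n%:R) * w)).
    rewrite t2E (_ : 4 * _ = 8 * K * (delta ^- 2 * n%:R) * q); last by ring.
    rewrite (_ : 32 * K * _ * w = 8 * K * (delta ^- 2 * n%:R) * (4 * w)); last by ring.
    apply: ler_wpM2l => //; rewrite !mulr_ge0 ?invr_ge0 ?exprn_ge0 ?(ltW d0)//.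
    by clear -K1; lra.
  apply: ler_wpM2r => //; rewrite -(mulrA (32 * K)) ler_wpM2l//.
    by clear -K1; lra.
  by apply: ler_pM => //; rewrite invr_ge0 exprn_ge0// ltW.
have s1 : 416 * s <= 32 * K * s by apply: ler_wpM2r => //; clear -K1; lra.
clear -q1 s1; lra.
Qed.

End final_bounds.

Lemma online_pca_tail_bound (R : realType) (G K C : R) (n : nat)
    (Sigma S V : 'M[R]_n.+1) (lam : n.+1.-tuple R)
    (dispZ : measure_display) (TZ : measurableType dispZ)
    (PZ : probability TZ R) (Z : TZ -> 'cV[R]_n.+1)
    (disp : measure_display) (T : measurableType disp)
    (P : probability T R) (X : nat -> T -> 'cV[R]_n.+1)
    (u0 : T -> 'cV[R]_n.+1) (eps beta delta : R) :
  let lam1 := lam`_0 in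
  let lam2 := lam`_1 in
  let r := lam1 ^+ 2 * (lam1 - lam2)^-1 * beta in
  let N s := rescaled_time lam1 lam2 beta s in
  let L0 := log_threshold G K C (9 ^+ 9) in
  let om := r `^ (1 / 2 - 4 * eps) in
  G = 130 * 1600 ^+ 2 -> K = 216 ^+ 2 -> C = (128 * 1600) ^+ 2 ->
  (0 < n)%N -> lam2 < lam1 ->
  V^T *m V = 1%:M -> V^T *m Sigma *m V = diag_mx (\row_i lam`_i) ->
  (forall i : 'I_n.+1, 0 <= lam`_i) ->
  (forall i : 'I_n.+1, i != 0 -> lam`_i <= lam2) ->
  is_psd_sqrt S Sigma ->
  measurable_fun setT Z -> isotropic_subgaussian PZ Z ->
  (forall n, measurable_fun setT (X n)) ->
  (forall n, same_law P (X n) PZ (fun w => S *m Z w)) ->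
  mutually_independent P X ->
  measurable_fun setT u0 -> uniform_on_sphere P u0 ->
  independent_of_family P u0 X ->
  0 < eps < 1 / 8 -> 0 < beta -> 0 < delta -> delta < 1 / 2 ->
  n.+1%:R * r `^ (1 - 2 * eps) <= expR (- L0) * delta ^+ 2 ->
  4 * n.+1%:R * (N 2)%:~R * expR (- 1 * r `^ (- 2 * eps)) <= delta ->
  exists A : set T,
    [/\ measurable A, ((1 - 2 * delta)%:E <= P A)%E &
    forall m : nat, m%:Z <= N 3 ->
      (\int[P]_(w in A) sqr_tan (angle (online_pca beta X u0 m w) (V *m delta_mx 0 0)%R)
       <= (32 * 216 ^+ 2 * delta ^- 4 * n.+1%:R ^+ 2
             * (1 - beta * (lam1 - lam2)) ^+ (2 * m)
           + 32 * 216 ^+ 2 * \sum_(i < n)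
               (lam1 * lam`_i.+1 + lam1 ^+ 2 * om) / (lam1 - lam`_i.+1) * beta)%:E)%E].
Proof.
move=> lam1 lam2 r N L0 om GE KE CE n0 gap VV VS lam_ge0 lam_le [[ST _] SS] mZ sgZ mX lawX
  indX mu0 unif ind0 eps8 beta0 d0 d2 H1 H2.
have lam20 : 0 <= lam2 by exact: (lam_ge0 (Ordinal (n0 : (1 < n.+1)%N))).
have lam10 : 0 < lam1 by exact: le_lt_trans gap.
have G0 : 0 < G by rewrite GE; clear; lra.
have K1 : 1 <= K by rewrite KE; clear; lra.
have C0 : 0 <= C by rewrite CE sqr_ge0.
have D2 : 2 <= n.+1%:R :> R by rewrite ler_nat.
have L01 : 1 <= L0.
  have [h _ _ _] := log_threshold_consts (ltW G0) K1 C0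
    (exprn_ge0 9 (ler0n R 9)) (lexx L0).
  by apply: le_trans h; clear; lra.
set x := beta * (lam1 - lam2).
have := step_size_bounds lam10 lam20 gap beta0 eps8 d0 d2 (n0 : (2 <= n.+1)%N) L01 H1 H2.
rewrite -/r; set b := beta * lam1; rewrite -/x; move: (- ln r) => l.
move=> [rE Ll bE /andP[x0 xb] [br DrL N3x]].
have x0b : 0 < x <= b by rewrite x0.
have [p [kap [p0 kap1 kx h160 [db p8 b2 Bp [Drl l512]]]]] :=
  survival_constants G0 K1 C0 D2 rE Ll bE x0b br DrL d0 d2.
have b0 : 0 < b by exact: lt_le_trans xb.
have r0 : 0 < r by exact: lt_le_trans br.
have l0 : 0 < l by clear -l512; lra.
pose ll (i : 'I_n.+1) := lam`_i / lam1.
have ll0 : ll 0 = 1 by rewrite /ll divff// gt_eqF.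
have llb i : i != 0 -> b * ll i <= b - x.
  move=> i0; rewrite /ll /b (_ : beta * lam1 * _ = beta * lam`_i); last first.
    by field; rewrite gt_eqF.
  rewrite (_ : _ - x = beta * lam2); last by rewrite /x; ring.
  by rewrite ler_pM2l// lam_le.
have ll_ge0 i : 0 <= ll i by rewrite divr_ge0 ?lam_ge0 ?ltW.
have ll01 i : 0 <= ll i <= 1.
  rewrite ll_ge0/=; have [->|i0] := eqVneq i 0; first by rewrite ll0.
  by rewrite ler_pdivrMr// mul1r (le_trans (lam_le _ i0))// ltW.
have diagS : V^T *m (S *m S) *m V = lam1 *: diag_mx (\row_i ll i).
  rewrite SS VS -linearZ/=; congr diag_mx; apply/rowP => i.
  by rewrite !mxE mulrC divfK// gt_eqF.
pose e : 'cV[R]_n.+1 := V *m delta_mx 0 0.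
have e1 : dotp e e = 1 by rewrite dotp_orth// dotp_delta mxE !eqxx.
have n00 : 0 < n%:R :> R by rewrite ltr0n.
(* The threshold for which the loss in [uniform_anticoncentration] is exactly [delta]. *)
pose t := delta / (216 * Num.sqrt n%:R).
have sn0 : 0 < 216 * Num.sqrt n%:R :> R.
  by apply: mulr_gt0; [clear; lra|rewrite sqrtr_gt0].
have t0 : 0 < t by exact: divr_gt0.
have t2E : t ^- 2 = 216 ^+ 2 * n%:R / delta ^+ 2.
  by rewrite /t expr_div_n invf_div exprMn sqr_sqrtr// ltW.
have good : ((1 - delta)%:E <= P [set w | good_start V t (u0 w)])%E.
  have := uniform_anticoncentration mu0 unif n0 e1 t0.
  rewrite (_ : 216 * t * _ = delta); first by [].
  by rewrite /t mulrAC mulrCA mulfV ?mulr1 ?gt_eqF.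
have [NN NNx mNN] : exists2 NN : nat, NN%:R * x <= 4 * l &
    forall m : nat, m%:Z <= N 3 -> (m <= NN)%N.
  move: N3x; rewrite -/(N 3); move: (N 3) => N3 N3x.
  have [N3_ge0|N3_lt0] := lerP 0 N3.
    exists `|N3|%N; first by rewrite -[_%:R]/(`|N3|%N%:Z%:~R) gez0_abs.
    by move=> m; rewrite -{1}(gez0_abs N3_ge0).
  exists 0%N; first by rewrite mul0r mulr_ge0// ltW.
  by move=> m m3; have := le_lt_trans m3 N3_lt0.
have surv : (P [set w | ~~ good_start V t (u0 w)] + ((4 * (kap * (t ^- 2 + 10 * l))) ^+ p)%:E
    <= (2 * delta)%:E)%E.
  have mg : measurable [set w | good_start V t (u0 w)].
    apply: measurable_set_pred; apply: (measurableT_comp (measurable_good_start V t)).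
    exact: mu0.
  rewrite (_ : [set w | ~~ _] = ~` [set w | good_start V t (u0 w)]); last first.
    by apply/seteqP; split => w /= /negP.
  rewrite probability_setC// (_ : 2 * delta = delta + delta); last by ring.
  rewrite EFinD; apply: leeD.
    by rewrite leeBlDr ?fin_num_measure// -leeBlDl// -EFinB.
  rewrite lee_fin; apply: le_trans Bp.
  have [k0 _] := andP kap1.
  have c0 : 0 <= t ^- 2 + 10 * l.
    by apply: addr_ge0; [rewrite invr_ge0 sqr_ge0|apply: mulr_ge0 => //; exact: ltW].
  have Bpos : 0 <= 4 * (kap * (t ^- 2 + 10 * l)).
    by apply: mulr_ge0 => //; apply: mulr_ge0 => //; exact: ltW.
  have BB : 4 * (kap * (t ^- 2 + 10 * l)) <= 4 * (kap * (K * n.+1%:R / delta ^+ 2 + 10 * l)).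
    rewrite ler_pM2l// ler_pM2l// lerD2r t2E KE ler_pM2r ?invr_gt0 ?exprn_gt0//.
    by rewrite ler_wpM2l ?sqr_ge0// ler_nat.
  by apply: lerXn2r => //; rewrite nnegrE // (le_trans Bpos).
have x_le : x <= b by [].
have Nc : 9 / 4 * (1 + x * NN%:R) <= 10 * l.
  by rewrite mulrC in NNx; clear -NNx l512; lra.
have dead : (P [set w | ~~ alive (eigen_chain X u0 V lam1 beta t NN w)] <= (2 * delta)%:E)%E.
  apply: le_trans surv.
  apply: (eigen_chain_survival VV lam10 beta0 t0 ST diagS ll0 ll01 mZ sgZ mX lawX indX
    mu0 ind0 x0 xb b2 llb kap1 _ h160 db p0 _ Nc); first by rewrite -GE.
  by rewrite -CE.
pose Aev := [set w | alive (eigen_chain X u0 V lam1 beta t NN w)].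
have mA : measurable Aev by exact: measurable_eigen_alive.
exists Aev; split => //.
  move: dead; rewrite (_ : [set w | ~~ _] = ~` Aev); last first.
    by apply/seteqP; split => w /= /negP.
  by rewrite probability_setC// leeBlDr ?fin_num_measure// -leeBlDl// -EFinB.
move=> m /mNN mN.
have mx : m%:R * x <= 4 * l.
  by apply: le_trans NNx; rewrite ler_pM2r// ler_nat.
have rl0 : 0 < r * l by exact: mulr_gt0.
have rl2 : 2 * (r * l) <= n.+1%:R * r * l by rewrite -mulrA ler_pM2r.
have r_rl : r <= r * l by rewrite ler_peMr ?(ltW r0)//; clear -l512; lra.
have r8 : r <= 1 / 8 by clear -rl0 rl2 r_rl Drl; lra.
have rl16 : 16 * (r * l) <= 1 by clear -rl0 rl2 Drl; lra.
have [rm2 rmm] := contraction_power x0 xb br r8 rl16 mx.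
have om01 : 0 < om <= 1.
  rewrite powR_gt0//= -(powRr0 r); apply: ger_powR.
    by rewrite r0/=; clear -r8; lra.
  by case/andP: eps8; clear; lra.
(* The weight must be positive even if [lam_k = 0]. Adding [om], which is at most 1 as
   [eps < 1 / 8], produces the second term in the numerators of the final sum. *)
pose l' (k : 'I_n) := ll (lift 0 k) + om.
have l'0 k : 0 < l' k.
  by case/andP: om01 => o0 _; rewrite ltr_wpDl.
have l'2 k : 0 <= l' k <= 2.
  rewrite ltW//=; case/andP: om01 => _ o1; have /andP[_] := ll01 (lift 0 k).
  by move=> lk1; exact: lerD lk1 o1.
have ll' k : ll (lift 0 k) <= l' k.
  by rewrite /l' lerDl; case/andP: om01 => /ltW.
have l1 : 1 <= l by clear -l512; lra.
have b1 : b <= 1 by clear -b2; lra.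
have nDrl : 512 * (n%:R * r * l) <= 1.
  apply: le_trans Drl; rewrite ler_pM2l; last by clear; lra.
  by rewrite ler_pM2r// ler_pM2r// ler_nat.
have llbk k : b * ll (lift 0 k) <= b - x by apply: llb; rewrite eq_sym neq_lift.
have [rho1 B0 BE NB SB] := noise_budget x0 xb br bE l1 b1 nDrl NNx
  (fun k => ll_ge0 (lift 0 k)) llbk l'2.
have := eigen_chain_second_moment VV lam10 beta0 t0 ST diagS ll01 mZ sgZ mX lawX indX
  mu0 ind0 l'0 ll' rho1 rm2 B0 BE NB SB mN.
move=> /(integral_sqr_tan VV lam10 beta0 t0 mX mu0 mN)/le_trans; apply.
rewrite lee_fin.
set s := \sum_(i < n) _ in SB *.
have -> : \sum_(i < n) (lam1 * lam`_i.+1 + lam1 ^+ 2 * om) / (lam1 - lam`_i.+1) * beta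
    = \sum_(k < n) b * l' k / (1 - ll (lift 0 k)).
  apply: eq_bigr => k _; rewrite /l' /ll /b /=.
  have := lam_le (lift 0 k); rewrite eq_sym neq_lift => /(_ isT)/le_lt_trans/(_ gap).
  rewrite -[lam`_(lift 0 k)]/(lam`_k.+1) -/lam1 => lk.
  by field; rewrite gt_eqF// subr_eq0 gt_eqF.
have -> : s = 104 * \sum_(k < n) b * l' k / (1 - ll (lift 0 k)).
  by rewrite /s mulr_sumr; apply: eq_bigr => k _; rewrite !mulrA.
apply: error_bound => //.
- by clear -d2; lra.
- by rewrite exprM exprn_ge0 ?sqr_ge0.
- by apply: sumr_ge0 => k _; have := B0 k; rewrite -!mulrA pmulr_rge0//; clear; lra.
Qed.

Theorem theorem2 (R : realType) :
  exists b2 C3 C4 : R, [/\ 0 < b2, 0 < C3, 0 < C4 &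
  forall (d : nat) (Sigma S : 'M[R]_d) (lam : d.-tuple R) (ustar : 'cV[R]_d)
         (dispZ : measure_display) (TZ : measurableType dispZ)
         (PZ : probability TZ R) (Z : TZ -> 'cV[R]_d)
         (disp : measure_display) (T : measurableType disp)
         (P : probability T R) (X : nat -> T -> 'cV[R]_d)
         (u0 : T -> 'cV[R]_d) (eps beta delta : R),
  let lam1 := lam`_0 in
  let lam2 := lam`_1 in
  let r := lam1 ^+ 2 * (lam1 - lam2)^-1 * beta in
  let N s := rescaled_time lam1 lam2 beta s in
  let u := online_pca beta X u0 in
  (2 <= d)%N ->
  sym_psd Sigma -> spectrum_of Sigma lam -> lam2 < lam1 ->
  enorm ustar = 1 -> Sigma *m ustar = lam1 *: ustar ->
  is_psd_sqrt S Sigma ->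
  measurable_fun setT Z -> isotropic_subgaussian PZ Z ->
  (forall n, measurable_fun setT (X n)) ->
  (forall n, same_law P (X n) PZ (fun w => S *m Z w)) ->
  mutually_independent P X ->
  measurable_fun setT u0 -> uniform_on_sphere P u0 ->
  independent_of_family P u0 X ->
  0 < eps < 1 / 8 -> 0 < beta -> 0 < delta ->
  d%:R * r `^ (1 - 2 * eps) <= b2 * delta ^+ 2 ->
  4 * d%:R * (N 2)%:~R * expR (- C3 * r `^ (- 2 * eps)) <= delta ->
  exists A : set T,
    [/\ measurable A, ((1 - 2 * delta)%:E <= P A)%E &
    forall n : nat, N 2 <= n%:Z <= N 3 ->
      (\int[P]_(w in A) sqr_tan (angle (u n w) ustar)
       <= (C4 * delta ^- 4 * d%:R ^+ 2
             * (1 - beta * (lam1 - lam2)) ^+ (2 * n)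
           + C4 * \sum_(1 <= k < d)
               (lam1 * lam`_k + lam1 ^+ 2 * r `^ (1 / 2 - 4 * eps))
                 / (lam1 - lam`_k) * beta)%:E)%E]].
Proof.
pose L0 : R := log_threshold (130 * 1600 ^+ 2) (216 ^+ 2) ((128 * 1600) ^+ 2) (9 ^+ 9).
(* With [b2 = exp (- L0)] the first step-size condition forces [ln (1 / r) >= L0], which exceeds all
   constants met on the way. *)
exists (expR (- L0)), 1, (32 * 216 ^+ 2).
have C40 : 0 < 32 * 216 ^+ 2 :> R by clear; lra.
split => //; first exact: expR_gt0.
move=> [//|[//|n]] Sigma S lam ustar dispZ TZ PZ Z disp T P X u0 eps beta delta
  lam1 lam2 r N u _ psd spec gap us1 us sqS mZ sgZ mX lawX indX mu0 unif ind0 eps8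
  beta0 d0 H1 H2.
have [V [VV Ve VS lam_ge0]] := spectral_data psd spec us1 us.
have lam_le (i : 'I_n.+2) : i != 0 -> lam`_i <= lam2.
  by move=> i0; apply: (spectrum_tail_le spec); rewrite ltn_ord lt0n i0.
have sumE : \sum_(1 <= k < n.+2) (lam1 * lam`_k + lam1 ^+ 2 * r `^ (1 / 2 - 4 * eps)) /
      (lam1 - lam`_k) * beta =
    \sum_(i < n.+1) (lam1 * lam`_i.+1 + lam1 ^+ 2 * r `^ (1 / 2 - 4 * eps)) /
      (lam1 - lam`_i.+1) * beta.
  by rewrite big_add1 big_mkord.
have [d2|d2] := ltP delta (1 / 2).
  have [A [mA PA intA]] := online_pca_tail_bound erefl erefl erefl (ltn0Sn n) gap VV VS
    lam_ge0 lam_le sqS mZ sgZ mX lawX indX mu0 unif ind0 eps8 beta0 d0 d2 H1 H2.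
  exists A; split => // m /andP[_ m3]; rewrite sumE -Ve.
  exact: intA.
exists set0; split; first exact: measurable0.
  by rewrite measure0 lee_fin; lra.
move=> m _; rewrite integral_set0 lee_fin addr_ge0//.
  apply: mulr_ge0; last by rewrite exprM; exact/exprn_ge0/sqr_ge0.
  apply: mulr_ge0; last exact: sqr_ge0.
  by apply: mulr_ge0; [exact: ltW|rewrite invr_ge0 exprn_ge0// ltW].
rewrite sumE mulr_ge0 ?(ltW C40)//; apply: sumr_ge0 => i _.
have lami : lam`_i.+1 <= lam2 by exact: (lam_le (lift 0 i)).
have lami0 : 0 <= lam`_i.+1 by exact: (lam_ge0 (lift 0 i)).
rewrite mulr_ge0 ?(ltW beta0)// divr_ge0// ?subr_ge0; last first.
  by rewrite (le_trans lami)// ltW.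
rewrite addr_ge0// mulr_ge0 ?powR_ge0 ?sqr_ge0//.
exact: (lam_ge0 0).
Qed.
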